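(* Let $k\geq 2$ be an integer. For all integers $n$ with $3k\leq n\leq 2k^{2}-k+2$, $$ar(n, kC_{3})\leq\left\lfloor\frac{(n-k+2)^{2}}{4}\right\rfloor+(k-2)(n-k+2)+\binom{k-2}{2}+(k-1)^{2}-\frac{n-3k}{2}+1.$$
   Context: An edge-coloring of a graph assigns a color to each edge; an edge-colored graph is rainbow if all colors on its edges are distinct. For a positive integer $n$ and a graph $F$, the anti-Ramsey number $ar(n,F)$ is the maximum number of colors in an edge-coloring of the complete graph $K_n$ containing no rainbow copy of $F$. $kC_3$ denotes the graph consisting of $k$ vertex-disjoint triangles. *)

(* Defs.v *)
From mathcomp Require Import all_boot.

Set Implicit Arguments.
Unset Strict Implicit.
Unset Printing Implicit Defensive.

Record sgraph := SGraph {
  vertex :> finType;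
  adj : rel vertex;
  adj_sym : symmetric adj;
  adj_irrefl : irreflexive adj }.

Definition edges (G : sgraph) : {set {set G}} :=
  [set [set p.1; p.2] | p in [pred p : G * G | adj p.1 p.2]].

Section CompleteGraph.
Variable n : nat.

Fact complete_sym : symmetric [rel x y : 'I_n | x != y].
Proof. by move=> x y; rewrite /= eq_sym. Qed.

Fact complete_irrefl : irreflexive [rel x y : 'I_n | x != y].
Proof. by move=> x; rewrite /= eqxx. Qed.

Definition complete_graph : sgraph := SGraph complete_sym complete_irrefl.
End CompleteGraph.

Section DisjointTriangles.
Variable k : nat.

(* The vertex (i, a) is the a-th vertex of the i-th triangle. *)
Definition triangles_adj : rel ('I_k * 'I_3) :=
  [rel x y | (x.1 == y.1) && (x.2 != y.2)].

Fact triangles_sym : symmetric triangles_adj.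
Proof. by move=> x y; rewrite /triangles_adj /= eq_sym [x.2 == _]eq_sym. Qed.

Fact triangles_irrefl : irreflexive triangles_adj.
Proof. by move=> x; rewrite /triangles_adj /= !eqxx. Qed.

Definition disjoint_triangles : sgraph := SGraph triangles_sym triangles_irrefl.
End DisjointTriangles.

(* A copy of F in G is the image of F under an injective homomorphism; it need
   not be an induced subgraph of G. *)
Definition is_copy (F G : sgraph) (h : {ffun F -> G}) : bool :=
  injectiveb h && [forall x, forall y, adj x y ==> adj (h x) (h y)].

(* An edge-coloring of G is given by a function on all of {set G}, of which only
   the values on edges G are ever used. *)
Section Colorings.
Variables (G : sgraph) (T : eqType) (c : {set G} -> T).

Definition num_colors : nat := size (undup [seq c e | e in edges G]).

Definition rainbow (F : sgraph) (h : {ffun F -> G}) : bool :=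
  dinjectiveb (fun e : {set F} => c (h @: e)) (mem (edges F)).

Definition rainbow_free (F : sgraph) : bool :=
  ~~ [exists h : {ffun F -> G}, is_copy h && rainbow h].
End Colorings.

(* A coloring of K_n uses at most 'C(n, 2) colors, so this palette loses no
   generality: see rainbow_free_leq_ar. When every
   coloring has a rainbow copy of F (e.g. F has a single edge), ar n F is 0. *)
Definition ar (n : nat) (F : sgraph) : nat :=
  \max_(c : {ffun {set complete_graph n} -> 'I_('C(n, 2))} | rainbow_free c F)
    num_colors c.

Lemma card_edges_complete (n : nat) : #|edges (complete_graph n)| = 'C(n, 2).
Proof.
have -> : edges (complete_graph n) = [set e : {set 'I_n} | #|e| == 2].
  apply/setP=> e; rewrite inE; apply/imsetP/cards2P => [[[x y]]|[x [y [xy ->]]]].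
    by rewrite inE /= => xy ->; exists x, y.
  by exists (x, y).
by rewrite card_draws card_ord.
Qed.

Lemma rainbow_free_leq_ar (n : nat) (F : sgraph) (T : eqType)
    (c : {set complete_graph n} -> T) :
  rainbow_free c F -> num_colors c <= ar n F.
Proof.
move=> freec; set G := complete_graph n.
pose s := undup [seq c e | e in edges G].
have sz_s : size s <= 'C(n, 2).
  by rewrite (leq_trans (size_undup _)) // size_map -cardE card_edges_complete.
have c_s e : e \in edges G -> c e \in s.
  by move=> Ee; rewrite mem_undup; apply/mapP; exists e; rewrite ?mem_enum.
case: (posnP 'C(n, 2)) => [C0|].
  by rewrite /num_colors -/s; move: sz_s; rewrite C0 leqn0 => /eqP->.
rewrite /ar; case: 'C(n, 2) sz_s => // m sz_s _.
pose d := [ffun e : {set G} => inord (index (c e) s) : 'I_m.+1].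
have dE : {in edges G &, forall e1 e2, (d e1 == d e2) = (c e1 == c e2)}.
  move=> e1 e2 /c_s s1 /c_s s2; rewrite !ffunE -val_eqE /=.
  rewrite !inordK ?(leq_trans _ sz_s) ?ltnS ?index_mem //.
  apply/eqP/eqP => [eq12|->//].
  by rewrite -(nth_index (c e1) s1) eq12 nth_index.
have edge_im (h : {ffun F -> G}) e :
    is_copy h -> e \in edges F -> h @: e \in edges G.
  case/andP=> _ /forallP hom /imsetP[[x y]]; rewrite inE /= => xy ->.
  apply/imsetP; exists (h x, h y); last by rewrite /= imsetU1 imset_set1.
  by rewrite inE; have /forallP/(_ y)/implyP/(_ xy) := hom x.
have freed : rainbow_free d F.
  apply: contra freec => /existsP[h /andP[copyh /dinjectiveP rain]].
  apply/existsP; exists h; rewrite copyh; apply/dinjectiveP=> e1 e2 E1 E2 /eqP.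
  by rewrite -dE ?edge_im // => /eqP; apply: rain.
apply: leq_trans (leq_bigmax_cond d freed).
rewrite /num_colors -/s -(size_map (fun x => inord (index x s) : 'I_m.+1)).
apply: uniq_leq_size => [|i /mapP[x]].
  rewrite map_inj_in_uniq ?undup_uniq // => x y sx sy /(congr1 val) /=.
  rewrite !inordK ?(leq_trans _ sz_s) ?ltnS ?index_mem // => eqxy.
  by rewrite -(nth_index x sx) eqxy nth_index.
rewrite /s !mem_undup => /mapP[e Ee ->] ->.
by apply/mapP; exists e; rewrite // ffunE.
Qed.

Lemma ar_attained (n : nat) (F : sgraph) :
  0 < ar n F ->
  exists2 c : {set complete_graph n} -> 'I_('C(n, 2)),
    rainbow_free c F & num_colors c = ar n F.
Proof.
rewrite /ar; pose P (c : {ffun {set complete_graph n} -> 'I_('C(n, 2))}) :=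
  rainbow_free c F.
case: (pickP P) => [c0 Pc0 _|P0]; last by rewrite big_pred0.
have [|c Pc ->] := @eq_bigmax_cond _ P (fun c => num_colors c).
  by apply/card_gt0P; exists c0.
by exists c.
Qed.

(* Main.v *)
(* Choosing one edge of each colour gives a rainbow graph with as many edges as there are colours,
   and a missing edge can be added to a rainbow graph at the cost of at most one other edge, the
   one of the same colour. Let k = j + 1, and suppose that a rainbow graph g has more edges than the
   bound while no rainbow graph of the colouring has k disjoint triangles. By induction on j, g can
   be modified without losing edges so as to contain a set L of j disjoint triangles. By induction
   on n, the degrees in g are large, and so are the degree sums of adjacent vertices; hence the
   vertices outside L carry a matching M that misses at most one of them. If an edge of M sends at
   least five edges to a triangle T of L, every other edge of M sends few, so that M sends at most
   4|M| edges to T. For n - 3k even and positive this contradicts the degrees. For n - 3k odd and at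
   least 3, it forces M to span a complete bipartite graph, and adding edges inside its two sides
   shows that g has too few edges. The cases n = 3k and n = 3k + 1 are settled by counting edges
   between pairs of triangles, except n = 7, which is a finite verification: after at most two
   exchanges of edges, two disjoint triangles appear. *)

Require Import Defs.
From Stdlib Require Import Classical.
From mathcomp Require Import all_boot all_order all_algebra.
From mathcomp Require Import zify lra.

Set Implicit Arguments.
Unset Strict Implicit.
Unset Printing Implicit Defensive.

(** Up to its last terms the bound counts the edges of a complete graph on [k - 2] vertices joined
    to a balanced complete bipartite graph on the other [n - k + 2]. The excess
    [(k-1)^2 - (n-3k)/2 + 1] falls by one half per added vertex and reaches 1 exactly at
    [n = 2k^2 - k + 2]. Lowering [k] shortens this range, so the induction leaves it; hence
    thresholds are proved for all [n >= 3k], with the difference cut off at zero. The obstacle is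
    that inserting an edge may destroy a triangle of the packing or an edge of the matching. Two
    devices absorb this. Packings are sought in any rainbow graph of the colouring, and maximality
    of a matching is assumed over all rainbow graphs with enough edges, so both remain usable after
    an exchange. And only one edge is lost, so among alternatives with no edge in common one
    survives. Edges are counted as ordered adjacent pairs, which avoids halves until the end. *)

Lemma count_ge2 (T : eqType) (a b : T) (p : pred T) s :
  a != b -> a \in s -> b \in s -> p a -> p b -> 1 < count p s.
Proof.
move=> ab sa sb pa pb.
have -> : 2 = size [:: a; b] by [].
rewrite -size_filter; apply: uniq_leq_size; first by rewrite /= inE ab.
by move=> x; rewrite !inE mem_filter => /orP[] /eqP->; apply/andP.
Qed.

Lemma count_le2 (T : eqType) (a b : T) (p : pred T) s :
  uniq s -> (forall x, p x -> x \in [:: a; b]) -> count p s <= 2.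
Proof.
move=> Us pab; have -> : 2 = size [:: a; b] by [].
rewrite -size_filter; apply: uniq_leq_size; first exact: filter_uniq.
by move=> x; rewrite mem_filter => /andP[/pab].
Qed.

Lemma sum_nat_le (I : eqType) (s : seq I) (f : I -> nat) c :
  {in s, forall i, f i <= c} -> \sum_(i <- s) f i <= c * size s.
Proof.
elim: s => [|i s IH] fc; first by rewrite big_nil.
rewrite big_cons /= mulnS leq_add ?fc ?mem_head // IH // => k sk.
by rewrite fc // inE sk orbT.
Qed.

Lemma sum_nat_ge (I : eqType) (s : seq I) (f : I -> nat) c :
  {in s, forall i, c <= f i} -> c * size s <= \sum_(i <- s) f i.
Proof.
elim: s => [|i s IH] fc; first by rewrite muln0.
rewrite big_cons /= mulnS leq_add ?fc ?mem_head // IH // => k sk.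
by rewrite fc // inE sk orbT.
Qed.

Lemma sum_nat_tight (I : eqType) (s : seq I) (f : I -> nat) c :
  {in s, forall i, f i <= c} -> c * size s <= \sum_(i <- s) f i ->
  {in s, forall i, f i = c}.
Proof.
elim: s => [|i s IH] // fc; rewrite big_cons /= mulnS => le.
have fi := fc i (mem_head _ _).
have fs : {in s, forall k, f k <= c} by move=> k sk; apply: fc; rewrite inE sk orbT.
have sle := sum_nat_le fs.
move=> k; rewrite inE => /orP[/eqP->|sk]; first by lia.
by apply: IH => //; lia.
Qed.

(** * Lists of pairs and triples, flattened to lists of vertices *)

Definition vs2 (V : Type) (M : seq (V * V)) := flatten [seq [:: m.1; m.2] | m <- M].
Definition vs3 (V : Type) (L : seq (V * V * V)) :=
  flatten [seq [:: t.1.1; t.1.2; t.2] | t <- L].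

Section Lists.
Variable V : eqType.
Implicit Types (M : seq (V * V)) (L : seq (V * V * V)).

Lemma vs3_cat L1 L2 : vs3 (L1 ++ L2) = vs3 L1 ++ vs3 L2.
Proof. by rewrite /vs3 map_cat flatten_cat. Qed.

Lemma vs2_perm M1 M2 : perm_eq M1 M2 -> perm_eq (vs2 M1) (vs2 M2).
Proof. by move=> p; apply/perm_flatten/perm_map. Qed.

Lemma vs3_perm L1 L2 : perm_eq L1 L2 -> perm_eq (vs3 L1) (vs3 L2).
Proof. by move=> p; apply/perm_flatten/perm_map. Qed.

Lemma size_vs2 M : size (vs2 M) = 2 * size M.
Proof. by elim: M => //= m M; rewrite /vs2 /= => ->; lia. Qed.

Lemma size_vs3 L : size (vs3 L) = 3 * size L.
Proof. by elim: L => //= m L; rewrite /vs3 /= => ->; lia. Qed.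

Lemma mem_vs2 M m : m \in M -> (m.1 \in vs2 M) && (m.2 \in vs2 M).
Proof.
move=> Mm; apply/andP; split; apply/flattenP; exists [:: m.1; m.2];
  by rewrite ?inE ?eqxx ?orbT //; apply/mapP; exists m.
Qed.

Lemma mem_vs3 L t : t \in L ->
  [&& t.1.1 \in vs3 L, t.1.2 \in vs3 L & t.2 \in vs3 L].
Proof.
move=> Lt; apply/and3P; split; apply/flattenP; exists [:: t.1.1; t.1.2; t.2];
  by rewrite ?inE ?eqxx ?orbT //; apply/mapP; exists t.
Qed.

Lemma sum_vs2 M (f : V -> nat) :
  \sum_(x <- vs2 M) f x = \sum_(m <- M) (f m.1 + f m.2).
Proof.
rewrite /vs2 big_flatten big_map; apply: eq_bigr => m _.
by rewrite !big_cons big_nil /= addn0.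
Qed.

Lemma sum_vs3 L (f : V -> nat) :
  \sum_(x <- vs3 L) f x = \sum_(t <- L) (f t.1.1 + f t.1.2 + f t.2).
Proof.
rewrite /vs3 big_flatten big_map; apply: eq_bigr => m _.
by rewrite !big_cons big_nil /= addn0 addnA.
Qed.

Lemma vs3_take L n : {subset vs3 (take n L) <= vs3 L}.
Proof. by rewrite -[in vs3 L](cat_take_drop n L) vs3_cat => x; rewrite mem_cat => ->. Qed.

End Lists.

(** * Rainbow graphs and triangle packings *)

Section Rainbow.
Variables (V D : eqType) (col : V -> V -> D).
Hypothesis colC : forall x y, col x y = col y x.
Implicit Types (g h : rel V) (U W Z : seq V) (M : seq (V * V)) (L : seq (V * V * V)).

Definition same_edge (x y z w : V) : bool :=
  (x == z) && (y == w) || (x == w) && (y == z).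

Definition rainbow_rel g :=
  [/\ symmetric g, irreflexive g &
      forall x y z w, g x y -> g z w -> col x y = col z w -> same_edge x y z w].

Definition deg g U x : nat := \sum_(y <- U) g x y.
(** Twice the number of edges inside [U], each edge being met from both ends. *)
Definition E2 g U : nat := \sum_(x <- U) deg g U x.
Definition tri g (t : V * V * V) : bool :=
  [&& g t.1.1 t.1.2, g t.1.1 t.2 & g t.1.2 t.2].
Definition adj2 g (m : V * V) : bool := g m.1 m.2.

(* The rainbow graph is not fixed: missing edges may be traded for edges of the same colour. *)
Definition has_packing U k := exists g L,
  [/\ rainbow_rel g, all (tri g) L, uniq (vs3 L), {subset vs3 L <= U} & k <= size L].

Lemma E2_pairs g U : E2 g U = count (fun p => g p.1 p.2) [seq (a, b) | a <- U, b <- U].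
Proof. by rewrite /E2 -sum1_count [RHS]big_mkcond [RHS]big_allpairs /=;
  apply: eq_bigr => x _; apply: eq_bigr => y _; case: (g x y). Qed.

Definition extend U h g : rel V := fun x y =>
  h x y || g x y && ~~ has (fun p => h p.1 p.2 && (col p.1 p.2 == col x y)) [seq (a, b) | a <- U, b <- U].

Lemma mem_pairs U x y : (x \in U) -> (y \in U) -> (x, y) \in [seq (a, b) | a <- U, b <- U].
Proof. by move=> Ux Uy; apply/allpairsP; exists (x, y). Qed.

(** The edges of [g] that give way have pairwise different colours, each the colour of an edge of
    [h], so no more edges are lost than gained. In ordered pairs: a lost pair has the colour of at
    least two pairs of [h], and a pair of [h] has the colour of at most two pairs of [g]. *)
Lemma extend_rainbow U g h : uniq U -> rainbow_rel g -> rainbow_rel h ->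
  (forall x y, h x y -> (x \in U) && (y \in U)) ->
  rainbow_rel (extend U h g) /\ E2 g U <= E2 (extend U h g) U.
Proof.
move=> UU [gS gI gR] [hS hI hR] hU.
have hasC x y : has (fun p => h p.1 p.2 && (col p.1 p.2 == col y x)) [seq (a, b) | a <- U, b <- U]
   = has (fun p => h p.1 p.2 && (col p.1 p.2 == col x y)) [seq (a, b) | a <- U, b <- U].
  by apply: eq_has => p; rewrite [col y x]colC.
split.
  split=> [x y|x|x y z w].
  - by rewrite /extend hS gS hasC.
  - by rewrite /extend hI gI.
  rewrite /extend => /orP[h1|/andP[g1 n1]] /orP[h2|/andP[g2 n2]] e.
  - exact: hR.
  - case/hasP: n2; exists (x, y); last by rewrite /= h1 e eqxx.
    by have /andP[] := hU _ _ h1; apply: mem_pairs.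
  - case/hasP: n1; exists (z, w); last by rewrite /= h2 e eqxx.
    by have /andP[] := hU _ _ h2; apply: mem_pairs.
  - exact: gR.
rewrite !E2_pairs; set P := [seq _ | _ <- _, _ <- _].
have UP : uniq P by apply: allpairs_uniq => // -[a b] [c d].
set C := fun p : V * V => has (fun q => h q.1 q.2 && (col q.1 q.2 == col p.1 p.2)) P.
(* Pairs of [h] block their own colour, so the two parts of the extension are disjoint. *)
have -> : count (fun p => extend U h g p.1 p.2) P =
   count (fun p => h p.1 p.2) P + count (fun p => g p.1 p.2 && ~~ C p) P.
  rewrite -(@count_predUI _ (fun p => h p.1 p.2)).
  rewrite [X in _ = _ + X](_ : _ = 0) ?addn0 //.
  apply/eqP; rewrite -leqn0 leqNgt -has_count; apply/hasPn=> p Pp /=.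
  apply/negP => /and3P[hp _ /hasP[]]; exists p => //.
  by rewrite hp eqxx.
have -> : count (fun p => g p.1 p.2) P =
   count (fun p => g p.1 p.2 && C p) P + count (fun p => g p.1 p.2 && ~~ C p) P.
  elim: (P) => //= p s ->; case: (g _ _) => //=; case: (C p) => /=; lia.
rewrite leq_add2r.
suff : 2 * count (fun p => g p.1 p.2 && C p) P <= 2 * count (fun p => h p.1 p.2) P by lia.
set A := [seq p <- P | g p.1 p.2 && C p]; set B := [seq p <- P | h p.1 p.2].
rewrite -!size_filter -/A -/B.
pose r (p q : V * V) := col q.1 q.2 == col p.1 p.2.
apply: (@leq_trans (\sum_(p <- A) \sum_(q <- B) r p q)).
  apply: sum_nat_ge => p; rewrite mem_filter => /andP[/andP[gp /hasP[q Pq /andP[hq cq]]] Pp].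
  have -> : \sum_(q0 <- B) r p q0 = count (r p) B.
    by rewrite -sum1_count [RHS]big_mkcond; apply: eq_bigr => i _; case: (r p i).
  apply: (@count_ge2 _ q (q.2, q.1)).
  - apply/negP => /eqP e; have e1 : q.1 = q.2 by rewrite {1}e.
    by move: hq; rewrite e1 hI.
  - by rewrite mem_filter hq.
  - rewrite mem_filter /= hS hq; have /andP[] := hU _ _ hq => *; exact: mem_pairs.
  - exact: cq.
  - by rewrite /r /= colC.
rewrite exchange_big /=; apply: sum_nat_le => q; rewrite mem_filter => /andP[hq Pq].
have -> : \sum_(i <- A) r i q = count (fun p => r p q) A.
  by rewrite -sum1_count [RHS]big_mkcond; apply: eq_bigr => i _; case: (r i q).
case E : [seq p <- A | r p q] => [|p s]; first by rewrite -size_filter E.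
have : p \in [seq p <- A | r p q] by rewrite E mem_head.
rewrite !mem_filter => /andP[rp /andP[/andP[gp _] _]].
have -> : count (fun p => r p q) A = count (fun p' => r p' q && g p'.1 p'.2) A.
  by apply: eq_in_count => p'; rewrite mem_filter => /andP[/andP[-> _] _]; rewrite andbT.
apply: (@count_le2 _ p (p.2, p.1)); first by rewrite filter_uniq.
move=> p' /andP[rp' gp']; have := gR _ _ _ _ gp' gp.
rewrite -(eqP rp) -(eqP rp') => /(_ erefl); rewrite !inE /same_edge.
by case: p' {rp' gp'} => a b; case: p {rp gp E} => c d /=; rewrite !xpair_eqE.
Qed.

(** The exchange of a single edge: [h] consists of [u v] alone. *)
Lemma ar_swap U g u v : uniq U -> rainbow_rel g -> u \in U -> v \in U -> u != v ->
  exists g', [/\ rainbow_rel g', E2 g U <= E2 g' U, g' u v &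
    forall x y, g x y -> col x y != col u v -> g' x y].
Proof.
move=> UU rg Uu Uv uv; pose h : rel V := fun x y => same_edge x y u v.
have hP x y : h x y -> (x = u /\ y = v) \/ (x = v /\ y = u).
  by move=> /orP[] /andP[/eqP-> /eqP->]; [left|right].
have rh : rainbow_rel h.
  split=> [x y|x|x y z w].
  - by rewrite /h /same_edge orbC [(x == v) && _]andbC [(x == u) && _]andbC.
  - by apply/negP => /hP[] [-> e]; move: uv; rewrite e eqxx.
  - by move=> /hP[] [-> ->] /hP[] [-> ->] _; rewrite /same_edge !eqxx ?orbT.
have hU x y : h x y -> (x \in U) && (y \in U) by move=> /hP[] [-> ->]; apply/andP.
have [rg' E] := extend_rainbow UU rg rh hU.
exists (extend U h g); split=> //; first by rewrite /extend /h /same_edge !eqxx.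
move=> x y gxy c; rewrite /extend gxy /=; apply/orP; right.
apply/hasPn => -[a b] _ /=; apply/negP => /andP[/hP[] [-> ->]]; rewrite 1?[col v u]colC => e;
  by rewrite eq_sym e in c.
Qed.

Lemma rainbow_rel_neq g x y : rainbow_rel g -> g x y -> x != y.
Proof. by move=> [_ gI _]; apply: contraTneq => ->; rewrite gI. Qed.

Lemma deg_perm g U U' x : perm_eq U U' -> deg g U x = deg g U' x.
Proof. by move=> p; rewrite /deg (perm_big _ p). Qed.

Lemma E2_perm g U U' : perm_eq U U' -> E2 g U = E2 g U'.
Proof.
move=> p; rewrite /E2 (perm_big _ p) /=.
by apply: eq_bigr => x _; apply: deg_perm.
Qed.

Lemma E2_cons g U v : rainbow_rel g -> E2 g (v :: U) = E2 g U + 2 * deg g U v.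
Proof.
move=> [gS gI _]; rewrite /E2 big_cons {1}/deg big_cons gI add0n -/(deg g U v).
have -> : \sum_(x <- U) deg g (v :: U) x = \sum_(x <- U) (g v x + deg g U x).
  by apply: eq_bigr => x _; rewrite /deg big_cons gS.
by rewrite big_split /= -/(deg g U v); lia.
Qed.

Lemma deg_cons_self g U v : rainbow_rel g -> deg g (v :: U) v = deg g U v.
Proof. by move=> [_ gI _]; rewrite /deg big_cons gI. Qed.

(** [F] is twice a number of edges, so [F + 2] means one edge more. *)
Definition edge_threshold j n F := forall U g, uniq U -> size U = n -> rainbow_rel g ->
  F + 2 <= E2 g U -> has_packing U j.+1.

Lemma has_packing_sub U U' k : {subset U <= U'} -> has_packing U k -> has_packing U' k.
Proof. by move=> s [g [L [a b c d e]]]; exists g, L; split=> // x /d/s. Qed.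

(** A packing found after deleting [x] would serve in [U], so the rest stays within the smaller
    threshold and the edges at [x] make up the difference. *)
Lemma min_deg j n F F1 U g x : edge_threshold j n F1 -> ~ has_packing U j.+1 -> uniq U ->
  size U = n.+1 -> rainbow_rel g -> F + 2 <= E2 g U -> x \in U -> F < F1 + 2 * deg g U x.
Proof.
move=> th nok UU sU rg le Ux.
have p := perm_to_rem Ux; rewrite (E2_perm _ p) E2_cons // in le.
rewrite (deg_perm _ _ p) deg_cons_self //.
case: (leqP (F1 + 2) (E2 g (rem x U))) => [h|]; last by lia.
case: nok; apply: (has_packing_sub (U := rem x U)); first exact: mem_rem.
by apply: th h => //; [rewrite rem_uniq|rewrite size_rem // sU].
Qed.

(** As for one vertex; the edge [x y] occurs in both degrees, which gives the extra 2. *)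
Lemma pair_deg j n F F1 U g x y : edge_threshold j n F1 -> ~ has_packing U j.+1 -> uniq U ->
  size U = n.+2 -> rainbow_rel g -> F + 2 <= E2 g U -> x \in U -> y \in U -> g x y ->
  F + 2 < F1 + 2 * (deg g U x + deg g U y).
Proof.
move=> th nok UU sU rg le Ux Uy gxy; have [gS gI _] := rg.
have nxy := rainbow_rel_neq rg gxy.
have p1 := perm_to_rem Ux; have Uy' : y \in rem x U by rewrite mem_rem_uniq // !inE eq_sym nxy.
have p2 := perm_to_rem Uy'; set U2 := rem y (rem x U) in p2.
have p : perm_eq U [:: x, y & U2] by rewrite (perm_trans p1) // perm_cons.
rewrite (E2_perm _ p) !E2_cons // in le.
rewrite !(deg_perm _ _ p) /deg !big_cons !gI [g y x]gS gxy.
rewrite /deg big_cons gxy in le.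
case: (leqP (F1 + 2) (E2 g U2)) => [h|]; last by lia.
case: nok; apply: (has_packing_sub (U := U2)); first by move=> z /mem_rem/mem_rem.
by apply: th h => //; [rewrite !rem_uniq|rewrite !size_rem // sU].
Qed.

Definition picks x0 W (I : seq (nat * nat * nat)) :=
  [seq (nth x0 W i.1.1, nth x0 W i.1.2, nth x0 W i.2) | i <- I].

(* Every local contradiction is an instance of this: the triangles of [L] outside a small
   list [W] of vertices, plus the triangles on [W] with indices [I], would be a packing. *)
Lemma no_repl U k x0 g W I R L :
  ~ has_packing U k -> uniq U -> perm_eq U (W ++ R ++ vs3 L) -> rainbow_rel g ->
  all (tri g) L -> uniq (vs3 I) && all (fun i => i < size W) (vs3 I) ->
  k <= size I + size L -> ~~ all (tri g) (picks x0 W I).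
Proof.
move=> nok UU p rg tL /andP[uI bI] le; apply/negP => tI; apply: nok.
exists g, (picks x0 W I ++ L).
have e : vs3 (picks x0 W I) = [seq nth x0 W i | i <- vs3 I].
  by elim: (I) => //= i s; rewrite /vs3 /= => ->.
have sub : {subset vs3 (picks x0 W I) <= W}.
  by rewrite e => x /mapP[i /(allP bI) h ->]; apply: mem_nth.
have := UU; rewrite (perm_uniq p) cat_uniq => /and3P[uW dW /[!cat_uniq] /and3P[_ _ uL]].
split=> //.
- by rewrite all_cat tI tL.
- rewrite vs3_cat cat_uniq uL andbT; apply/andP; split.
    rewrite e map_inj_in_uniq // => i i' /(allP bI) hi /(allP bI) hi' /eqP.
    by rewrite nth_uniq // => /eqP.
  apply/hasPn => x xL; apply/negP => /sub xW.
  by case/hasP: dW; exists x => //; rewrite mem_cat xL orbT.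
- move=> x; rewrite (perm_mem p) vs3_cat !mem_cat => /orP[/sub ->//|->].
  by rewrite !orbT.
- by rewrite size_cat size_map.
Qed.

End Rainbow.

(** * Growing a matching outside the packing *)

Section Config.
Variables (V D : eqType) (col : V -> V -> D).
Hypothesis colC : forall x y, col x y = col y x.
Implicit Types (g h : rel V) (U W Z : seq V) (M : seq (V * V)) (L : seq (V * V * V)).
Local Notation rainbow_rel := (rainbow_rel col).
Local Notation has_packing := (has_packing col).

Lemma vs2_cons (m : V * V) M : vs2 (m :: M) = m.1 :: m.2 :: vs2 M.
Proof. by []. Qed.
Lemma vs3_cons (t : V * V * V) L : vs3 (t :: L) = t.1.1 :: t.1.2 :: t.2 :: vs3 L.
Proof. by []. Qed.

Lemma vs2_rem (m : V * V) M : m \in M -> perm_eq (vs2 M) (m.1 :: m.2 :: vs2 (rem m M)).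
Proof. by move=> mM; apply: (vs2_perm (perm_to_rem mM)). Qed.
Lemma vs3_rem (t : V * V * V) L : t \in L ->
  perm_eq (vs3 L) (t.1.1 :: t.1.2 :: t.2 :: vs3 (rem t L)).
Proof. by move=> tL; apply: (vs3_perm (perm_to_rem tL)). Qed.

(** The state of the argument: matching edges, uncovered vertices and triangles partition [U],
    disjointness being inherited from [uniq U]. *)
Definition config U g M Z L :=
  [/\ perm_eq U (vs2 M ++ Z ++ vs3 L), all (adj2 g) M & all (tri g) L].

Definition em g x (m : V * V) : nat := g x m.1 + g x m.2.
Definition et g x (t : V * V * V) : nat := g x t.1.1 + g x t.1.2 + g x t.2.

Lemma config_perm U g M M' Z Z' L L' : perm_eq M M' -> perm_eq Z Z' -> perm_eq L L' ->
  config U g M Z L -> config U g M' Z' L'.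
Proof.
move=> pM pZ pL [p aM aL]; split; last 2 first.
- by rewrite -(perm_all _ pM).
- by rewrite -(perm_all _ pL).
by rewrite (perm_trans p) // perm_cat ?vs2_perm // perm_cat // vs3_perm.
Qed.

Lemma deg_config U g M Z L x : config U g M Z L ->
  deg g U x = \sum_(m <- M) em g x m + \sum_(z <- Z) g x z + \sum_(t <- L) et g x t.
Proof.
move=> [p _ _]; rewrite (deg_perm _ _ p) /deg !big_cat /= sum_vs2 sum_vs3.
by rewrite addnA.
Qed.

Lemma size_config U g M Z L : config U g M Z L ->
  size U = 2 * size M + size Z + 3 * size L.
Proof. by move=> [p _ _]; rewrite (perm_size p) !size_cat size_vs2 size_vs3 addnA. Qed.

End Config.

(** Lists are permutations of each other when every predicate counts equally on them, and such
    counts reduce to linear arithmetic. *)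
Ltac perm_count :=
  let q := fresh in apply/permP => q;
  repeat match goal with H : is_true (perm_eq _ _) |- _ => try move: (permP H q); clear H end;
  clear; rewrite ?(vs2_cons, vs3_cons, count_cat) /= ?(vs2_cons, vs3_cons, count_cat) /=;
  repeat match goal with |- context [nat_of_bool ?b] => generalize (nat_of_bool b); intro end;
  repeat match goal with |- context [count ?b ?s] => generalize (count b s); intro end;
  lia.

Section Grow.
Variables (V D : eqType) (col : V -> V -> D).
Hypothesis colC : forall x y, col x y = col y x.
Implicit Types (g h : rel V) (W Z : seq V) (M : seq (V * V)) (L : seq (V * V * V)).
Local Notation rainbow_rel := (rainbow_rel col).
Variables (U : seq V) (j m0 n0 : nat).
Hypothesis UU : uniq U.
Hypothesis nok : ~ has_packing col U j.+1.
(** Maximality of [n0] over all rainbow graphs with enough edges, so that it still applies after an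
    exchange. *)
Hypothesis mx : forall g M Z L, rainbow_rel g -> m0 <= E2 g U -> config U g M Z L ->
  size L = j -> size M = n0.+1 -> False.

Section Fixed.
Variable g : rel V.
Hypotheses (rg : rainbow_rel g) (Eg : m0 <= E2 g U).
Let gS : symmetric g. Proof. by case: rg. Qed.

Lemma grow_z M x y Z L : config U g M (x :: y :: Z) L -> size L = j -> size M = n0 ->
  ~~ g x y.
Proof.
move=> [p aM aL] sL sM; apply/negP => gxy.
apply: (@mx g ((x, y) :: M) Z L) => //=; last by rewrite sM.
by split; [perm_count | rewrite /= /adj2 gxy | ].
Qed.

(** There is no triangle on [m] with [x] or [y], so each of them sees at most one end; and no
    augmenting path through [m], so they cannot see different ends. *)
Lemma grow_m M m x y Z L : config U g (m :: M) (x :: y :: Z) L -> size L = j ->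
  (size M).+1 = n0 ->
  em g x m + em g y m <= 2 /\
  (em g x m + em g y m = 2 -> g x m.1 && g y m.1 || g x m.2 && g y m.2).
Proof.
case: m => u v [p /= /andP[guv aM] aL] sL sM; rewrite /adj2 /= in guv.
have T a b : perm_eq [:: x; y] [:: a; b] -> ~~ (g a u && g a v).
  move=> pab; have := @no_repl _ _ _ U _ x g [:: a; u; v] [:: (0, 1, 2)] ([:: b] ++ vs2 M ++ Z)
    L nok UU _ rg aL isT _.
  rewrite /= /tri /= guv andbT andbT => -> //; [perm_count | by rewrite sL].
have A a b : perm_eq [:: x; y] [:: a; b] -> ~~ (g a u && g b v).
  move=> pab; apply/negP => /andP[h1 h2].
  apply: (@mx g ((a, u) :: (b, v) :: M) Z L) => //=; last by rewrite sM.
  by split; [perm_count | rewrite /= /adj2 /= h1 h2 | ].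
have pyx : perm_eq [:: x; y] [:: y; x] by rewrite (perm_catC [:: x] [:: y]).
move: (T _ _ (perm_refl _)) (T _ _ pyx) (A _ _ (perm_refl _)) (A _ _ pyx).
by rewrite /em /=; case: (g x u); case: (g x v); case: (g y u); case: (g y v).
Qed.

(** If one of [x], [y] sees two vertices of [t] and the other sees the third, the first one takes
    over that side and the second is matched with the third vertex. Five edges always allow this. *)
Lemma grow_t M t x y Z L : config U g M (x :: y :: Z) (t :: L) -> (size L).+1 = j ->
  size M = n0 -> et g x t + et g y t <= 4.
Proof.
case: t => [[p q] r] [pU aM /= /andP[/and3P[/= gpq gpr gqr] aL]] sL sM.
have A a b u v w : perm_eq [:: x; y] [:: a; b] -> perm_eq [:: p; q; r] [:: u; v; w] ->
   g u v -> ~~ [&& g a u, g a v & g b w].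
  move=> pab puvw guv; apply/negP => /and3P[h1 h2 h3].
  apply: (@mx g ((b, w) :: M) Z ((a, u, v) :: L)) => //=; last by rewrite sM.
  by split; [perm_count | rewrite /= /adj2 h3 | rewrite /= /tri /= h1 h2 guv].
have pyx : perm_eq [:: x; y] [:: y; x] by rewrite (perm_catC [:: x] [:: y]).
have p1 : perm_eq [:: p; q; r] [:: p; r; q] by perm_count.
have p2 : perm_eq [:: p; q; r] [:: q; r; p] by perm_count.
move: (A _ _ _ _ _ (perm_refl _) (perm_refl _) gpq) (A _ _ _ _ _ pyx (perm_refl _) gpq).
move: (A _ _ _ _ _ (perm_refl _) p1 gpr) (A _ _ _ _ _ pyx p1 gpr).
move: (A _ _ _ _ _ (perm_refl _) p2 gqr) (A _ _ _ _ _ pyx p2 gqr).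
rewrite /et /=; case: (g x p); case: (g x q); case: (g x r);
  by case: (g y p); case: (g y q); case: (g y r).
Qed.

(** Uncovered vertices are pairwise nonadjacent, so only the matching and the packing contribute. *)
Lemma grow_deg M x y Z L : config U g M (x :: y :: Z) L -> size L = j -> size M = n0 ->
  deg g U x + deg g U y =
  \sum_(m <- M) (em g x m + em g y m) + \sum_(t <- L) (et g x t + et g y t).
Proof.
move=> c sL sM; rewrite !(deg_config _ c) !big_split /= !big_cons.
have [gS' gI _] := rg; rewrite !gI [g y x]gS (negbTE (grow_z c sL sM)).
have Z0 w : w = x \/ w = y -> \sum_(z <- Z) g w z = 0.
  move=> xy; apply/eqP; rewrite -leqn0 -(mul0n (size Z)); apply: sum_nat_le => z zZ.
  have pz := perm_to_rem zZ.
  rewrite leqn0 eqb0.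
  case: xy => ->.
    apply: (@grow_z M x z (y :: rem z Z) L) => //; apply: config_perm c => //.
    by perm_count.
  apply: (@grow_z M y z (x :: rem z Z) L) => //; apply: config_perm c => //.
  by perm_count.
by rewrite !Z0; [lia | right | left].
Qed.

Lemma grow_em M x y Z L : config U g M (x :: y :: Z) L -> size L = j -> size M = n0 ->
  {in M, forall m, em g x m + em g y m <= 2 /\
    (em g x m + em g y m = 2 -> g x m.1 && g y m.1 || g x m.2 && g y m.2)}.
Proof.
move=> c sL sM m Mm; have pm := perm_to_rem Mm.
apply: (@grow_m (rem m M) m x y Z L) => //; first exact: config_perm c.
by rewrite -sM (perm_size pm).
Qed.

Lemma grow_et M x y Z L : config U g M (x :: y :: Z) L -> size L = j -> size M = n0 ->
  {in L, forall t, et g x t + et g y t <= 4}.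
Proof.
move=> c sL sM t Lt; have pt := perm_to_rem Lt.
apply: (@grow_t M t x y Z (rem t L)) => //; first exact: config_perm c.
by rewrite -sL (perm_size pt).
Qed.

Lemma grow_bound M x y Z L : config U g M (x :: y :: Z) L -> size L = j -> size M = n0 ->
  deg g U x + deg g U y <= 2 * n0 + 4 * j.
Proof.
move=> c sL sM; rewrite (grow_deg c) //.
have h1 := sum_nat_le (fun m Mm => proj1 (grow_em c sL sM Mm)).
have h2 := sum_nat_le (grow_et c sL sM).
by rewrite -sM -sL leq_add.
Qed.

Lemma grow_tight M x y Z L : config U g M (x :: y :: Z) L -> size L = j -> size M = n0 ->
  2 * n0 + 4 * j <= deg g U x + deg g U y ->
  {in M, forall m, em g x m + em g y m = 2} /\ {in L, forall t, et g x t + et g y t = 4}.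
Proof.
move=> c sL sM; rewrite (grow_deg c) //.
have h1 := sum_nat_le (fun m Mm => proj1 (grow_em c sL sM Mm)).
have h2 := sum_nat_le (grow_et c sL sM).
have t1 := sum_nat_tight (fun m Mm => proj1 (grow_em c sL sM Mm)).
have t2 := sum_nat_tight (grow_et c sL sM).
rewrite -{1}sM -{1}sL => le; split; [apply: t1|apply: t2].
  by rewrite -(leq_add2r (4 * size L)) (leq_trans le) // leq_add2l.
by rewrite -(leq_add2l (2 * size M)) (leq_trans le) // leq_add2r.
Qed.

End Fixed.
End Grow.

(** Two named edges differ because their coincidence would repeat a vertex in a duplicate-free
    list. *)
Ltac same_absurd u :=
  apply/negP => /orP[] /andP[/eqP ? /eqP ?]; subst;
  by move: u; rewrite /= !inE !eqxx ?(orbT, andbF).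

(** * What survives an exchange *)

Section Keep.
Variables (V D : eqType) (col : V -> V -> D).
Implicit Types (g h : rel V) (W Z : seq V) (M : seq (V * V)) (L : seq (V * V * V)).

Definition colT (t : V * V * V) (c : D) :=
  [|| col t.1.1 t.1.2 == c, col t.1.1 t.2 == c | col t.1.2 t.2 == c].

Definition keeps g g' c := forall x y, g x y -> col x y != c -> g' x y.

Lemma keep_same g g' a b x y : rainbow_rel col g -> g a b -> keeps g g' (col a b) -> g x y ->
  ~~ same_edge x y a b -> g' x y.
Proof.
move=> [_ _ gR] gab k gxy; apply: contraR => /negP ng; apply: gR => //.
by apply/eqP; apply: contraT => /k - /(_ gxy).
Qed.

Lemma keepM g g' c M : keeps g g' c -> all (adj2 g) M ->
  ~~ has (fun m => col m.1 m.2 == c) M -> all (adj2 g') M.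
Proof. by move=> k /allP aM /hasPn h; apply/allP => m mM; apply: k; [apply: aM|apply: h]. Qed.

Lemma keepT g g' c t : keeps g g' c -> tri g t -> ~~ colT t c -> tri g' t.
Proof.
move=> k /and3P[a b d]; rewrite /colT !negb_or => /and3P[a' b' d'].
by apply/and3P; split; apply: k.
Qed.

Lemma keepL g g' c L : keeps g g' c -> all (tri g) L ->
  ~~ has (colT^~ c) L -> all (tri g') L.
Proof.
by move=> k /allP aM /hasPn h; apply/allP => m mM; apply: keepT k _ _; [apply: aM|apply: h].
Qed.

Lemma keepM_edge g g' a b M : rainbow_rel col g -> g a b -> keeps g g' (col a b) ->
  a \notin vs2 M -> all (adj2 g) M -> all (adj2 g') M.
Proof.
move=> rg gab k aM /allP gM; apply/allP => m mM.
apply: (keep_same rg gab k); first exact: gM.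
have /andP[m1 m2] := mem_vs2 mM.
by apply: contra aM => /orP[] /andP[/eqP e1 /eqP e2]; rewrite -?e1 // -e2.
Qed.

Lemma keepL_edge g g' a b L : rainbow_rel col g -> g a b -> keeps g g' (col a b) ->
  a \notin vs3 L -> all (tri g) L -> all (tri g') L.
Proof.
move=> rg gab k aL /allP gL; apply/allP => t tL.
have /and3P[g1 g2 g3] := gL t tL; have /and3P[m1 m2 m3] := mem_vs3 tL.
by apply/and3P; split; apply: (keep_same rg gab k) => //;
  apply: contra aL => /orP[] /andP[/eqP e1 /eqP e2]; rewrite -?e1 // -e2.
Qed.

End Keep.

(** * Exactly two uncovered vertices *)

Section Star.
Variables (V D : eqType) (col : V -> V -> D).
Hypothesis colC : forall x y, col x y = col y x.
Implicit Types (g h : rel V) (W Z : seq V) (M : seq (V * V)) (L : seq (V * V * V)).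
Local Notation rainbow_rel := (rainbow_rel col).
Variables (U : seq V) (j m0 n0 : nat).
Hypothesis UU : uniq U.
Hypothesis nok : ~ has_packing col U j.+1.
Hypothesis mx : forall g M Z L, rainbow_rel g -> m0 <= E2 g U -> config U g M Z L ->
  size L = j -> size M = n0.+1 -> False.
Hypothesis dl : forall g x, rainbow_rel g -> m0 <= E2 g U -> x \in U -> n0 + 2 * j <= deg g U x.

Variable g : rel V.
Hypotheses (rg : rainbow_rel g) (Eg : m0 <= E2 g U).
Let gS : symmetric g. Proof. by case: rg. Qed.

(** The minimum degree meets the upper bound for the degree sum of two uncovered vertices, which
    forces equality in every term. *)
Lemma config_tight M x y Z L : config U g M (x :: y :: Z) L -> size L = j -> size M = n0 ->
  {in M, forall m, em g x m + em g y m = 2} /\ {in L, forall t, et g x t + et g y t = 4}.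
Proof.
move=> c sL sM; apply: (grow_tight UU nok mx rg Eg c) => //.
have [p _ _] := c.
have xU : x \in U by rewrite (perm_mem p) mem_cat inE eqxx orbT.
have yU : y \in U by rewrite (perm_mem p) mem_cat !inE eqxx !orbT.
by move: (dl rg Eg xU) (dl rg Eg yU); lia.
Qed.

(** The inserted edge [x y] closes a triangle with [u]. If it costs [p q], the pairs [v p] and [q r]
    lengthen the matching; if it costs another side, [v p q] is a second triangle in place of
    [p q r]. *)
Lemma star_end M x y v u p q r L :
  perm_eq U ([:: x; y; v; u; p; q; r] ++ vs2 M ++ vs3 L) ->
  all (adj2 g) M -> all (tri g) L -> tri g (p, q, r) ->
  g x u -> g y u -> [&& g x p, g x q, g y p, g y q, g v p & g v q] ->
  size L = j.-1 -> 0 < j -> (size M).+1 = n0 -> colT col (p, q, r) (col x y) -> False.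
Proof.
move=> pU aM aL /and3P[/= gpq gpr gqr] gxu gyu /and5P[gxp gxq gyp gyq /andP[gvp gvq]] sL j0 sM.
have uq : uniq [:: x; y; v; u; p; q; r].
  by have := UU; rewrite (perm_uniq pU) cat_uniq => /andP[].
have nM a : a \in [:: x; y; v; u; p; q; r] -> a \notin vs2 M.
  have := UU; rewrite (perm_uniq pU) cat_uniq => /and3P[_ /hasPn h _] aW.
  by apply: contraL aW => aM'; apply: h; rewrite mem_cat aM'.
have nL a : a \in [:: x; y; v; u; p; q; r] -> a \notin vs3 L.
  have := UU; rewrite (perm_uniq pU) cat_uniq => /and3P[_ /hasPn h _] aW.
  by apply: contraL aW => aM'; apply: h; rewrite mem_cat aM' orbT.
have [xU yU] : x \in U /\ y \in U by rewrite !(perm_mem pU) !inE !eqxx !orbT.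
have xy : x != y by move: uq; rewrite /= !inE !negb_or; case/andP => /andP[].
have [g' [rg' Eg' gxy k]] := ar_swap colC UU rg xU yU xy.
have k' : keeps col g g' (col x y) by [].
have le2 : j.+1 <= 2 + j.-1 by move: j0; clear; lia.
case/or3P => /= /eqP c.
- rewrite -c in k'; have kk := keep_same rg gpq k'.
  apply: (mx (g := g') (M := (v, p) :: (q, r) :: M) (Z := [::]) (L := (x, y, u) :: L)) => //=.
  + exact: leq_trans Eg Eg'.
  + split; first by perm_count.
      rewrite /= /adj2 /= !kk //; first by apply: (keepM_edge rg gpq k') => //; rewrite nM ?inE ?eqxx ?orbT.
        by same_absurd uq.
      by same_absurd uq.
    rewrite /= /tri /= gxy !kk //; first by apply: (keepL_edge rg gpq k') => //; rewrite nL ?inE ?eqxx ?orbT.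
      by same_absurd uq.
    by same_absurd uq.
  + by rewrite sL prednK.
  + by rewrite sM.
- rewrite -c in k'; have kk := keep_same rg gpr k'.
  have aL' : all (tri g') L by apply: (keepL_edge rg gpr k') => //; rewrite nL ?inE ?eqxx ?orbT.
  have := @no_repl _ _ _ U j.+1 x g' [:: x; y; v; u; p; q; r] [:: (0, 1, 3); (2, 4, 5)]
     (vs2 M) L nok UU pU rg' aL' isT; rewrite /= sL /tri /= gxy !kk ?andbT //; try by same_absurd uq.
  by move/(_ le2)/negP.
- rewrite -c in k'; have kk := keep_same rg gqr k'.
  have aL' : all (tri g') L by apply: (keepL_edge rg gqr k') => //; rewrite nL ?inE ?eqxx ?orbT.
  have := @no_repl _ _ _ U j.+1 x g' [:: x; y; v; u; p; q; r] [:: (0, 1, 3); (2, 4, 5)]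
     (vs2 M) L nok UU pU rg' aL' isT; rewrite /= sL /tri /= gxy !kk ?andbT //; try by same_absurd uq.
  by move/(_ le2)/negP.
Qed.

(** Any of the leaves [x], [y], [v] can be the one matched with [u]. Tightness for every two of them
    gives two edges from each leaf to the triangle, and leaves with different neighbours there would
    permit the exchange [S]. So all three see the same two vertices, and [star_end] applies. *)
Lemma star M x y v u p q r L :
  perm_eq U ([:: x; y; v; u; p; q; r] ++ vs2 M ++ vs3 L) ->
  all (adj2 g) M -> all (tri g) L -> tri g (p, q, r) -> g x u -> g y u -> g v u ->
  size L = j.-1 -> 0 < j -> (size M).+1 = n0 -> colT col (p, q, r) (col x y) -> False.
Proof.
move=> pU aM aL tp gxu gyu gvu sL j0 sM cT; have /and3P[/= gpq gpr gqr] := tp.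
have S a b c d e f : perm_eq [:: x; y; v] [:: a; b; c] -> perm_eq [:: p; q; r] [:: d; e; f] ->
   g d e -> g c u -> ~~ [&& g a d, g a e & g b f].
  move=> p1 p2 gef gcu; apply/negP => /and3P[h1 h2 h3].
  apply: (@mx g ((c, u) :: (b, f) :: M) [::] ((a, d, e) :: L)) => //=.
  + split; first by perm_count.
      by rewrite /= /adj2 /= gcu h3.
    by rewrite /= /tri /= h1 h2 gef.
  + by rewrite sL prednK.
  + by rewrite sM.
have T a b c : perm_eq [:: x; y; v] [:: a; b; c] -> g c u ->
   et g a (p, q, r) + et g b (p, q, r) = 4.
  move=> p1 gcu; have cf : config U g ((c, u) :: M) [:: a; b] ((p, q, r) :: L).
    split; first by perm_count.
      by rewrite /= /adj2 /= gcu.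
    by rewrite /= tp.
  have sj : size ((p, q, r) :: L) = j by rewrite /= sL prednK.
  by have [_ h] := config_tight cf sj sM; apply: h; exact: mem_head.
have [P1 P2 P3 P4 P5] : [/\ perm_eq [:: x; y; v] [:: x; v; y], perm_eq [:: x; y; v] [:: y; x; v],
  perm_eq [:: x; y; v] [:: y; v; x], perm_eq [:: x; y; v] [:: v; x; y] &
  perm_eq [:: x; y; v] [:: v; y; x]] by clear; split; perm_count.
have [Q1 Q2] : perm_eq [:: p; q; r] [:: p; r; q] /\ perm_eq [:: p; q; r] [:: q; r; p].
  by split; perm_count.
have P0 := perm_refl [:: x; y; v]; have Q0 := perm_refl [:: p; q; r].
have F1 := S _ _ _ _ _ _ P0 Q0 gpq gvu; have F2 := S _ _ _ _ _ _ P0 Q1 gpr gvu.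
have F3 := S _ _ _ _ _ _ P0 Q2 gqr gvu.
have F4 := S _ _ _ _ _ _ P1 Q0 gpq gyu; have F5 := S _ _ _ _ _ _ P1 Q1 gpr gyu.
have F6 := S _ _ _ _ _ _ P1 Q2 gqr gyu.
have T1 := T _ _ _ P0 gvu; have T2 := T _ _ _ P1 gyu; have T3 := T _ _ _ P3 gxu.
have E1 := star_end pU aM aL tp gxu gyu _ sL j0 sM cT.
have pU2 : perm_eq U ([:: x; y; v; u; p; r; q] ++ vs2 M ++ vs3 L).
  by rewrite (perm_trans pU) //; perm_count.
have pU3 : perm_eq U ([:: x; y; v; u; q; r; p] ++ vs2 M ++ vs3 L).
  by rewrite (perm_trans pU) //; perm_count.
have E2 := star_end pU2 aM aL _ gxu gyu _ sL j0 sM.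
have E3 := star_end pU3 aM aL _ gxu gyu _ sL j0 sM.
rewrite /tri /= [g r q]gS gpr gpq gqr in E2; rewrite /tri /= [g q p]gS [g r p]gS gpr gpq gqr in E3.
have /E2 {}E2 : colT col (p, r, q) (col x y) by move: cT; rewrite /colT /= [col r q]colC; do 3 case: (_ == _).
have /E3 {}E3 : colT col (q, r, p) (col x y) 
  by move: cT; rewrite /colT /= [col q p]colC [col r p]colC; do 3 case: (_ == _).
move: E1 (E2 isT) (E3 isT) F1 F2 F3 F4 F5 F6 T1 T2 T3; rewrite /et /=; clear.
case: (g x p); case: (g x q); case: (g x r); case: (g y p); case: (g y q); case: (g y r) => //=;
by case: (g v p); case: (g v q); case: (g v r) => //= a b c; first [case: (a isT)|case: (b isT)|case: (c isT)].
Qed.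

(** Insert [x y]. If this costs a matching edge, the end of that edge seen by both [x] and [y]
    completes a triangle; if it costs a side of a triangle of the packing, any matching edge
    supplies the star; otherwise the matching has grown. *)
Lemma no_two_uncovered M x y L : config U g M [:: x; y] L -> size L = j -> size M = n0 -> 0 < n0 -> False.
Proof.
move=> cf sL sM n0_gt0; have [pU aM aL] := cf.
have [xU yU] : x \in U /\ y \in U by rewrite !(perm_mem pU) !mem_cat !inE !eqxx !orbT.
have xy : x != y.
  by have := UU; rewrite (perm_uniq pU) !cat_uniq /= inE => /and5P[_ _ /andP[]].
have [tM tL] := config_tight cf sL sM.
have oM := grow_em UU nok mx rg Eg cf sL sM.
have [g' [rg' Eg' gxy k]] := ar_swap colC UU rg xU yU xy.
have k' : keeps col g g' (col x y) by [].
have [|hM] := boolP (has (fun m => col m.1 m.2 == col x y) M).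
  case/hasP=> -[u v] mM /= /eqP cuv; have pm := perm_to_rem mM.
  have guv : g u v by have /allP/(_ _ mM) := aM.
  have pU' : perm_eq U ([:: x; y; u; v] ++ vs2 (rem (u, v) M) ++ vs3 L).
    by have pm2 := vs2_rem mM; perm_count.
  have uq : uniq [:: x; y; u; v].
    by have := UU; rewrite (perm_uniq pU') cat_uniq => /andP[].
  have nL a : a \in [:: x; y; u; v] -> a \notin vs3 L.
    have := UU; rewrite (perm_uniq pU') cat_uniq => /and3P[_ /hasPn h _] aW.
    by apply: contraL aW => aM'; apply: h; rewrite mem_cat aM' orbT.
  rewrite -cuv in k'; have kk := keep_same rg guv k'.
  have aL' : all (tri g') L.
    by apply: (keepL_edge rg guv k') => //; rewrite nL ?inE ?eqxx ?orbT.
  have [_ /(_ (tM _ mM)) /= /orP[] /andP[gx gy]] := oM _ mM.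
    have := @no_repl _ _ _ U j.+1 x g' [:: x; y; u; v] [:: (0, 1, 2)]
     (vs2 (rem (u, v) M)) L nok UU pU' rg' aL' isT; rewrite /= sL /tri /= gxy.
    rewrite !kk ?andbT //; try by same_absurd uq.
    by move/(_ (leqnn _)).
  have := @no_repl _ _ _ U j.+1 x g' [:: x; y; u; v] [:: (0, 1, 3)]
     (vs2 (rem (u, v) M)) L nok UU pU' rg' aL' isT; rewrite /= sL /tri /= gxy.
  rewrite !kk ?andbT //; try by same_absurd uq.
  by move/(_ (leqnn _)).
have [|hL] := boolP (has (fun t => colT col t (col x y)) L); last first.
  apply: (@mx g' ((x, y) :: M) [::] L) => //; last by rewrite /= sM.
    exact: leq_trans Eg Eg'.
  split; [by perm_count | | exact: keepL k' _ _].
  by rewrite /= /adj2 gxy; apply: keepM k' _ _.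
case/hasP=> -[[p q] r] tin cT; have pt := perm_to_rem tin.
case: M cf sM pU aM tM oM {hM} => [|[u v] M] cf sM pU aM tM oM; first by rewrite -sM in n0_gt0.
have sL' : size (rem (p, q, r) L) = j.-1 by rewrite size_rem // sL.
have tp : tri g (p, q, r) by have /allP/(_ _ tin) := aL.
have aL' : all (tri g) (rem (p, q, r) L) by apply/allP => t /mem_rem; apply: (allP aL).
have /andP[guv aM'] := aM; rewrite /adj2 /= in guv.
have j0 : 0 < j by rewrite -sL; case: (L) tin.
have [_ /(_ (tM _ (mem_head _ _))) /= /orP[] /andP[gx gy]] := oM _ (mem_head _ _).
  apply: (@star M x y v u p q r (rem (p, q, r) L)) => //; last by rewrite gS.
  by have pm2 := vs3_rem tin; perm_count.
apply: (@star M x y u v p q r (rem (p, q, r) L)) => //.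
by have pm2 := vs3_rem tin; perm_count.
Qed.

End Star.

(** * Maximal matchings, and the case of [n - 3k] even *)

Section Step.
Variables (V D : eqType) (col : V -> V -> D).
Hypothesis colC : forall x y, col x y = col y x.
Implicit Types (g h : rel V) (W Z : seq V) (M : seq (V * V)) (L : seq (V * V * V)).
Local Notation rainbow_rel := (rainbow_rel col).
Variables (U : seq V) (j : nat).
Hypothesis UU : uniq U.
Hypothesis nok : ~ has_packing col U j.+1.

Definition e2 g (m : V * V) (t : V * V * V) : nat := et g m.1 t + et g m.2 t.

(** Induction on the number of matching edges still wanted. A matching that cannot grow has at least
    [N - 1] edges by [grow_bound], and exactly two uncovered vertices are excluded. The suffix is
    the parity of [n - 3k] for [k = j + 1]. *)
Lemma perfect_odd m0 N : size U = 3 * j + 2 * N -> 1 < N ->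
  (forall g x, rainbow_rel g -> m0 <= E2 g U -> x \in U -> N.-1 + 2 * j <= deg g U x) ->
  (forall g M L, rainbow_rel g -> m0 <= E2 g U -> config U g M [::] L -> size L = j ->
     size M = N -> False) ->
  forall g M Z L, rainbow_rel g -> m0 <= E2 g U -> config U g M Z L -> size L = j -> False.
Proof.
move=> sU N1 dl fin g M Z L.
have [d] := ubnP (N - size M); elim: d => // d IH in g M Z L *.
move=> hd rg Eg cf sL; have := size_config cf; rewrite sU sL => sMZ.
case: (leqP N (size M)) => [le|lt].
  have {sMZ} [sM sZ] : size M = N /\ size Z = 0 by move: sMZ le; clear; lia.
  by case: Z cf sZ => // cf _; apply: (fin g M L).
case: Z cf sMZ => [|x [|y Z]] cf sMZ; try by move: sMZ lt; rewrite /=; clear; lia.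
have mx g' M' Z' L' : rainbow_rel g' -> m0 <= E2 g' U -> config U g' M' Z' L' ->
  size L' = j -> size M' = (size M).+1 -> False.
  move=> rg' Eg' cf' sL' sM'; apply: (IH g' M' Z' L') => //.
  by rewrite sM'; move: hd lt; clear; lia.
have bd := grow_bound UU nok mx rg Eg cf sL erefl.
have [pU _ _] := cf.
have xU : x \in U by rewrite (perm_mem pU) mem_cat inE eqxx orbT.
have yU : y \in U by rewrite (perm_mem pU) mem_cat !inE eqxx !orbT.
have dx := dl _ _ rg Eg xU; have dy := dl _ _ rg Eg yU.
have [sM sZ] : size M = N.-1 /\ size Z = 0.
  by move: sMZ lt bd dx dy N1; rewrite /=; clear; lia.
clear pU; case: Z cf sZ {sMZ bd} => // cf _.
apply: (no_two_uncovered colC UU nok mx _ rg Eg cf) => //; first by rewrite sM.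
by rewrite sM; move: N1; clear; lia.
Qed.

(** Here the degree bound is large enough for [grow_bound] alone to exclude two uncovered
    vertices. *)
Lemma perfect_even m0 N : size U = 3 * j + 2 * N + 1 ->
  (forall g x, rainbow_rel g -> m0 <= E2 g U -> x \in U -> N + 2 * j < deg g U x) ->
  (forall g M z L, rainbow_rel g -> m0 <= E2 g U -> config U g M [:: z] L -> size L = j ->
     size M = N -> False) ->
  forall g M Z L, rainbow_rel g -> m0 <= E2 g U -> config U g M Z L -> size L = j -> False.
Proof.
move=> sU dl fin g M Z L.
have [d] := ubnP (N - size M); elim: d => // d IH in g M Z L *.
move=> hd rg Eg cf sL; have := size_config cf; rewrite sU sL => sMZ.
case: (leqP N (size M)) => [le|lt].
  have {sMZ} [sM sZ] : size M = N /\ size Z = 1 by move: sMZ le; clear; lia.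
  by case: Z cf sZ => // z [] // cf _; apply: (fin g M z L).
case: Z cf sMZ => [|x [|y Z]] cf sMZ; try by move: sMZ lt; rewrite /=; clear; lia.
have mx g' M' Z' L' : rainbow_rel g' -> m0 <= E2 g' U -> config U g' M' Z' L' ->
  size L' = j -> size M' = (size M).+1 -> False.
  move=> rg' Eg' cf' sL' sM'; apply: (IH g' M' Z' L') => //.
  by rewrite sM'; move: hd lt; clear; lia.
have bd := grow_bound UU nok mx rg Eg cf sL erefl.
have [pU _ _] := cf.
have xU : x \in U by rewrite (perm_mem pU) mem_cat inE eqxx orbT.
have yU : y \in U by rewrite (perm_mem pU) mem_cat !inE eqxx !orbT.
by move: (dl _ _ rg Eg xU) (dl _ _ rg Eg yU) bd lt; clear; lia.
Qed.

Section Fixed.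
Variable g : rel V.
Hypothesis rg : rainbow_rel g.
Let gS : symmetric g. Proof. by case: rg. Qed.

(** The eighteen placements of two triangles on the seven vertices: either each pair takes a vertex
    of [t], or one pair takes a vertex and an end of the other takes the opposite side. More than
    eight edges, at least five of them from [x y], realize one of these. *)
Lemma e2_swap_pairs x y x' y' t R L :
  perm_eq U ([:: x; y; x'; y'; t.1.1; t.1.2; t.2] ++ R ++ vs3 L) ->
  all (tri g) (t :: L) -> g x y -> g x' y' -> j <= (size L).+1 ->
  4 < e2 g (x, y) t -> e2 g (x, y) t + e2 g (x', y') t <= 8.
Proof.
case: t => [[p q] r] /= pU /andP[/and3P[/= gpq gpr gqr] aL] gxy gxy' sL.
have F I := @no_repl _ _ _ U j.+1 x g [:: x; y; x'; y'; p; q; r] I R L nok UU pU rg aL.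
have := F [:: (0, 1, 4); (2, 3, 5)] isT sL; have := F [:: (0, 1, 4); (2, 3, 6)] isT sL.
have := F [:: (0, 1, 5); (2, 3, 4)] isT sL; have := F [:: (0, 1, 5); (2, 3, 6)] isT sL.
have := F [:: (0, 1, 6); (2, 3, 4)] isT sL; have := F [:: (0, 1, 6); (2, 3, 5)] isT sL.
have := F [:: (0, 1, 4); (2, 5, 6)] isT sL; have := F [:: (0, 1, 4); (3, 5, 6)] isT sL.
have := F [:: (0, 1, 5); (2, 4, 6)] isT sL; have := F [:: (0, 1, 5); (3, 4, 6)] isT sL.
have := F [:: (0, 1, 6); (2, 4, 5)] isT sL; have := F [:: (0, 1, 6); (3, 4, 5)] isT sL.
have := F [:: (2, 3, 4); (0, 5, 6)] isT sL; have := F [:: (2, 3, 4); (1, 5, 6)] isT sL.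
have := F [:: (2, 3, 5); (0, 4, 6)] isT sL; have := F [:: (2, 3, 5); (1, 4, 6)] isT sL.
have := F [:: (2, 3, 6); (0, 4, 5)] isT sL; have := F [:: (2, 3, 6); (1, 4, 5)] isT sL.
rewrite /e2 /et /tri /= gpq gpr gqr gxy gxy' !andbT /=; clear.
case: (g x p); case: (g x q); case: (g x r); case: (g y p); case: (g y q); case: (g y r) => //=;
by case: (g x' p); case: (g x' q); case: (g x' r); case: (g y' p); case: (g y' q); case: (g y' r).
Qed.

Lemma e2_le6 m t : e2 g m t <= 6.
Proof. by rewrite /e2 /et; do 6 case: (g _ _). Qed.

Lemma e2_pairs M m m' Z t L : config U g M Z L -> j <= size L -> m \in M -> m' \in rem m M ->
  t \in L -> 4 < e2 g m t -> e2 g m t + e2 g m' t <= 8.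
Proof.
move=> [pU aM aL] sL mM mM' tL.
have p1 := vs2_rem mM; have p2 := vs2_rem mM'; have p3 := vs3_rem tL.
have := @e2_swap_pairs m.1 m.2 m'.1 m'.2 t (vs2 (rem m' (rem m M)) ++ Z) (rem t L).
rewrite -!surjective_pairing; apply.
- by perm_count.
- by rewrite -(perm_all _ (perm_to_rem tL)).
- exact: (allP aM _ mM).
- exact: (allP aM _ (mem_rem mM')).
- by rewrite size_rem // (leq_trans sL) // leqSpred.
Qed.

Lemma e2_sum M Z t L : config U g M Z L -> j <= size L -> 1 < size M -> t \in L ->
  \sum_(m <- M) e2 g m t <= 4 * size M.
Proof.
move=> cf sL sM tL.
have [/allP h|] := boolP (all (fun m => e2 g m t <= 4) M); first exact: sum_nat_le.
case/allPn => m mM; rewrite -ltnNge => hm; have pm := perm_to_rem mM.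
have h m' : m' \in rem m M -> e2 g m' t <= 8 - e2 g m t.
  by move=> m'M; have := e2_pairs cf sL mM m'M tL hm; move: hm; clear; lia.
rewrite (perm_big _ pm) big_cons /=; have := sum_nat_le h.
rewrite size_rem //; have a6 := e2_le6 m t.
move: sM hm a6; set S := bigop _ _ _; set a := e2 _ _ _; clear; case: (size M) => [|[|n]] // _.
(* The heavy edge and one other send at most [a + b = 8]; each of the remaining [n] edges sends at
   most 3. *)
move=> a4 a6 /=; have [b ba b3] : exists2 b, a + b = 8 & b <= 3 by exists (8 - a); lia.
have -> : 8 - a = b by lia.
have : b * n <= 3 * n by rewrite leq_mul2r b3 orbT.
lia.
Qed.

(** A common neighbour outside the packing would give one more triangle. *)
Lemma degR_pair M Z L x y R : config U g M Z L -> j <= size L -> g x y ->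
  perm_eq (vs2 M ++ Z) (x :: y :: R) ->
  {in vs2 M ++ Z, forall v, g x v + g y v <= 1}.
Proof.
move=> [pU aM aL] sL gxy pR v.
have [_ gI _] := rg.
rewrite (perm_mem pR) !inE => /or3P[/eqP->|/eqP->|vR].
- by rewrite gI; case: (g y x).
- by rewrite gI; case: (g x y).
have pv := perm_to_rem vR.
have pU' : perm_eq U ([:: x; y; v] ++ rem v R ++ vs3 L).
  by move: pU pR pv; rewrite catA; clear; move=> pU pR pv; perm_count.
have := @no_repl _ _ _ U j.+1 x g _ [:: (0, 1, 2)] _ L nok UU pU' rg aL isT.
rewrite /= /tri /= gxy !andbT /= => /(_ sL).
by case: (g x v); case: (g y v).
Qed.

Lemma deg_pair M Z L x y R : config U g M Z L -> j <= size L -> g x y ->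
  perm_eq (vs2 M ++ Z) (x :: y :: R) ->
  deg g U x + deg g U y <= 2 * size M + size Z + \sum_(t <- L) e2 g (x, y) t.
Proof.
move=> cf sL gxy pR; have h := degR_pair cf sL gxy pR; have [pU _ _] := cf.
have E w : deg g U w = \sum_(v <- vs2 M ++ Z) g w v + \sum_(t <- L) et g w t.
  by rewrite (deg_perm _ _ pU) /deg catA big_cat /= sum_vs3.
rewrite !E addnACA -!big_split /= leq_add //.
by have := sum_nat_le h; rewrite size_cat size_vs2 mul1n.
Qed.

End Fixed.

Lemma even_step m0 N : size U = 3 * j + 2 * N + 1 -> 1 < N ->
  (forall g x, rainbow_rel g -> m0 <= E2 g U -> x \in U -> N + 2 * j < deg g U x) ->
  forall g M Z L, rainbow_rel g -> m0 <= E2 g U -> config U g M Z L -> size L = j -> False.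
Proof.
move=> sU N1 dl; apply: (perfect_even sU dl) => g M z L rg Eg cf sL sM.
(* The degree sum is at least [2 * N + 4 * j + 2], and at most [2 * N + 1] of it stays outside the
   packing. *)
have lo m : m \in M -> 4 * j + 1 <= \sum_(t <- L) e2 g m t.
  move=> mM; have pm := vs2_rem mM; have [pU aM _] := cf.
  have gm : g m.1 m.2 by have /allP/(_ _ mM) := aM.
  have pR : perm_eq (vs2 M ++ [:: z]) (m.1 :: m.2 :: (vs2 (rem m M) ++ [:: z])).
    by rewrite -!cat_cons perm_cat2r.
  have jL : j <= size L by rewrite sL.
  have := deg_pair rg cf jL gm pR; rewrite -surjective_pairing.
  have m1U : m.1 \in U by rewrite (perm_mem pU) catA mem_cat (perm_mem pR) mem_head.
  have m2U : m.2 \in U by rewrite (perm_mem pU) catA mem_cat (perm_mem pR) !inE eqxx orbT.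
  move: (dl _ _ rg Eg m1U) (dl _ _ rg Eg m2U); rewrite sM /=.
  set a := deg _ _ _; set b := deg _ _ _; set S := bigop _ _ _; clear; lia.
have := sum_nat_ge lo; rewrite exchange_big /= sM.
have jL : j <= size L by rewrite sL.
have sM1 : 1 < size M by rewrite sM.
have := sum_nat_le (fun t tL => e2_sum rg cf jL sM1 tL); rewrite sL sM.
set S := bigop _ _ _; move: N1; clear; nia.
Qed.

End Step.

(** * Recolouring a missing edge *)

Section Recolor.
Variables (V D : eqType) (col : V -> V -> D).
Hypothesis colC : forall x y, col x y = col y x.
Implicit Types (g h : rel V) (W Z R : seq V) (M : seq (V * V)) (L : seq (V * V * V)).
Local Notation rainbow_rel := (rainbow_rel col).
Variables (U : seq V) (j : nat).
Hypothesis UU : uniq U.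
Hypothesis nok : ~ has_packing col U j.+1.

Definition verts (t : V * V * V) := [:: t.1.1; t.1.2; t.2].

Lemma colTP t c : colT col t c -> exists a b d,
  perm_eq (verts t) [:: a; b; d] /\ col a b = c.
Proof.
case: t => [[p q] r] /or3P[] /= /eqP <-.
- by exists p, q, r; split; first exact: perm_refl.
- by exists p, r, q; split; first by rewrite /verts /=; perm_count.
- by exists q, r, p; split; first by rewrite /verts /=; perm_count.
Qed.

Lemma tri_adj g t a b d : rainbow_rel g -> tri g t -> perm_eq (verts t) [:: a; b; d] ->
  [/\ g a b, g a d & g b d].
Proof.
move=> rg; have [gS gI _] := rg; case: t => [[p q] r] /and3P[/= pq pr qr] pm.
have T x y : x \in verts (p, q, r) -> y \in verts (p, q, r) -> x != y -> g x y.
  rewrite !inE /= => /or3P[] /eqP-> /or3P[] /eqP->; rewrite ?eqxx // 1?gS //.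
have [ta tb td] : [/\ a \in verts (p, q, r), b \in verts (p, q, r) & d \in verts (p, q, r)].
  by rewrite !(perm_mem pm) !inE !eqxx !orbT.
have u : uniq [:: a; b; d].
  rewrite -(perm_uniq pm) /verts /= !inE negb_or andbT.
  by rewrite (rainbow_rel_neq rg pq) (rainbow_rel_neq rg pr) (rainbow_rel_neq rg qr).
move: u; rewrite /= !inE negb_or andbT => /andP[/andP[ab ad] bd].
by split; apply: T.
Qed.

Section Fixed.
Variable g : rel V.
Hypothesis rg : rainbow_rel g.
Let gS : symmetric g. Proof. by case: rg. Qed.

(** Inserting the diagonal [u u'] closes two triangles that share no other edge. One lost edge
    cannot destroy both, so it must damage the packing instead. *)
Lemma recolor_C4 u u' w w' R L : perm_eq U ([:: u; u'; w; w'] ++ R ++ vs3 L) ->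
  all (tri g) L -> j <= size L -> g u w -> g u w' -> g u' w -> g u' w' ->
  exists2 t, t \in L & colT col t (col u u').
Proof.
move=> pU aL sL uw uw' vw vw'; apply/hasP; apply: contraT => nh.
have uq : uniq [:: u; u'; w; w'].
  by have := UU; rewrite (perm_uniq pU) cat_uniq => /andP[].
have [xU yU] : u \in U /\ u' \in U by rewrite !(perm_mem pU) !inE !eqxx !orbT.
have xy : u != u' by move: uq; rewrite /= !inE !negb_or; case/andP => /andP[].
have [g' [rg' _ gxy k]] := ar_swap colC UU rg xU yU xy.
have aL' := keepL k aL nh.
have F I := @no_repl _ _ _ U j.+1 u g' [:: u; u'; w; w'] I R L nok UU pU rg' aL'.
have F1 := F [:: (0, 1, 2)] isT sL; have F2 := F [:: (0, 1, 3)] isT sL.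
have K x y : g x y -> ~~ g' x y -> col x y = col u u'.
  by move=> gxy' ; apply: contraNeq => /(k _ _ gxy').
have [_ _ gR] := rg.
have N x y z t : ~~ same_edge x y z t -> g x y -> g z t -> ~~ g' x y -> ~~ g' z t -> False.
  by move=> ne gx gz /(K _ _ gx) e1 /(K _ _ gz) e2; move: ne; rewrite gR // e1 e2.
move: F1 F2; rewrite /= /tri /= gxy !andbT !negb_and /= => /orP[] h1 /orP[] h2.
- by case: (N u w u w') => //; same_absurd uq.
- by case: (N u w u' w') => //; same_absurd uq.
- by case: (N u' w u w') => //; same_absurd uq.
- by case: (N u' w u' w') => //; same_absurd uq.
Qed.

Lemma recolor p q u u' L : u \in U -> u' \in U -> u != u' -> g p q ->
  col p q = col u u' -> p \notin vs3 L -> all (tri g) L ->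
  exists g', [/\ rainbow_rel g', g' u u', all (tri g') L &
    forall x y, g x y -> ~~ same_edge x y p q -> g' x y].
Proof.
move=> uU vU uv gpq c pL aL; have [g' [rg' _ guv k]] := ar_swap colC UU rg uU vU uv.
have k' : keeps col g g' (col p q) by rewrite c.
exists g'; split=> //; first exact: keepL_edge rg gpq k' pL aL.
by move=> x y; apply: (keep_same rg gpq k').
Qed.

(* Recolouring frees the triangle containing the edge [p q]. *)
Lemma recolor_local u u' w a b p q r R L :
  perm_eq U ([:: u; u'; w; a; b; p; q; r] ++ R ++ vs3 L) ->
  all (tri g) L -> j <= (size L).+1 -> tri g (p, q, r) -> col p q = col u u' ->
  g u w -> g u' w ->
  [/\ g a b -> [/\ ~~ (g a p && g b p), ~~ (g a q && g b q) & ~~ (g a r && g b r)],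
   ~~ (g a p && g a r), ~~ (g a q && g a r), ~~ (g b p && g b r) & ~~ (g b q && g b r)].
Proof.
move=> pU aL sL /and3P[/= gpq gpr gqr] cpq uw vw.
have uq : uniq [:: u; u'; w; a; b; p; q; r].
  by have := UU; rewrite (perm_uniq pU) cat_uniq => /andP[].
have [xU yU] : u \in U /\ u' \in U by rewrite !(perm_mem pU) !inE !eqxx !orbT.
have xy : u != u' by move: uq; rewrite /= !inE !negb_or; case/andP => /andP[].
have pL : p \notin vs3 L.
  have := UU; rewrite (perm_uniq pU) cat_uniq => /and3P[_ /hasPn h _].
  by apply/negP => pL; have := h p; rewrite mem_cat pL orbT !inE !eqxx !orbT => /(_ isT).
have [g' [rg' guv aL' kk]] := recolor xU yU xy gpq cpq pL aL.
have F I := @no_repl _ _ _ U j.+1 u g' [:: u; u'; w; a; b; p; q; r] I R L nok UU pU rg' aL'.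
have guw : g' u w by rewrite kk //; same_absurd uq.
have gvw : g' u' w by rewrite kk //; same_absurd uq.
have gpr' : g' p r by rewrite kk //; same_absurd uq.
have gqr' : g' q r by rewrite kk //; same_absurd uq.
split.
- move=> gab; have gab' : g' a b by rewrite kk //; same_absurd uq.
  split; apply/negP => /andP[h1 h2].
  + have := F [:: (0, 1, 2); (3, 4, 5)] isT sL; rewrite /= /tri /= guv guw gvw gab'.
    by rewrite !kk //; same_absurd uq.
  + have := F [:: (0, 1, 2); (3, 4, 6)] isT sL; rewrite /= /tri /= guv guw gvw gab'.
    by rewrite !kk //; same_absurd uq.
  + have := F [:: (0, 1, 2); (3, 4, 7)] isT sL; rewrite /= /tri /= guv guw gvw gab'.
    by rewrite !kk //; same_absurd uq.
- apply/negP => /andP[h1 h2].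
  have := F [:: (0, 1, 2); (3, 5, 7)] isT sL; rewrite /= /tri /= guv guw gvw gpr'.
  by rewrite !kk //; same_absurd uq.
- apply/negP => /andP[h1 h2].
  have := F [:: (0, 1, 2); (3, 6, 7)] isT sL; rewrite /= /tri /= guv guw gvw gqr'.
  by rewrite !kk //; same_absurd uq.
- apply/negP => /andP[h1 h2].
  have := F [:: (0, 1, 2); (4, 5, 7)] isT sL; rewrite /= /tri /= guv guw gvw gpr'.
  by rewrite !kk //; same_absurd uq.
- apply/negP => /andP[h1 h2].
  have := F [:: (0, 1, 2); (4, 6, 7)] isT sL; rewrite /= /tri /= guv guw gvw gqr'.
  by rewrite !kk //; same_absurd uq.
Qed.

(** For an edge [a b]: it forms no triangle with a vertex of [t], and hence sends at most three
    edges to [t]. *)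
Definition bad a b (t : V * V * V) := ~~ has (fun v => g a v && g b v) (verts t).

Lemma badE a b t : bad a b t =
  [&& ~~ (g a t.1.1 && g b t.1.1), ~~ (g a t.1.2 && g b t.1.2) & ~~ (g a t.2 && g b t.2)].
Proof. by rewrite /bad /= orbF !negb_or. Qed.

Lemma bad_e2 a b t : bad a b t -> e2 g (a, b) t <= 3.
Proof. by rewrite badE /e2 /et /=; do 6 case: (g _ _). Qed.

(** The triangle [u u' w] can replace [t], which pays for the new edge. The vertices of [t] become
    free, and one of them completing [a b] would enlarge the packing. *)
Lemma recolor_bad u u' w a b t R L :
  perm_eq U ([:: u; u'; w; a; b] ++ R ++ vs3 L) ->
  all (tri g) L -> size L = j -> t \in L -> colT col t (col u u') ->
  g u w -> g u' w -> g a b -> bad a b t.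
Proof.
move=> pU aL sL tL /colTP[p [q [r [pt cpq]]]] uw vw ab.
have tt : tri g t by apply: (allP aL).
have [gpq gpr gqr] := tri_adj rg tt pt.
have pr := vs3_rem tL.
have pU' : perm_eq U ([:: u; u'; w; a; b; p; q; r] ++ R ++ vs3 (rem t L)).
  by move: pt; rewrite /verts => pt; perm_count.
have aL' : all (tri g) (rem t L) by apply/allP => x /mem_rem; apply: (allP aL).
have sL' : j <= (size (rem t L)).+1 by rewrite size_rem // -sL leqSpred.
have tp : tri g (p, q, r) by rewrite /tri /= gpq gpr gqr.
have [/(_ ab)[h1 h2 h3] _ _ _ _] := recolor_local pU' aL' sL' tp cpq uw vw.
by rewrite /bad (perm_has _ pt) /= !negb_or h1 h2 h3.
Qed.

End Fixed.
End Recolor.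

(** * Complete bipartite remainder *)

Section Bip.
Variables (V D : eqType) (col : V -> V -> D).
Hypothesis colC : forall x y, col x y = col y x.
Implicit Types (g h : rel V) (W Z R : seq V) (M : seq (V * V)).
Local Notation rainbow_rel := (rainbow_rel col).
Variables (U : seq V) (j : nat).
Hypothesis UU : uniq U.
Hypothesis nok : ~ has_packing col U j.+1.
Variable g : rel V.
Hypothesis rg : rainbow_rel g.
Let gS : symmetric g. Proof. by case: rg. Qed.

Section OneSide.
Variables (A B : seq V) (L : seq (V * V * V)).
Hypothesis pU : perm_eq U (A ++ B ++ vs3 L).
Hypothesis aL : all (tri g) L.
Hypothesis sL : size L = j.
Hypothesis bip : {in A & B, forall a b, g a b}.

Lemma sub_perm (T : eqType) (s W : seq T) : uniq s -> uniq W -> {subset W <= s} ->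
  perm_eq s (W ++ [seq x <- s | x \notin W]).
Proof.
move=> us uW sW; apply: uniq_perm => //.
  rewrite cat_uniq uW filter_uniq // andbT; apply/hasPn => x.
  by rewrite mem_filter => /andP[].
move=> x; rewrite mem_cat mem_filter; case: (boolP (x \in W)) => //= /sW ->.
by [].
Qed.

(** Brings chosen vertices of the two sides to the front, the form in which the local lemmas take
    them. *)
Lemma localize sa sb : uniq sa && all [in A] sa -> uniq sb && all [in B] sb ->
  exists R, perm_eq U ((sa ++ sb) ++ R ++ vs3 L).
Proof.
move=> /andP[ua /allP aA] /andP[ub /allP bB].
have := UU; rewrite (perm_uniq pU) catA cat_uniq => /and3P[uAB _ _].
have uAB' := uAB; rewrite cat_uniq in uAB'; case/and3P: uAB' => _ /hasPn dAB _.
have uW : uniq (sa ++ sb).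
  rewrite cat_uniq ua ub andbT; apply/hasPn => x /bB xB; apply/negP => /aA xA.
  by have := dAB x xB; rewrite /= xA.
have sub : {subset sa ++ sb <= A ++ B}.
  by move=> x; rewrite !mem_cat => /orP[/aA->|/bB->]; rewrite ?orbT.
have p := sub_perm uAB uW sub.
exists [seq x <- A ++ B | x \notin sa ++ sb].
by rewrite (perm_trans pU) // !catA perm_cat2r -!catA catA.
Qed.

(** The four vertices form a 4-cycle with diagonal [a1 a2]. *)
Lemma side_color_in_packing a1 a2 b1 b2 : a1 \in A -> a2 \in A -> a1 != a2 -> b1 \in B -> b2 \in B -> b1 != b2 ->
  exists2 t, t \in L & colT col t (col a1 a2).
Proof.
move=> a1A a2A a12 b1B b2B b12.
have [|| R p] := @localize [:: a1; a2] [:: b1; b2]; rewrite /= ?inE ?a12 ?b12 ?a1A ?a2A ?b1B ?b2B //.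
by apply: (recolor_C4 colC UU nok rg p aL); rewrite ?sL // bip.
Qed.

Lemma side_color_bad a1 a2 t : a1 \in A -> a2 \in A -> a1 != a2 -> t \in L -> colT col t (col a1 a2) ->
  1 < size B -> uniq B ->
  forall a b, a \in A -> a != a1 -> a != a2 -> b \in B -> bad g a b t.
Proof.
move=> a1A a2A a12 tL cT sB uB a b aA n1 n2 bB.
have [w wB wb] : exists2 w, w \in B & w != b.
  move: sB uB bB; case: (B) => [|x [|y s]] // _ /= /andP[]; rewrite inE negb_or => /andP[xy _] _ _.
  by case: (eqVneq b x) => [->|bx]; [exists y; rewrite ?inE ?eqxx ?orbT // eq_sym|
     exists x; rewrite ?inE ?eqxx // eq_sym].
have [|| R p] := @localize [:: a1; a2; a] [:: w; b].
- by rewrite /= !inE !negb_or a12 [a1 == a]eq_sym [a2 == a]eq_sym n1 n2 a1A a2A aA.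
- by rewrite /= inE wb wB bB.
apply: (@recolor_bad _ _ _ colC U j UU nok g rg a1 a2 w a b t R L) => //; rewrite ?bip //.
by rewrite (perm_trans p) //; perm_count.
Qed.

Lemma pairE a b a' b' t : a \in A -> a' \in A -> a != a' -> b \in B -> b' \in B -> b != b' ->
  t \in L -> e2 g (a, b) t + e2 g (a', b') t <= 8.
Proof.
move=> aA aA' aa bB bB' bb tL.
have P x y x' y' : x \in A -> x' \in A -> x != x' -> y \in B -> y' \in B -> y != y' ->
    4 < e2 g (x, y) t -> e2 g (x, y) t + e2 g (x', y') t <= 8.
  move=> xA xA' xx yB yB' yy.
  have [|| R p] := @localize [:: x; x'] [:: y; y']; rewrite /= ?inE ?xx ?yy ?xA ?xA' ?yB ?yB' //.
  have p3 := vs3_rem tL.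
  apply: (@e2_swap_pairs _ _ _ U j UU nok g rg x y x' y' t R (rem t L)); rewrite ?bip //.
  - by perm_count.
  - by rewrite -(perm_all _ (perm_to_rem tL)).
  - by rewrite size_rem // -sL leqSpred.
case: (ltnP 4 (e2 g (a, b) t)) => [|h1]; first exact: P.
case: (ltnP 4 (e2 g (a', b') t)) => [h|h2]; last by rewrite (leq_add h1 h2).
by rewrite addnC P // eq_sym.
Qed.

(** Adjacent vertices have no common neighbour outside the packing, so at most [size A + size B] of
    their degree sum stays there. *)
Lemma sumE a b : a \in A -> b \in B ->
  size A + size B + 4 * j <= deg g U a + deg g U b + 1 ->
  4 * j <= \sum_(t <- L) e2 g (a, b) t + 1.
Proof.
move=> aA bB le.
have [|| R p] := @localize [:: a] [:: b]; rewrite /= ?aA ?bB //.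
have cf : config U g [::] (A ++ B) L by split; rewrite // -catA.
have jL : j <= size L by rewrite sL.
have uAB : uniq (A ++ B) by have := UU; rewrite (perm_uniq pU) catA cat_uniq => /and3P[].
have ab : a != b by apply: rainbow_rel_neq rg _; apply: bip.
have pR : perm_eq (vs2 [::] ++ A ++ B) (a :: b :: [seq x <- A ++ B | x \notin [:: a; b]]).
  apply: (@sub_perm _ _ [:: a; b]) => //=; first by rewrite inE ab.
  by move=> x; rewrite !inE mem_cat => /orP[] /eqP->; rewrite ?aA ?bB ?orbT.
have := deg_pair UU nok rg cf jL (bip aA bB) pR; rewrite muln0 add0n size_cat.
by move: le; set s := bigop _ _ _; clear; lia.
Qed.

(** Each vertex of [t] sees exactly one of [a3] and [b3], and a common neighbour of [a1] and [b1]
    does not see [a3]. If [b3] saw all of [t], it would take a side while [a1 b1] takes the third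
    vertex; so [a3] sees a vertex of [t], the one that is not common. *)
Lemma heavy_other a1 b1 a3 b3 t : a1 \in A -> b1 \in B -> a3 \in A -> b3 \in B ->
  b1 != b3 -> t \in L ->
  4 < e2 g (a1, b1) t -> e2 g (a3, b3) t = 3 -> bad g a3 b1 t -> bad g a3 b3 t ->
  [/\ g a3 t.1.1 = ~~ (g a1 t.1.1 && g b1 t.1.1), g a3 t.1.2 = ~~ (g a1 t.1.2 && g b1 t.1.2),
      g a3 t.2 = ~~ (g a1 t.2 && g b1 t.2) & [|| g a3 t.1.1, g a3 t.1.2 | g a3 t.2]].
Proof.
move=> a1A b1B a3A b3B b13 tL.
have [|| R p] := @localize [:: a1] [:: b1; b3]; rewrite /= ?inE ?b13 ?a1A ?b1B ?b3B //.
have p3 := vs3_rem tL.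
have tt : tri g t by apply: (allP aL).
have pU' : perm_eq U ([:: a1; b1; b3; t.1.1; t.1.2; t.2] ++ R ++ vs3 (rem t L)) by perm_count.
have aL' : all (tri g) (rem t L) by apply/allP => x /mem_rem; apply: (allP aL).
have F I := @no_repl _ _ _ U j.+1 a1 g [:: a1; b1; b3; t.1.1; t.1.2; t.2] I R _ nok UU pU' rg aL'.
have sL' : j.+1 <= 2 + size (rem t L) by rewrite size_rem // -sL ltnS leqSpred.
have := F [:: (2, 3, 4); (0, 1, 5)] isT sL'; have := F [:: (2, 3, 5); (0, 1, 4)] isT sL'.
have := F [:: (2, 4, 5); (0, 1, 3)] isT sL'.
have /and3P[t1 t2 t3] := tt.
rewrite !badE /e2 /et /tri /= (bip a1A b1B) t1 t2 t3 !andbT /=; clear.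
case: (g a1 t.1.1); case: (g a1 t.1.2); case: (g a1 t.2);
case: (g b1 t.1.1); case: (g b1 t.1.2); case: (g b1 t.2) => //=;
by case: (g a3 t.1.1); case: (g a3 t.1.2); case: (g a3 t.2);
case: (g b3 t.1.1); case: (g b3 t.1.2); case: (g b3 t.2).
Qed.

(** Each vertex of [t] sees one of [a3] and [b3], hence by badness not both of [a1] and [b1]. That
    leaves at most three edges from [a1 b1], not five. *)
Lemma heavy_bad2 a1 b1 a3 b3 t : a1 \in A -> b1 \in B -> a3 \in A -> b3 \in B ->
  4 < e2 g (a1, b1) t -> e2 g (a3, b3) t = 3 ->
  bad g a3 b1 t -> bad g a1 b3 t -> bad g a3 b3 t -> False.
Proof.
move=> _ _ _ _; rewrite !badE /e2 /et /=.
case: (g a1 t.1.1); case: (g a1 t.1.2); case: (g a1 t.2);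
case: (g b1 t.1.1); case: (g b1 t.1.2); case: (g b1 t.2) => //=;
by case: (g a3 t.1.1); case: (g a3 t.1.2); case: (g a3 t.2);
case: (g b3 t.1.1); case: (g b3 t.1.2); case: (g b3 t.2).
Qed.

End OneSide.

Lemma badC a b t : bad g a b t = bad g b a t.
Proof. by rewrite /bad; congr (~~ _); apply: eq_has => v; rewrite andbC. Qed.

Lemma e2C a b t : e2 g (a, b) t = e2 g (b, a) t.
Proof. by rewrite /e2 addnC. Qed.

Variables (A B : seq V) (L : seq (V * V * V)).
Hypothesis pU : perm_eq U (A ++ B ++ vs3 L).
Hypothesis aL : all (tri g) L.
Hypothesis sL : size L = j.
Hypothesis bip : {in A & B, forall a b, g a b}.
Hypothesis dl : {in A & B, forall a b, size A + size B + 4 * j <= deg g U a + deg g U b + 1}.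
Hypothesis sA : 2 < size A.
Hypothesis sB : 2 < size B.

Let pU' : perm_eq U (B ++ A ++ vs3 L).
Proof. by rewrite (perm_trans pU) // perm_catCA. Qed.
Let bip' : {in B & A, forall a b, g a b}.
Proof. by move=> b a bB aA; rewrite gS bip. Qed.
Let uA : uniq A. Proof. by have := UU; rewrite (perm_uniq pU) cat_uniq => /and3P[]. Qed.
Let uB : uniq B. Proof. by have := UU; rewrite (perm_uniq pU') cat_uniq => /and3P[]. Qed.

(** By [heavy_other], read from both sides, [a3] and [b2] see exactly the vertices of [t] that are
    not common to [a1] and [b1]. There is such a vertex, so the pair [a3], [b2] is not bad. *)
Lemma heavy_AB a1 b1 a2 b2 a3 b3 t : [/\ a1 \in A, a2 \in A & a3 \in A] ->
  [/\ b1 \in B, b2 \in B & b3 \in B] -> a1 != a2 -> b1 != b3 -> t \in L ->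
  4 < e2 g (a1, b1) t -> e2 g (a2, b2) t = 3 -> e2 g (a3, b3) t = 3 ->
  {in B, forall b, bad g a3 b t} -> {in A, forall a, bad g a b2 t} -> False.
Proof.
move=> [a1A a2A a3A] [b1B b2B b3B] a12 b13 tL h1 e3 e4 bA bB.
have [x1 x2 x3 x4] := heavy_other pU aL sL bip a1A b1B a3A b3B b13 tL h1 e4 (bA _ b1B) (bA _ b3B).
rewrite e2C in h1; rewrite e2C in e3.
have bB1 : bad g b2 a1 t by rewrite badC bB.
have bB2 : bad g b2 a2 t by rewrite badC bB.
have [y1 y2 y3 _] := heavy_other pU' aL sL bip' b1B a1A b2B a2A a12 tL h1 e3 bB1 bB2.
have := bA _ b2B; rewrite badE.
move: x4; rewrite x1 x2 x3 y1 y2 y3 ![g b1 _ && _]andbC.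
by do 3 case: (_ && _).
Qed.

Definition totally_bad t := {in A & B, forall a b, bad g a b t}.

(** The triangles [tA] and [tB] that hold the colours of [a1 a2] and [b1 b2] receive at most three
    edges from [a3 b3], whose total is at most one short of four per triangle. So some triangle
    receives five, or [tA = tB]. *)
Lemma index_case a1 a2 a3 b1 b2 b3 :
  uniq [:: a1; a2; a3] && all [in A] [:: a1; a2; a3] ->
  uniq [:: b1; b2; b3] && all [in B] [:: b1; b2; b3] ->
  (exists t, [/\ t \in L, colT col t (col a1 a2), colT col t (col b1 b2) & totally_bad t]) \/
  (exists tA tB tH, [/\ tA \in L, tB \in L & tH \in L] /\
    [/\ {in B, forall b, bad g a3 b tA}, {in A, forall a, bad g a b3 tB} & 4 < e2 g (a3, b3) tH]).
Proof.
rewrite /= !inE !andbT !negb_or.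
move=> /andP[/andP[/andP[a12 a13] a23] /and3P[a1A a2A a3A]].
move=> /andP[/andP[/andP[b12 b13] b23] /and3P[b1B b2B b3B]].
have [tA tAL cA] := side_color_in_packing pU aL sL bip a1A a2A a12 b1B b2B b12.
have [tB tBL cB] := side_color_in_packing pU' aL sL bip' b1B b2B b12 a1A a2A a12.
have bA := side_color_bad pU aL sL bip a1A a2A a12 tAL cA (ltnW sB) uB.
have bB := side_color_bad pU' aL sL bip' b1B b2B b12 tBL cB (ltnW sA) uA.
have bA3 : {in B, forall b, bad g a3 b tA} by move=> b bin; apply: bA; rewrite // eq_sym.
have bB3 : {in A, forall a, bad g a b3 tB} by move=> a ain; rewrite badC; apply: bB; rewrite // eq_sym.
have [/hasP[h hL h4]|/hasPn nh] := boolP (has (fun t => 4 < e2 g (a3, b3) t) L).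
  by right; exists tA, tB, h.
left; have le t : t \in L -> e2 g (a3, b3) t <= 4 by move/nh; rewrite -leqNgt.
have S := sumE pU aL sL bip a3A b3B (dl a3A b3B).
have pA := perm_to_rem tAL; rewrite (perm_big _ pA) big_cons /= in S.
have eA := bad_e2 (bA3 _ b3B).
have tAB : tB = tA.
  apply: contraTeq isT => ne; have tBL' : tB \in rem tA L.
    by move: tBL; rewrite (perm_mem pA) inE (negbTE ne).
  have pB := perm_to_rem tBL'; rewrite (perm_big _ pB) big_cons /= in S.
  have eB := bad_e2 (bB3 _ a3A).
  have : \sum_(t <- rem tB (rem tA L)) e2 g (a3, b3) t <= 4 * size (rem tB (rem tA L)).
    by apply: sum_nat_le => t /mem_rem/mem_rem/le.
  have sj : size L = (size (rem tB (rem tA L))).+2 by rewrite (perm_size pA) /= (perm_size pB).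
  rewrite -sL sj in S; move: S eA eB; set s := bigop _ _ _; clear; lia.
rewrite {tBL}tAB in cB bB bB3.
have eA3 : 3 <= e2 g (a3, b3) tA.
  have : \sum_(t <- rem tA L) e2 g (a3, b3) t <= 4 * size (rem tA L).
    by apply: sum_nat_le => t /mem_rem/le.
  have sj : size L = (size (rem tA L)).+1 by rewrite (perm_size pA).
  rewrite -sL sj in S; move: S eA; set s := bigop _ _ _; clear; lia.
exists tA; split=> // a b aA bBin; rewrite badE.
have [|] := boolP ((a != a1) && (a != a2)); first by case/andP=> *; rewrite -badE bA.
have [|] := boolP ((b != b1) && (b != b2)); first by case/andP=> *; rewrite -badE badC bB.
(* Only [a] among [a1], [a2] and [b] among [b1], [b2] are left. Every vertex of [tA] sees exactly
   one of [a3] and [b3], while the pairs [a3], [b] and [a], [b3] are bad. *)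
move=> _ _; move: (bA3 _ bBin) (bB3 _ aA) (bA3 _ b3B) eA3; rewrite !badE /e2 /et /=; clear.
case: (g a3 _); case: (g a3 _); case: (g a3 _); case: (g b3 _); case: (g b3 _); case: (g b3 _) => //=;
by do 6 case: (g _ _).
Qed.

(** [index_case] is applied with each of three indices left out. If a heavy triangle arises every
    time, [H1], [H2], [H3] are distinct, and [d] is at most 11 on them and 12 elsewhere. This only
    just reaches the lower bound [12 * j - 3], so all values are determined, and a triangle bad for
    index [i] is the heavy triangle of another index. *)
Lemma totally_bad_exists : exists a1 a2 b1 b2 t,
  [/\ a1 \in A, a2 \in A & a1 != a2] /\ [/\ b1 \in B, b2 \in B & b1 != b2] /\
  [/\ t \in L, colT col t (col a1 a2), colT col t (col b1 b2) & totally_bad t].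
Proof.
have [a1 [a2 [a3 [A' EA]]]] : exists a1 a2 a3 A', A = [:: a1, a2, a3 & A'].
  by case: (A) sA => [|a1 [|a2 [|a3 A']]] // _; exists a1, a2, a3, A'.
have [b1 [b2 [b3 [B' EB]]]] : exists b1 b2 b3 B', B = [:: b1, b2, b3 & B'].
  by case: (B) sB => [|b1 [|b2 [|b3 B']]] // _; exists b1, b2, b3, B'.
have [a1A a2A a3A] : [/\ a1 \in A, a2 \in A & a3 \in A] by rewrite EA !inE !eqxx !orbT.
have [b1B b2B b3B] : [/\ b1 \in B, b2 \in B & b3 \in B] by rewrite EB !inE !eqxx !orbT.
have /and3P[a12 a13 a23] : [&& a1 != a2, a1 != a3 & a2 != a3].
  by move: uA; rewrite EA /= !inE !negb_or => /and3P[/and3P[-> -> _] /andP[-> _] _].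
have /and3P[b12 b13 b23] : [&& b1 != b2, b1 != b3 & b2 != b3].
  by move: uB; rewrite EB /= !inE !negb_or => /and3P[/and3P[-> -> _] /andP[-> _] _].
case: (@index_case a1 a2 a3 b1 b2 b3).
- by rewrite /= !inE !negb_or a12 a13 a23 a1A a2A a3A.
- by rewrite /= !inE !negb_or b12 b13 b23 b1B b2B b3B.
- by move=> [t ht]; exists a1, a2, b1, b2, t; split.
move=> [A3 [B3 [H3 [[A3L B3L H3L] [bA3 bB3 h3]]]]].
case: (@index_case a1 a3 a2 b1 b3 b2).
- by rewrite /= !inE !negb_or a12 a13 eq_sym a23 a1A a2A a3A.
- by rewrite /= !inE !negb_or b12 b13 eq_sym b23 b1B b2B b3B.
- by move=> [t ht]; exists a1, a3, b1, b3, t; split.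
move=> [A2 [B2 [H2 [[A2L B2L H2L] [bA2 bB2 h2]]]]].
case: (@index_case a2 a3 a1 b2 b3 b1).
- by rewrite /= !inE !negb_or [a2 == a1]eq_sym a12 [a3 == a1]eq_sym a13 a23 a1A a2A a3A.
- by rewrite /= !inE !negb_or [b2 == b1]eq_sym b12 [b3 == b1]eq_sym b13 b23 b1B b2B b3B.
- by move=> [t ht]; exists a2, a3, b2, b3, t; split.
move=> [A1 [B1 [H1 [[A1L B1L H1L] [bA1 bB1 h1]]]]].
exfalso.
have P12 t : t \in L -> e2 g (a1, b1) t + e2 g (a2, b2) t <= 8 by move=> tL; apply: (pairE pU aL sL bip).
have P13 t : t \in L -> e2 g (a1, b1) t + e2 g (a3, b3) t <= 8 by move=> tL; apply: (pairE pU aL sL bip).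
have P23 t : t \in L -> e2 g (a2, b2) t + e2 g (a3, b3) t <= 8 by move=> tL; apply: (pairE pU aL sL bip).
have S1 := sumE pU aL sL bip a1A b1B (dl a1A b1B).
have S2 := sumE pU aL sL bip a2A b2B (dl a2A b2B).
have S3 := sumE pU aL sL bip a3A b3B (dl a3A b3B).
pose d t := e2 g (a1, b1) t + e2 g (a2, b2) t + e2 g (a3, b3) t.
have S : 12 * j <= \sum_(t <- L) d t + 3.
  have -> : \sum_(t <- L) d t = \sum_(t <- L) e2 g (a1, b1) t +
    \sum_(t <- L) e2 g (a2, b2) t + \sum_(t <- L) e2 g (a3, b3) t by rewrite -!big_split.
  move: S1 S2 S3.
  set s1 := bigop _ _ _; set s2 := bigop _ _ _; set s3 := bigop _ _ _; clear; lia.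
have d12 t : t \in L -> d t <= 12.
  move=> tL; move: (P12 _ tL) (P13 _ tL) (P23 _ tL); rewrite /d; clear; lia.
have [n12 n13 n23] : [/\ H2 != H1, H3 != H1 & H3 != H2].
  split; apply/negP => /eqP e.
  - by move: (P12 _ H1L) h1 h2; rewrite e; clear; lia.
  - by move: (P13 _ H1L) h1 h3; rewrite e; clear; lia.
  - by move: (P23 _ H2L) h2 h3; rewrite e; clear; lia.
have p1 := perm_to_rem H1L; have H2L' : H2 \in rem H1 L by move: H2L; rewrite (perm_mem p1) inE (negbTE n12).
have p2 := perm_to_rem H2L'; have H3L' : H3 \in rem H2 (rem H1 L).
  by move: H3L; rewrite (perm_mem p1) inE (negbTE n13) (perm_mem p2) inE (negbTE n23).
have p3 := perm_to_rem H3L'; set L' := rem H3 _ in p3.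
have pL : perm_eq L [:: H1, H2, H3 & L'].
  by rewrite (perm_trans p1) // perm_cons (perm_trans p2) // perm_cons.
have sub t : t \in L' -> t \in L by rewrite (perm_mem pL) !inE => ->; rewrite !orbT.
have sj : j = (size L').+3 by rewrite -sL (perm_size pL).
rewrite (perm_big _ pL) !big_cons /= in S.
have dH1 : d H1 <= 11 by move: (P12 _ H1L) (P13 _ H1L) h1; rewrite /d; clear; lia.
have dH2 : d H2 <= 11 by move: (P12 _ H2L) (P23 _ H2L) h2; rewrite /d; clear; lia.
have dH3 : d H3 <= 11 by move: (P13 _ H3L) (P23 _ H3L) h3; rewrite /d; clear; lia.
have sle := sum_nat_le (fun t tL' => d12 t (sub t tL')).
have tight : {in L', forall t, d t = 12}.
  apply: sum_nat_tight; first by move=> t /sub/d12.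
  by rewrite sj in S; move: S dH1 dH2 dH3 sle; set s := bigop _ _ _; clear; lia.
have [f1 f2 f3] : [/\ d H1 = 11, d H2 = 11 & d H3 = 11].
  by rewrite sj in S; split; move: S dH1 dH2 dH3 sle; set s := bigop _ _ _; clear; lia.
have H1_2 : e2 g (a2, b2) H1 = 3 by move: f1 (P12 _ H1L) (P13 _ H1L) h1; rewrite /d; clear; lia.
have H1_3 : e2 g (a3, b3) H1 = 3 by move: f1 (P12 _ H1L) (P13 _ H1L) h1; rewrite /d; clear; lia.
have H2_1 : e2 g (a1, b1) H2 = 3 by move: f2 (P12 _ H2L) (P23 _ H2L) h2; rewrite /d; clear; lia.
have H2_3 : e2 g (a3, b3) H2 = 3 by move: f2 (P12 _ H2L) (P23 _ H2L) h2; rewrite /d; clear; lia.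
have H3_1 : e2 g (a1, b1) H3 = 3 by move: f3 (P13 _ H3L) (P23 _ H3L) h3; rewrite /d; clear; lia.
have H3_2 : e2 g (a2, b2) H3 = 3 by move: f3 (P13 _ H3L) (P23 _ H3L) h3; rewrite /d; clear; lia.
have c3 t : t \in L -> bad g a3 b3 t -> t = H1 \/ t = H2.
  move=> tL /bad_e2 le3; move: tL; rewrite (perm_mem pL) !inE => /or4P[/eqP|/eqP|/eqP e|tL']; try by auto.
    by move: h3 le3; rewrite e; clear; lia.
  by move: (P12 _ (sub _ tL')) (tight _ tL') le3; rewrite /d; clear; lia.
have c2 t : t \in L -> bad g a2 b2 t -> t = H1 \/ t = H3.
  move=> tL /bad_e2 le3; move: tL; rewrite (perm_mem pL) !inE => /or4P[/eqP|/eqP e|/eqP|tL']; try by auto.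
    by move: h2 le3; rewrite e; clear; lia.
  by move: (P13 _ (sub _ tL')) (tight _ tL') le3; rewrite /d; clear; lia.
have c1 t : t \in L -> bad g a1 b1 t -> t = H2 \/ t = H3.
  move=> tL /bad_e2 le3; move: tL; rewrite (perm_mem pL) !inE => /or4P[/eqP e|/eqP|/eqP|tL']; try by auto.
    by move: h1 le3; rewrite e; clear; lia.
  by move: (P23 _ (sub _ tL')) (tight _ tL') le3; rewrite /d; clear; lia.
have a21 : a2 != a1 by rewrite eq_sym. have a31 : a3 != a1 by rewrite eq_sym.
have a32 : a3 != a2 by rewrite eq_sym. have b21 : b2 != b1 by rewrite eq_sym.
have b31 : b3 != b1 by rewrite eq_sym. have b32 : b3 != b2 by rewrite eq_sym.
(* If the triangles [A] and [B] of one index coincide, [heavy_bad2] applies. If an [A] and a [B] of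
   different indices are both the heavy triangle of the third index, [heavy_AB] does. One of the two
   always occurs. *)
case: (c3 _ A3L (bA3 _ b3B)) => eA3; rewrite {}eA3 in bA3 A3L.
- case: (c3 _ B3L (bB3 _ a3A)) => eB3; rewrite {}eB3 in bB3 B3L.
    exact: (heavy_bad2 a1A b1B a3A b3B h1 H1_3 (bA3 _ b1B) (bB3 _ a1A) (bA3 _ b3B)).
  case: (c2 _ B2L (bB2 _ a2A)) => eB2; rewrite {}eB2 in bB2 B2L.
    by apply: (@heavy_AB a1 b1 a2 b2 a3 b3 H1).
  case: (c1 _ A1L (bA1 _ b1B)) => eA1; rewrite {}eA1 in bA1 A1L.
    by apply: (@heavy_AB a2 b2 a3 b3 a1 b1 H2).
  by apply: (@heavy_AB a3 b3 a2 b2 a1 b1 H3).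
- case: (c3 _ B3L (bB3 _ a3A)) => eB3; rewrite {}eB3 in bB3 B3L; last first.
    exact: (heavy_bad2 a2A b2B a3A b3B h2 H2_3 (bA3 _ b2B) (bB3 _ a2A) (bA3 _ b3B)).
  case: (c2 _ A2L (bA2 _ b2B)) => eA2; rewrite {}eA2 in bA2 A2L.
    by apply: (@heavy_AB a1 b1 a3 b3 a2 b2 H1).
  case: (c1 _ B1L (bB1 _ a1A)) => eB1; rewrite {}eB1 in bB1 B1L.
    by apply: (@heavy_AB a2 b2 a1 b1 a3 b3 H2).
  by apply: (@heavy_AB a3 b3 a1 b1 a2 b2 H3).
Qed.

End Bip.

(** * Edge counts by blocks *)

Section Count.
Variables (V : eqType) (g : rel V).
Implicit Types (L : seq (V * V * V)) (t : V * V * V).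

(** For [t' = t] each side is counted twice, as in [E2]. *)
Definition tt t t' : nat := et g t.1.1 t' + et g t.1.2 t' + et g t.2 t'.

Lemma E2_split U R L : symmetric g -> perm_eq U (R ++ vs3 L) ->
  E2 g U = \sum_(x <- R) \sum_(y <- R) g x y + 2 * (\sum_(t <- L) \sum_(x <- R) et g x t)
    + \sum_(t <- L) \sum_(t' <- L) tt t t'.
Proof.
move=> gS p; rewrite (E2_perm _ p) /E2 /deg.
have D x : \sum_(y <- R ++ vs3 L) g x y = \sum_(y <- R) g x y + \sum_(t <- L) et g x t.
  by rewrite big_cat /= sum_vs3.
rewrite (eq_bigr _ (fun x _ => D x)) big_split /= !big_cat /= !sum_vs3.
have E t : \sum_(y <- R) g t.1.1 y + \sum_(y <- R) g t.1.2 y + \sum_(y <- R) g t.2 y =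
    \sum_(x <- R) et g x t.
  by rewrite -!big_split /=; apply: eq_bigr => x _; rewrite /et ![g _ x]gS.
rewrite (eq_bigr _ (fun t _ => E t)).
have E' t : \sum_(t' <- L) et g t.1.1 t' + \sum_(t' <- L) et g t.1.2 t' + \sum_(t' <- L) et g t.2 t' =
    \sum_(t' <- L) tt t t'.
  by rewrite -!big_split.
rewrite (eq_bigr _ (fun t _ => E' t)) (exchange_big _ _ _ _ _ (fun x t => et g x t)) /=.
set s1 := bigop _ _ _; set s2 := bigop _ _ _; set s3 := bigop _ _ _; clear; lia.
Qed.

Lemma et_perm x t p q r : perm_eq (verts t) [:: p; q; r] -> et g x t = g x p + g x q + g x r.
Proof.
move=> pm; have : \sum_(y <- verts t) g x y = \sum_(y <- [:: p; q; r]) g x y by exact: perm_big.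
by rewrite /verts !big_cons !big_nil /et; lia.
Qed.

Lemma tt_perm t p q r t' p' q' r' : perm_eq (verts t) [:: p; q; r] ->
  perm_eq (verts t') [:: p'; q'; r'] ->
  tt t t' = (g p p' + g p q' + g p r') + (g q p' + g q q' + g q r') + (g r p' + g r q' + g r r').
Proof.
move=> pm pm'; rewrite -!(et_perm _ pm').
have : \sum_(y <- verts t) et g y t' = \sum_(y <- [:: p; q; r]) et g y t' by exact: perm_big.
by rewrite /verts !big_cons !big_nil /tt; lia.
Qed.

Lemma tt_self t : irreflexive g -> tt t t <= 6.
Proof. by move=> gI; rewrite /tt /et !gI; do 6 case: (g _ _). Qed.

Lemma tt_le9 t t' : tt t t' <= 9.
Proof. by rewrite /tt /et; do 9 case: (g _ _). Qed.

End Count.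

(** * Edge count over a complete bipartite remainder *)

Section BipCount.
Variables (V D : eqType) (col : V -> V -> D).
Hypothesis colC : forall x y, col x y = col y x.
Implicit Types (R : seq V).
Local Notation rainbow_rel := (rainbow_rel col).
Variables (U : seq V) (j N : nat).
Hypothesis UU : uniq U.
Hypothesis nok : ~ has_packing col U j.+1.
Variable g : rel V.
Hypothesis rg : rainbow_rel g.
Let gS : symmetric g. Proof. by case: rg. Qed.

(** [d] sees both sides completely, [b] sees only [A] and [c] only [B]; so every [a b] sends four
    edges to [t]. *)
Definition dominated (A B : seq V) t d b c :=
  [/\ perm_eq (verts t) [:: d; b; c], {in A, forall a, [&& g a d, g a b & ~~ g a c]} &
      {in B, forall v, [&& g v d, g v c & ~~ g v b]}].

Section Final.
Variables (A B : seq V) (L : seq (V * V * V)) (t0 : V * V * V) (p q r : V).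
Hypothesis pU : perm_eq U (A ++ B ++ vs3 (t0 :: L)).
Hypothesis aL : all (tri g) (t0 :: L).
Hypothesis sL : j = (size L).+1.
Hypothesis bip : {in A & B, forall a b, g a b}.
Hypotheses (sA : size A = N) (sB : size B = N) (N3 : 2 < N).
Hypothesis p0 : perm_eq (verts t0) [:: p; q; r].
Hypothesis t0A : {in A, forall a, [&& g a p, g a q & ~~ g a r]}.
Hypothesis t0B : {in B, forall b, [&& g b r, ~~ g b p & ~~ g b q]}.
Variables (a1 a2 b1 b2 : V).
Hypotheses (a1A : a1 \in A) (a2A : a2 \in A) (a12 : a1 != a2).
Hypotheses (b1B : b1 \in B) (b2B : b2 \in B) (b12 : b1 != b2).
Hypotheses (cA : col p q = col a1 a2) (cB : col p q = col b1 b2).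
Hypothesis dom : {in L, forall t, exists d b c, dominated A B t d b c}.

Let uAB : uniq (A ++ B).
Proof. by have := UU; rewrite (perm_uniq pU) catA cat_uniq => /and3P[]. Qed.
Let uA : uniq A. Proof. by have := uAB; rewrite cat_uniq => /and3P[]. Qed.
Let uB : uniq B. Proof. by have := uAB; rewrite cat_uniq => /and3P[]. Qed.

Lemma third_element (S : seq V) x y : uniq S -> 2 < size S -> exists z, [/\ z \in S, z != x & z != y].
Proof.
move=> uS sS; have [/hasP[z zS /andP[h1 h2]]|/hasPn h] := boolP (has (fun z => (z != x) && (z != y)) S).
  by exists z.
suff : size S <= size [:: x; y] by rewrite leqNgt sS.
apply: uniq_leq_size => // z /h; rewrite negb_and !negbK !inE.
by [].
Qed.

Let localize3 := localize UU pU.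

Lemma tri0 : [/\ g p q, g p r & g q r].
Proof. by apply: (tri_adj rg _ p0); apply: (allP aL); apply: mem_head. Qed.

(** Trade [p q] for [b1 b2] or [a1 a2]. The new edge closes a triangle with the opposite side, the
    forbidden edge closes one with [a2] or [b2], and [a3 b3 d] is the third: three triangles in
    place of [t] and [t0]. *)
Lemma cross_t0 t d b c : t \in L -> dominated A B t d b c ->
  [/\ ~~ g b p, ~~ g b q & ~~ g c r].
Proof.
move=> tL [pt tA tB].
have [a3 [a3A a31 a32]] := third_element a1 a2 uA (eq_ind_r (fun n => 2 < n) N3 sA).
have [b3 [b3B b31 b32]] := third_element b1 b2 uB (eq_ind_r (fun n => 2 < n) N3 sB).
have [gpq gpr gqr] := tri0.
have ta : tri g t by apply: (allP aL); rewrite inE tL orbT.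
have [gdb gdc gbc] := tri_adj rg ta pt.
have [|| R pR] := @localize3 [:: a1; a2; a3] [:: b1; b2; b3].
- by rewrite /= !inE !negb_or a12 eq_sym a31 eq_sym a32 a1A a2A a3A.
- by rewrite /= !inE !negb_or b12 eq_sym b31 eq_sym b32 b1B b2B b3B.
have pr := vs3_rem tL; rewrite vs3_cons in pR.
have pW : perm_eq U ([:: a1; a2; a3; b1; b2; b3; d; b; c; p; q; r] ++ R ++ vs3 (rem t L)).
  by move: p0 pt; rewrite /verts; clear - pR pr; move=> p0 pt; perm_count.
have uq : uniq [:: a1; a2; a3; b1; b2; b3; d; b; c; p; q; r].
  by have := UU; rewrite (perm_uniq pW) cat_uniq => /andP[].
have aU x : x \in [:: a1; a2; a3; b1; b2; b3; d; b; c; p; q; r] -> x \in U.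
  by rewrite (perm_mem pW) mem_cat => ->.
have pL : p \notin vs3 (rem t L).
  have := UU; rewrite (perm_uniq pW) cat_uniq => /and3P[_ /hasPn h _].
  by apply/negP => pL; have := h p; rewrite mem_cat pL orbT !inE !eqxx !orbT => /(_ isT).
have aL' : all (tri g) (rem t L).
  by apply/allP => x /mem_rem xL; apply: (allP aL); rewrite inE xL orbT.
have sL' : j.+1 <= 3 + size (rem t L).
  by rewrite size_rem // sL; move: tL; case: (L) => //= *; clear; lia.
have [g1 [rg1 g1a aL1 k1]] := recolor colC UU rg (aU _ (mem_head _ _))
  (aU a2 ltac:(by rewrite !inE eqxx orbT)) a12 gpq cA pL aL'.
have [g2 [rg2 g2b aL2 k2]] := recolor colC UU rg (aU b1 ltac:(by rewrite !inE eqxx !orbT))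
  (aU b2 ltac:(by rewrite !inE eqxx !orbT)) b12 gpq cB pL aL'.
have F1 I := @no_repl _ _ _ U j.+1 a1 g1 _ I R _ nok UU pW rg1 aL1.
have F2 I := @no_repl _ _ _ U j.+1 a1 g2 _ I R _ nok UU pW rg2 aL2.
have /and3P[a1d a1b _] := tA _ a1A. have /and3P[a2d a2b _] := tA _ a2A.
have /and3P[a3d a3b _] := tA _ a3A.
have /and3P[b1d b1c _] := tB _ b1B. have /and3P[b2d b2c _] := tB _ b2B.
have /and3P[b3d b3c _] := tB _ b3B.
have /and3P[a1p a1q _] := t0A a1A. have /and3P[a2p a2q _] := t0A a2A.
have /and3P[a3p a3q _] := t0A a3A.
have /and3P[b1r _ _] := t0B b1B. have /and3P[b2r _ _] := t0B b2B. have /and3P[b3r _ _] := t0B b3B.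
have [b1a1 b2a1] : g b1 a1 /\ g b2 a1 by split; rewrite gS bip.
have [a1b1 a2b1 a3b3] : [/\ g a1 b1, g a2 b1 & g a3 b3] by split; rewrite bip.
split; apply/negP => h.
- have := F2 [:: (3, 4, 0); (1, 7, 9); (2, 5, 6)] isT sL'; rewrite /= /tri /= g2b.
  by rewrite !k2 //; same_absurd uq.
- have := F2 [:: (3, 4, 0); (1, 7, 10); (2, 5, 6)] isT sL'; rewrite /= /tri /= g2b.
  by rewrite !k2 //; same_absurd uq.
- have := F1 [:: (0, 1, 3); (4, 8, 11); (2, 5, 6)] isT sL'; rewrite /= /tri /= g1a.
  by rewrite !k1 //; same_absurd uq.
Qed.

Lemma cross_L t d b c t' d' b' c' : t \in L -> t' \in rem t L ->
  dominated A B t d b c -> dominated A B t' d' b' c' -> ~~ g b b' /\ ~~ g c c'.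
Proof.
move=> tL tL' [pt tA tB] [pt' tA' tB'].
have [a3 [a3A a31 a32]] := third_element a1 a2 uA (eq_ind_r (fun n => 2 < n) N3 sA).
have [b3 [b3B b31 b32]] := third_element b1 b2 uB (eq_ind_r (fun n => 2 < n) N3 sB).
have [|| R pR] := @localize3 [:: a1; a2; a3] [:: b1; b2; b3].
- by rewrite /= !inE !negb_or a12 eq_sym a31 eq_sym a32 a1A a2A a3A.
- by rewrite /= !inE !negb_or b12 eq_sym b31 eq_sym b32 b1B b2B b3B.
have pr := vs3_rem tL; rewrite vs3_cons in pR; have pr' := vs3_rem tL'.
have pW : perm_eq U ([:: a1; a2; a3; b1; b2; b3; d; b; c; d'; b'; c'] ++
   R ++ vs3 (t0 :: rem t' (rem t L))).
  rewrite vs3_cons; move: pt pt'; rewrite /verts; clear - pR pr pr'; move=> pt pt'; perm_count.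
have aL' : all (tri g) (t0 :: rem t' (rem t L)).
  apply/allP => x; rewrite inE => /orP[/eqP->|/mem_rem/mem_rem xL]; apply: (allP aL);
    by rewrite ?mem_head // inE xL orbT.
have sL' : j.+1 <= 3 + size (t0 :: rem t' (rem t L)).
  by rewrite /= !size_rem // sL; move: tL; case: (L) => //= *; clear; lia.
have F I := @no_repl _ _ _ U j.+1 a1 g _ I R _ nok UU pW rg aL'.
have /and3P[a1d a1b _] := tA _ a1A. have /and3P[a1d' a1b' _] := tA' _ a1A.
have /and3P[a2d _ _] := tA _ a2A. have /and3P[a3d' _ _] := tA' _ a3A.
have /and3P[b1d b1c _] := tB _ b1B. have /and3P[b1d' b1c' _] := tB' _ b1B.
have /and3P[b2d _ _] := tB _ b2B. have /and3P[b3d' _ _] := tB' _ b3B.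
have [a2b2 a3b3] : g a2 b2 /\ g a3 b3 by split; rewrite bip.
split; apply/negP => h.
- have := F [:: (0, 7, 10); (1, 4, 6); (2, 5, 9)] isT sL'; rewrite /= /tri /=.
  by rewrite a1b a1b' h a2b2 a3b3 a2d b2d a3d' b3d'.
- have := F [:: (3, 8, 11); (1, 4, 6); (2, 5, 9)] isT sL'; rewrite /= /tri /=.
  by rewrite b1c b1c' h a2b2 a3b3 a2d b2d a3d' b3d'.
Qed.

Lemma side_nonadj (A' B' : seq V) : perm_eq U (A' ++ B' ++ vs3 (t0 :: L)) ->
  {in A' & B', forall a b, g a b} -> 0 < size B' -> {in A' &, forall a a', ~~ g a a'}.
Proof.
move=> pU' bip' sB' a a' aA aA'; apply/negP => gaa.
case: B' sB' pU' bip' => // b B' _ pU' bip'.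
have aa := rainbow_rel_neq rg gaa.
have [|| R pR] := @localize _ _ UU _ _ _ pU' [:: a; a'] [:: b].
- by rewrite /= inE aa aA aA'.
- by rewrite /= mem_head.
have sL' : j.+1 <= 1 + size (t0 :: L) by rewrite /= sL.
have := @no_repl _ _ _ U j.+1 a g _ [:: (0, 1, 2)] R _ nok UU pR rg aL isT sL'.
by rewrite /= /tri /= gaa !bip' ?mem_head.
Qed.

(** There are [N * N] edges between the sides, [3 * N] to [t0], [4 * N] to any other triangle, at
    most six between [t0] and another triangle by [cross_t0], and at most seven between two others
    by [cross_L]. *)
Lemma final_count : E2 g U <= 2 * (N * N) + 2 * (3 * N + 4 * N * size L) +
  (6 + 12 * size L + size L * (6 + 7 * (size L).-1)).
Proof.
have [_ gI _] := rg.
have pU' : perm_eq U (B ++ A ++ vs3 (t0 :: L)) by rewrite (perm_trans pU) // perm_catCA.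
have bip' : {in B & A, forall b a, g b a} by move=> b a bB aA; rewrite gS bip.
have nA := side_nonadj pU bip (eq_ind_r (fun n => 0 < n) (ltnW (ltnW N3)) sB).
have nB := side_nonadj pU' bip' (eq_ind_r (fun n => 0 < n) (ltnW (ltnW N3)) sA).
have pR : perm_eq U ((A ++ B) ++ vs3 (t0 :: L)) by rewrite -catA.
rewrite (E2_split gS pR).
apply: leq_add; first apply: leq_add.
- rewrite big_cat /= mul2n -addnn; apply: leq_add.
    rewrite -{2}sA; apply: sum_nat_le => a aA; rewrite big_cat /=.
    have -> : \sum_(i <- A) g a i = 0.
      by rewrite big_seq big1 // => i iA; rewrite (negbTE (nA _ _ aA iA)).
    by rewrite -sB -(mul1n (size B)); apply: sum_nat_le => b _; case: (g a b).
  rewrite -{2}sB; apply: sum_nat_le => b bB; rewrite big_cat /=.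
  have -> : \sum_(i <- B) g b i = 0.
    by rewrite big_seq big1 // => i iB; rewrite (negbTE (nB _ _ bB iB)).
  by rewrite addn0 -sA -(mul1n (size A)); apply: sum_nat_le => a _; case: (g b a).
- rewrite leq_mul2l /= big_cons; apply: leq_add.
    rewrite big_cat /= (_ : 3 * N = 2 * size A + 1 * size B); last by rewrite sA sB; clear; lia.
    apply: leq_add; apply: sum_nat_le => x xin; rewrite (et_perm g x p0).
      by have /and3P[-> -> /negbTE->] := t0A xin.
    by have /and3P[-> /negbTE-> /negbTE->] := t0B xin.
  apply: sum_nat_le => t tL; have [d [b [c [pt tA tB]]]] := dom tL.
  rewrite big_cat /= (_ : 4 * N = 2 * size A + 2 * size B); last by rewrite sA sB; clear; lia.
  apply: leq_add; apply: sum_nat_le => x xin; rewrite (et_perm g x pt).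
    by have /and3P[-> -> /negbTE->] := tA _ xin.
  by have /and3P[-> -> /negbTE->] := tB _ xin.
have c0 t : t \in L -> tt g t t0 <= 6 /\ tt g t0 t <= 6.
  move=> tL; have [d [b [c dm]]] := dom tL; have [n1 n2 n3] := cross_t0 tL dm.
  have [pt _ _] := dm; rewrite (tt_perm g pt p0) (tt_perm g p0 pt) [g p b]gS [g q b]gS [g r c]gS.
  by rewrite (negbTE n1) (negbTE n2) (negbTE n3); split; do 6 case: (g _ _).
set q0 := size L * (_ + _).
have -> : 6 + 12 * size L + q0 = 6 + (6 * size L + (6 * size L + q0)) by clear; lia.
rewrite big_cons [X in X + _ <= _]big_cons -addnA.
apply: leq_add; first exact: tt_self.
apply: leq_add; first by apply: sum_nat_le => t /c0[].
under eq_bigr => t _ do rewrite big_cons.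
rewrite big_split /=; apply: leq_add; first by apply: sum_nat_le => t /c0[].
rewrite /q0 mulnC; apply: sum_nat_le => t tL.
rewrite (perm_big _ (perm_to_rem tL)) big_cons /=.
apply: leq_add; first exact: tt_self.
rewrite -(size_rem tL); apply: sum_nat_le => t' tL'.
have [d [b [c dm]]] := dom tL; have [d' [b' [c' dm']]] := dom (mem_rem tL').
have [n1 n2] := cross_L tL tL' dm dm'.
have [pt _ _] := dm; have [pt' _ _] := dm'; rewrite (tt_perm g pt pt').
by rewrite (negbTE n1) (negbTE n2); do 7 case: (g _ _).
Qed.

End Final.
End BipCount.

(** * The packing over a complete bipartite remainder *)

Section BipBound.
Variables (V D : eqType) (col : V -> V -> D).
Hypothesis colC : forall x y, col x y = col y x.
Implicit Types (R : seq V).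
Local Notation rainbow_rel := (rainbow_rel col).
Variables (U : seq V) (j N : nat).
Hypothesis UU : uniq U.
Hypothesis nok : ~ has_packing col U j.+1.
Variable g : rel V.
Hypothesis rg : rainbow_rel g.
Let gS : symmetric g. Proof. by case: rg. Qed.

Lemma two_other_elements (S : seq V) x : uniq S -> 2 < size S -> x \in S ->
  exists y z, [/\ y \in S, z \in S & [/\ x != y, x != z & y != z]].
Proof.
move=> uS sS xS; have [y [yS yx _]] := third_element x x uS sS.
have [z [zS zx zy]] := third_element x y uS sS.
by exists y, z; split=> //; split; rewrite eq_sym.
Qed.

Section Pattern.
Variables (A B : seq V) (L : seq (V * V * V)).
Hypothesis pU : perm_eq U (A ++ B ++ vs3 L).
Hypothesis aL : all (tri g) L.
Hypothesis sL : size L = j.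
Hypothesis bip : {in A & B, forall a b, g a b}.

(** A finite check: this is the only distribution of the edges to [t] that leaves no two disjoint
    triangles on the seven vertices. *)
Lemma same_pattern t a a' b b' : t \in L -> a \in A -> a' \in A -> a != a' ->
  b \in B -> b' \in B -> b != b' ->
  [/\ e2 g (a, b) t = 4, e2 g (a', b') t = 4, e2 g (a, b') t = 4 & e2 g (a', b) t = 4] ->
  [&& g a t.1.1 == g a' t.1.1, g a t.1.2 == g a' t.1.2, g a t.2 == g a' t.2,
      g b t.1.1 == g b' t.1.1, g b t.1.2 == g b' t.1.2, g b t.2 == g b' t.2,
      et g a t == 2, et g b t == 2 & [|| g a t.1.1 != g b t.1.1, g a t.1.2 != g b t.1.2
      | g a t.2 != g b t.2]].
Proof.
move=> tL aA a'A aa bB b'B bb.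
have [|| R p] := localize UU pU (sa := [:: a; a']) (sb := [:: b; b']).
- by rewrite /= inE aa aA a'A.
- by rewrite /= inE bb bB b'B.
have p3 := vs3_rem tL.
have tt : tri g t by apply: (allP aL).
have pU' : perm_eq U ([:: a; a'; b; b'; t.1.1; t.1.2; t.2] ++ R ++ vs3 (rem t L)) by perm_count.
have aL' : all (tri g) (rem t L) by apply/allP => x /mem_rem; apply: (allP aL).
have sL' : j.+1 <= 2 + size (rem t L) by rewrite size_rem // -sL ltnS leqSpred.
have F I := @no_repl _ _ _ U j.+1 a g _ I R _ nok UU pU' rg aL'.
have /and3P[t1 t2 t3] := tt.
have /and4P[ab ab' a'b a'b'] : [&& g a b, g a b', g a' b & g a' b'] by rewrite !bip.
have := F [:: (0, 2, 4); (1, 3, 5)] isT sL'; have := F [:: (0, 2, 4); (1, 3, 6)] isT sL'.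
have := F [:: (0, 2, 5); (1, 3, 4)] isT sL'; have := F [:: (0, 2, 5); (1, 3, 6)] isT sL'.
have := F [:: (0, 2, 6); (1, 3, 4)] isT sL'; have := F [:: (0, 2, 6); (1, 3, 5)] isT sL'.
have := F [:: (0, 3, 4); (1, 2, 5)] isT sL'; have := F [:: (0, 3, 4); (1, 2, 6)] isT sL'.
have := F [:: (0, 3, 5); (1, 2, 4)] isT sL'; have := F [:: (0, 3, 5); (1, 2, 6)] isT sL'.
have := F [:: (0, 3, 6); (1, 2, 4)] isT sL'; have := F [:: (0, 3, 6); (1, 2, 5)] isT sL'.
have := F [:: (0, 4, 5); (1, 3, 6)] isT sL'; have := F [:: (0, 4, 6); (1, 3, 5)] isT sL'.
have := F [:: (0, 5, 6); (1, 3, 4)] isT sL'.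
have := F [:: (2, 4, 5); (1, 3, 6)] isT sL'; have := F [:: (2, 4, 6); (1, 3, 5)] isT sL'.
have := F [:: (2, 5, 6); (1, 3, 4)] isT sL'.
have := F [:: (1, 4, 5); (0, 2, 6)] isT sL'; have := F [:: (1, 4, 6); (0, 2, 5)] isT sL'.
have := F [:: (1, 5, 6); (0, 2, 4)] isT sL'.
rewrite /e2 /et /tri /= ab ab' a'b a'b' t1 t2 t3 !andbT /=; clear.
move=> ? ? ? ? ? ? ? ? ? ? ? ? ? ? ? ? ? ? ? ? ? [].
repeat match goal with H : is_true _ |- _ => move: H end.
case: (g a t.1.1); case: (g a t.1.2); case: (g a t.2);
case: (g b t.1.1); case: (g b t.1.2); case: (g b t.2) => //=;
by case: (g a' t.1.1); case: (g a' t.1.2); case: (g a' t.2);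
case: (g b' t.1.1); case: (g b' t.1.2); case: (g b' t.2).
Qed.

Lemma dominated_exists t a0 b0 : t \in L -> uniq A -> uniq B -> 1 < size A -> 1 < size B ->
  a0 \in A -> b0 \in B ->
  {in A & B, forall a b, e2 g (a, b) t = 4} -> exists d b c, dominated g A B t d b c.
Proof.
move=> tL uA uB sA sB a0A b0B e4.
have other (S : seq V) x : uniq S -> 1 < size S -> exists2 y, y \in S & x != y.
  case: S => [|y [|z S]] // /andP[]; rewrite inE negb_or => /andP[yz _] _ _.
  by case: (eqVneq x y) => [->|xy]; [exists z; rewrite ?inE ?eqxx ?orbT|exists y; rewrite ?inE ?eqxx].
have P a a' b b' : a \in A -> a' \in A -> a != a' -> b \in B -> b' \in B -> b != b' -> _ :=
  fun aA a'A aa bB b'B bb => same_pattern tL aA a'A aa bB b'B bb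
    (And4 (e4 a b aA bB) (e4 a' b' a'A b'B) (e4 a b' aA b'B) (e4 a' b a'A bB)).
have [a1 a1A a01] := other _ a0 uA sA; have [b1 b1B b01] := other _ b0 uB sB.
have EA a : a \in A -> [/\ g a t.1.1 = g a0 t.1.1, g a t.1.2 = g a0 t.1.2 & g a t.2 = g a0 t.2].
  move=> aA; case: (eqVneq a0 a) => [->//|ne].
  by have /and5P[/eqP-> /eqP-> /eqP-> _ _] := P _ _ _ _ a0A aA ne b0B b1B b01.
have EB b : b \in B -> [/\ g b t.1.1 = g b0 t.1.1, g b t.1.2 = g b0 t.1.2 & g b t.2 = g b0 t.2].
  move=> bB; case: (eqVneq b0 b) => [->//|ne].
  by have /and5P[_ _ _ /eqP-> /and5P[/eqP-> /eqP-> _ _ _]] := P _ _ _ _ a0A a1A a01 b0B bB ne.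
have /and5P[_ _ _ _ /and5P[_ _ h1 h2 h3]] := P _ _ _ _ a0A a1A a01 b0B b1B b01.
have DD d b c : perm_eq (verts t) [:: d; b; c] ->
    [&& g a0 d, g a0 b & ~~ g a0 c] -> [&& g b0 d, g b0 c & ~~ g b0 b] ->
    exists d b c, dominated g A B t d b c.
  move=> pm ha hb; exists d, b, c; split=> // x xin.
    have ex v : v \in verts t -> g x v = g a0 v.
      by have [q1 q2 q3] := EA _ xin; rewrite !inE => /or3P[] /eqP->.
    by rewrite !ex // (perm_mem pm) !inE eqxx ?orbT.
  have ex v : v \in verts t -> g x v = g b0 v.
    by have [q1 q2 q3] := EB _ xin; rewrite !inE => /or3P[] /eqP->.
  by rewrite !ex // (perm_mem pm) !inE eqxx ?orbT.
have pm1 : perm_eq (verts t) [:: t.1.1; t.1.2; t.2] by [].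
have pm2 : perm_eq (verts t) [:: t.1.1; t.2; t.1.2] by rewrite /verts; perm_count.
have pm3 : perm_eq (verts t) [:: t.1.2; t.1.1; t.2] by rewrite /verts; perm_count.
have pm4 : perm_eq (verts t) [:: t.1.2; t.2; t.1.1] by rewrite /verts; perm_count.
have pm5 : perm_eq (verts t) [:: t.2; t.1.1; t.1.2] by rewrite /verts; perm_count.
have pm6 : perm_eq (verts t) [:: t.2; t.1.2; t.1.1] by rewrite /verts; perm_count.
move: h1 h2 h3 (DD _ _ _ pm1) (DD _ _ _ pm2) (DD _ _ _ pm3) (DD _ _ _ pm4) (DD _ _ _ pm5) (DD _ _ _ pm6).
rewrite /et; clear.
case: (g a0 _); case: (g a0 _); case: (g a0 _) => //=;
by case: (g b0 _); case: (g b0 _); case: (g b0 _) => //= _ _ _; auto.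
Qed.

End Pattern.

Section Bound.
Variables (A B : seq V) (L : seq (V * V * V)).
Hypothesis pU : perm_eq U (A ++ B ++ vs3 L).
Hypothesis aL : all (tri g) L.
Hypothesis sL : size L = j.
Hypothesis bip : {in A & B, forall a b, g a b}.
Hypothesis dl : {in A & B, forall a b, size A + size B + 4 * j <= deg g U a + deg g U b + 1}.
Hypotheses (sA : size A = N) (sB : size B = N) (N3 : 2 < N).

(** The totally bad triangle [t0] receives only three edges from any [a b], which uses up all slack
    in the degrees: three at [t0] and four at every other triangle. It remains to see that the
    colours of [a1 a2] and [b1 b2] lie on the same side [p q] of [t0], as [final_count] requires. *)
Lemma complete_bipartite_bound : 0 < j /\ E2 g U <= 2 * (N * N) + 2 * (3 * N + 4 * N * j.-1) +
  (6 + 12 * j.-1 + j.-1 * (6 + 7 * j.-2)).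
Proof.
have pU' : perm_eq U (B ++ A ++ vs3 L) by rewrite (perm_trans pU) // perm_catCA.
have bip' : {in B & A, forall b a, g b a} by move=> b a bB aA; rewrite gS bip.
have uA : uniq A by have := UU; rewrite (perm_uniq pU) cat_uniq => /and3P[].
have uB : uniq B by have := UU; rewrite (perm_uniq pU') cat_uniq => /and3P[].
have sA2 : 2 < size A by rewrite sA.
have sB2 : 2 < size B by rewrite sB.
have := totally_bad_exists colC UU nok rg pU aL sL bip dl sA2 sB2.
move=> [a1 [a2 [b1 [b2 [t0 [[a1A a2A a12] [[b1B b2B b12] [t0L cA cB bd]]]]]]]].
have j0 : 0 < j by rewrite -sL; case: (L) t0L.
split=> //.
have pr := perm_to_rem t0L; set L' := rem t0 L in pr.
have sL' : j = (size L').+1 by rewrite -sL (perm_size pr).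
have pV : perm_eq U (A ++ B ++ vs3 (t0 :: L')).
  by rewrite (perm_trans pU) // !perm_cat2l; apply: vs3_perm.
have aV : all (tri g) (t0 :: L') by rewrite -(perm_all _ pr).
have inL t : t \in L' -> t \in L by apply: mem_rem.
have e3 a b : a \in A -> b \in B -> e2 g (a, b) t0 <= 3 by move=> aA bB; apply/bad_e2/bd.
have S a b : a \in A -> b \in B -> 4 * j <= e2 g (a, b) t0 + \sum_(t <- L') e2 g (a, b) t + 1.
  move=> aA bB; have := sumE UU nok rg pU aL sL bip aA bB (dl aA bB).
  by rewrite (perm_big _ pr) big_cons.
have P8 a a' b b' : a \in A -> a' \in A -> a != a' -> b \in B -> b' \in B -> b != b' ->
    {in L', forall t, e2 g (a, b) t + e2 g (a', b') t = 8}.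
  move=> aA a'A aa bB b'B bb; apply: sum_nat_tight.
    by move=> t tL'; apply: (pairE UU nok rg pU aL sL bip) => //; apply: inL.
  rewrite big_split /=; move: (S _ _ aA bB) (S _ _ a'A b'B) (e3 _ _ aA bB) (e3 _ _ a'A b'B).
  rewrite sL'; move: (\sum_(t <- L') e2 g (a, b) t) (\sum_(t <- L') e2 g (a', b') t).
  by move: (e2 g (a, b) t0) (e2 g (a', b') t0) (size L'); clear; lia.
(* Three disjoint edges whose pairwise sums are eight send four each. *)
have e4 : {in L', forall t, {in A & B, forall a b, e2 g (a, b) t = 4}}.
  move=> t tL' a b aA bB.
  have [a' [a'' [a'A a''A [q1 q2 q3]]]] := two_other_elements uA sA2 aA.
  have [b' [b'' [b'B b''B [r1 r2 r3]]]] := two_other_elements uB sB2 bB.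
  have x1 := P8 _ _ _ _ aA a'A q1 bB b'B r1 _ tL'.
  have x2 := P8 _ _ _ _ aA a''A q2 bB b''B r2 _ tL'.
  have x3 := P8 _ _ _ _ a'A a''A q3 b'B b''B r3 _ tL'.
  by move: x1 x2 x3; clear; lia.
have e03 : {in A & B, forall a b, e2 g (a, b) t0 = 3}.
  move=> a b aA bB; have := S _ _ aA bB; have := e3 _ _ aA bB.
  have : \sum_(t <- L') e2 g (a, b) t <= 4 * size L' by apply: sum_nat_le => t tL'; rewrite e4.
  by rewrite sL'; set s := bigop _ _ _; clear; lia.
have dom : {in L', forall t, exists d b c, dominated g A B t d b c}.
  move=> t tL'; apply: (dominated_exists pU aL sL bip (inL _ tL') uA uB _ _ a1A b1B); try exact: ltnW.
  by move=> a b aA bB; apply: e4.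
(* Three edges and no common neighbour: every vertex of [t0] sees exactly one of [a] and [b]. *)
have opp a b v : a \in A -> b \in B -> v \in verts t0 -> g b v = ~~ g a v.
  move=> aA bB; move: (e03 _ _ aA bB) (bd _ _ aA bB); rewrite badE /e2 /et /= !inE.
  by move=> h1 h2 /or3P[] /eqP->; move: h1 h2; do 6 case: (g _ _).
have constA a v : a \in A -> v \in verts t0 -> g a v = g a1 v.
  by move=> aA vt; have := opp _ _ _ aA b1B vt; rewrite (opp _ _ _ a1A b1B vt) => /negb_inj.
have pVc x y z t (c1 : perm_eq (verts t) [:: x; y; z]) : true by [].
have [p [q [r [pt cpq]]]] := colTP cA.
have [p' [q' [r' [pt' cpq']]]] := colTP cB.
have t0t : tri g t0 by apply: (allP aL).
have jL' : j <= (size L').+1 by rewrite sL'.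
have aL' : all (tri g) L' by have /andP[] := aV.
have loc_col (x y z : V) (A0 B0 : seq V) u u' : perm_eq (verts t0) [:: x; y; z] ->
    perm_eq U (A0 ++ B0 ++ vs3 L) -> {in A0 & B0, forall a b, g a b} -> uniq A0 -> uniq B0 ->
    2 < size A0 -> 2 < size B0 -> u \in A0 -> u' \in A0 -> u != u' -> col x y = col u u' ->
    exists a b, [/\ a \in A0, b \in B0 &
      [/\ ~~ (g a x && g a z), ~~ (g a y && g a z), ~~ (g b x && g b z) & ~~ (g b y && g b z)]].
  move=> pxyz pU0 bip0 uA0 uB0 sA0 sB0 uin u'in uu cc.
  have [a [aA a_1 a_2]] := third_element u u' uA0 sA0.
  have [b [bB _ _]] := third_element u u uB0 sB0; have [w [wB wb _]] := third_element b b uB0 sB0.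
  have [|| R pR] := localize UU pU0 (sa := [:: u; u'; a]) (sb := [:: w; b]).
  - by rewrite /= !inE !negb_or uu [u == a]eq_sym a_1 [u' == a]eq_sym a_2 uin u'in aA.
  - by rewrite /= inE wb wB bB.
  have p3 := vs3_rem t0L; rewrite -/L' in p3.
  have pW : perm_eq U ([:: u; u'; w; a; b; x; y; z] ++ R ++ vs3 L').
    by move: pxyz; rewrite /verts; clear - pR p3; move=> pxyz; perm_count.
  have [gxy gxz gyz] := tri_adj rg t0t pxyz.
  have txyz : tri g (x, y, z) by rewrite /tri /= gxy gxz gyz.
  have [_ h1 h2 h3 h4] := recolor_local colC UU nok rg pW aL' jL' txyz cc (bip0 _ _ uin wB) (bip0 _ _ u'in wB).
  by exists a, b; split.
have inp x y z v : perm_eq (verts t0) [:: x; y; z] -> v \in [:: x; y; z] -> v \in verts t0.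
  by move=> pm; rewrite (perm_mem pm).
(* Once [x y] is traded for [u u'], no vertex of [A] or [B] may see [z] together with [x] or [y].
   Since [A] and [B] see complementary parts of [t0], [z] is separated from both [x] and [y]. *)
have side x y z (A0 B0 : seq V) u u' : perm_eq (verts t0) [:: x; y; z] -> A0 = A /\ B0 = B \/ A0 = B /\ B0 = A ->
    u \in A0 -> u' \in A0 -> u != u' -> col x y = col u u' ->
    [&& g a1 x, g a1 y & ~~ g a1 z] || [&& ~~ g a1 x, ~~ g a1 y & g a1 z].
  move=> pxyz AB uin u'in uu cc.
  have [xt yt zt] : [/\ x \in verts t0, y \in verts t0 & z \in verts t0].
    by split; apply: (inp _ _ _ _ pxyz); rewrite !inE eqxx ?orbT.
  case: AB => -[eA eB]; subst A0 B0.
    have [a [b [aA bB [h1 h2 h3 h4]]]] := loc_col _ _ _ _ _ _ _ pxyz pU bip uA uB sA2 sB2 uin u'in uu cc.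
    move: h1 h2 h3 h4; rewrite !(opp _ _ _ aA bB) // !(constA _ _ aA) //.
    by case: (g a1 x); case: (g a1 y); case: (g a1 z).
  have [b [a [bB aA [h1 h2 h3 h4]]]] := loc_col _ _ _ _ _ _ _ pxyz pU' bip' uB uA sB2 sA2 uin u'in uu cc.
  move: h1 h2 h3 h4; rewrite !(opp _ _ _ aA bB) // !(constA _ _ aA) //.
  by case: (g a1 x); case: (g a1 y); case: (g a1 z).
have s1 := side _ _ _ _ _ _ _ pt (or_introl (conj erefl erefl)) a1A a2A a12 cpq.
have s2 := side _ _ _ _ _ _ _ pt' (or_intror (conj erefl erefl)) b1B b2B b12 cpq'.
have pmm : perm_eq [:: p; q; r] [:: p'; q'; r'] by rewrite -(permPl pt).
(* The vertex of [t0] seen differently from the other two is unique. *)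
have rr : r = r'.
  have : r' \in [:: p; q; r] by rewrite (perm_mem pmm) !inE eqxx !orbT.
  have /eqP cnt := permP pmm (g a1); rewrite /= in cnt.
  rewrite !inE => /or3P[/eqP e|/eqP e|/eqP//]; move: cnt s1 s2; rewrite e; clear.
    case: (g a1 p'); case: (g a1 q'); case: (g a1 p); case: (g a1 q); case: (g a1 r) => //=.
  case: (g a1 p'); case: (g a1 q'); case: (g a1 p); case: (g a1 q); case: (g a1 r) => //=.
have pq : col p q = col b1 b2.
  rewrite -cpq'; have : perm_eq [:: p; q] [:: p'; q'].
    by move: pmm; rewrite -rr; clear => pm; perm_count.
  move=> pm; have u2 : p \in [:: p'; q'] by rewrite -(perm_mem pm) mem_head.
  have one x y : perm_eq [:: x] [:: y] -> x = y.
    by move=> h0; apply/eqP; rewrite -mem_seq1 -(perm_mem h0) mem_head.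
  move: u2; rewrite !inE => /orP[] /eqP e; rewrite e in pm *.
    by congr col; apply: one; perm_count.
  by rewrite colC; congr col; apply: one; perm_count.
have [pv qv rv] : [/\ p \in verts t0, q \in verts t0 & r \in verts t0].
  by split; apply: (inp _ _ _ _ pt); rewrite !inE eqxx ?orbT.
have sj : size L' = j.-1 by rewrite sL'.
rewrite -sj.
(* The side that sees [p] and [q] takes the first role; in the other case [A] and [B] are
   interchanged. *)
case/orP: s1 => /and3P[x1 x2 x3].
- apply: (@final_count V D col colC U j N UU nok g rg A B L' t0 p q r pV aV sL' bip sA sB N3 pt _ _ a1 a2 b1 b2) => //.
  + by move=> a aA; rewrite !(constA _ _ aA) // x1 x2 x3.
  + by move=> b bB; rewrite !(opp _ _ _ a1A bB) // x1 x2 x3.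
have pV' : perm_eq U (B ++ A ++ vs3 (t0 :: L')) by rewrite (perm_trans pV) // perm_catCA.
apply: (@final_count V D col colC U j N UU nok g rg B A L' t0 p q r pV' aV sL' bip' sB sA N3 pt _ _ b1 b2 a1 a2) => //.
- by move=> b bB; rewrite !(opp _ _ _ a1A bB) // x1 x2 x3.
- by move=> a aA; rewrite !(constA _ _ aA) // x1 x2 x3.
move=> t /dom[d [b [c [h1 h2 h3]]]]; exists d, c, b; split=> //.
by rewrite (perm_trans h1) //; perm_count.
Qed.

End Bound.
End BipBound.

(** * From a perfect matching to a complete bipartite graph *)

Section Odd.
Variables (V D : eqType) (col : V -> V -> D).
Hypothesis colC : forall x y, col x y = col y x.
Implicit Types (R : seq V).
Local Notation rainbow_rel := (rainbow_rel col).
Variables (U : seq V) (j N : nat).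
Hypothesis UU : uniq U.
Hypothesis nok : ~ has_packing col U j.+1.

Section Fixed.
Variable g : rel V.
Hypothesis rg : rainbow_rel g.
Let gS : symmetric g. Proof. by case: rg. Qed.
Variables (M : seq (V * V)) (L : seq (V * V * V)).
Hypothesis cf : config U g M [::] L.
Hypotheses (sM : size M = N) (sL : size L = j) (N3 : 2 < N).
Hypothesis pd : forall x y, x \in U -> y \in U -> g x y ->
  2 * N + 4 * j <= deg g U x + deg g U y + 1.

Let jL : j <= size L. Proof. by rewrite sL. Qed.
Let pU : perm_eq U (vs2 M ++ vs3 L). Proof. by case: cf. Qed.
Let aM : {in M, forall m, g m.1 m.2}. Proof. by case: cf => _ /allP. Qed.
Let aL : all (tri g) L. Proof. by case: cf. Qed.

Lemma inU m : m \in M -> m.1 \in U /\ m.2 \in U.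
Proof. by move=> /mem_vs2 /andP[h1 h2]; rewrite !(perm_mem pU) !mem_cat h1 h2. Qed.

Lemma uniqR : uniq (vs2 M).
Proof. by have := UU; rewrite (perm_uniq pU) cat_uniq => /and3P[]. Qed.

Lemma uniq_vs2 (M' : seq (V * V)) : uniq (vs2 M') -> uniq M'.
Proof.
elim: M' => // m M' IH; rewrite vs2_cons [uniq (m :: M')]/=  [uniq (_ :: _)]/=.
move=> /and3P[h1 h2 /IH ->]; rewrite andbT; apply: contra h1 => /mem_vs2 /andP[h _].
by rewrite inE h orbT.
Qed.

Let uM : uniq M. Proof. exact: uniq_vs2 uniqR. Qed.

Lemma free_tri x y v : x \in vs2 M -> y \in vs2 M -> v \in vs2 M -> g x y -> g x v + g y v <= 1.
Proof.
move=> xR yR vR gxy.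
have pR : perm_eq (vs2 M ++ [::]) (x :: y :: [seq z <- vs2 M | z \notin [:: x; y]]).
  rewrite cats0; apply: (@sub_perm V (vs2 M) [:: x; y]); first exact: uniqR.
    by rewrite /= inE (rainbow_rel_neq rg gxy).
  by move=> z; rewrite !inE => /orP[] /eqP->.
by apply: (degR_pair UU nok rg cf jL gxy pR); rewrite mem_cat vR.
Qed.

Definition rsum m := \sum_(w <- vs2 M) (g m.1 w + g m.2 w).
Definition tsum (m : V * V) := \sum_(t <- L) e2 g m t.

Lemma rt_sum m : m \in M -> 2 * N + 4 * j <= rsum m + tsum m + 1.
Proof.
move=> mM; have [m1 m2] := inU mM; have := pd m1 m2 (aM mM).
suff -> : deg g U m.1 + deg g U m.2 = rsum m + tsum m by [].
have E w : deg g U w = \sum_(v <- vs2 M) g w v + \sum_(t <- L) et g w t.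
  by rewrite (deg_perm _ _ pU) /deg big_cat /= sum_vs3.
by rewrite !E addnACA -!big_split.
Qed.

Lemma rsum_le1 m : m \in M -> {in vs2 M, forall w, g m.1 w + g m.2 w <= 1}.
Proof.
by move=> mM w wR; have /andP[h1 h2] := mem_vs2 mM; apply: free_tri => //; apply: aM.
Qed.

Lemma rsum_le m : m \in M -> rsum m <= 2 * N.
Proof. by move=> mM; have := sum_nat_le (rsum_le1 mM); rewrite size_vs2 sM mul1n. Qed.

Lemma rsum_miss m (W : seq V) : m \in M -> uniq W -> {subset W <= vs2 M} ->
  {in W, forall w, g m.1 w + g m.2 w = 0} -> rsum m + size W <= 2 * N.
Proof.
move=> mM uW sW W0; have p := sub_perm uniqR uW sW.
rewrite /rsum (perm_big _ p) big_cat /= (_ : \sum_(w <- W) _ = 0); last first.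
  by rewrite big_seq big1.
have := perm_size p; rewrite size_vs2 sM size_cat => ->; rewrite add0n addnC leq_add2l.
rewrite -(mul1n (size _)); apply: sum_nat_le => w; rewrite mem_filter => /andP[_].
exact: rsum_le1.
Qed.

Lemma pair8 m m' t : m \in M -> m' \in rem m M -> t \in L -> e2 g m t + e2 g m' t <= 8.
Proof.
move=> mM m'M tL; have m'M' := mem_rem m'M.
have mM' : m \in rem m' M.
  by move: m'M; rewrite !mem_rem_uniq // !inE eq_sym mM => /andP[->].
case: (ltnP 4 (e2 g m t)) => [|h1]; first exact: (e2_pairs UU nok rg cf jL).
case: (ltnP 4 (e2 g m' t)) => [|h2]; last by rewrite (leq_add h1 h2).
by rewrite addnC; apply: (e2_pairs UU nok rg cf jL).
Qed.

(** If [v] saw no end of [m], then some end [x0] of [m] would see no end of [m'], as the partner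
    [v'] of [v] sees at most one. Both edges lose one outside the packing, so together they send
    exactly eight edges to every triangle. A third matching edge closes a 4-cycle with [v v']; the
    triangle [t0] holding the colour of a diagonal is bad for [m], and nothing makes up for this
    shortage. *)
Lemma no_missing m m' v : m \in M -> m' \in rem m M -> v \in [:: m'.1; m'.2] ->
  g m.1 v + g m.2 v = 1.
Proof.
move=> mM m'M vm'; have m'M' := mem_rem m'M.
have /andP[m'1 m'2] := mem_vs2 m'M'.
have vR : v \in vs2 M by move: vm'; rewrite !inE => /orP[] /eqP->.
have := rsum_le1 mM vR; rewrite leq_eqVlt => /orP[/eqP//|]; rewrite ltnS leqn0 => /eqP v0.
exfalso.
have /andP[m1 m2] := mem_vs2 mM.
have [v' [v'R vv' pv]] : exists v', [/\ v' \in vs2 M, g v v' & perm_eq [:: m'.1; m'.2] [:: v; v']].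
  move: vm'; rewrite !inE => /orP[] /eqP->.
    by exists m'.2; split=> //; apply: aM.
  by exists m'.1; split=> //; [rewrite gS; apply: aM | rewrite (perm_catC [:: _] [:: _])].
have r1 : rsum m + 1 <= 2 * N.
  by apply: (@rsum_miss m [:: v]) => // w; rewrite !inE => /eqP->.
have gm w : g m'.1 w + g m'.2 w = g v w + g v' w.
  have h : \sum_(z <- [:: m'.1; m'.2]) g z w = \sum_(z <- [:: v; v']) g z w by exact: perm_big.
  by move: h; rewrite !big_cons !big_nil !addn0.
have [x0 [x0m x0R xv0]] : exists x0, [/\ x0 \in [:: m.1; m.2], x0 \in vs2 M & g m'.1 x0 + g m'.2 x0 = 0].
  move: v0 (rsum_le1 mM v'R); rewrite [g m.1 v]gS [g m.2 v]gS [g m.1 v']gS [g m.2 v']gS.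
  case h1 : (g v' m.1) => /= v0 a.
    exists m.2; rewrite !inE eqxx orbT m2 gm; split=> //.
    by move: v0 a; case: (g v m.1); case: (g v m.2); case: (g v' m.2).
  exists m.1; rewrite !inE eqxx m1 gm h1; split=> //.
  by move: v0; case: (g v m.1).
have r2 : rsum m' + 1 <= 2 * N.
  by apply: (@rsum_miss m' [:: x0]) => // w; rewrite !inE => /eqP->.
have t1 := rt_sum mM; have t2 := rt_sum m'M'.
have tight : {in L, forall t, e2 g m t + e2 g m' t = 8}.
  apply: sum_nat_tight; first by move=> t; apply: pair8.
  rewrite big_split /= sL; move: t1 t2 r1 r2; rewrite /tsum.
  move: (rsum m) (rsum m') (\sum_(i <- L) e2 g m i) (\sum_(i <- L) e2 g m' i); clear; lia.
have ts : tsum m <= 4 * j /\ 2 * N <= rsum m' + 1.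
  have : tsum m + tsum m' <= 8 * j.
    by rewrite /tsum -big_split /= -sL; apply: sum_nat_le => t tL; rewrite tight.
  move: t1 t2 r1 r2; move: (rsum m) (rsum m') (tsum m) (tsum m'); clear; lia.
have [m2' m2M] : exists m2', m2' \in rem m' (rem m M).
  have : 0 < size (rem m' (rem m M)) by rewrite !size_rem // sM; move: N3; clear; lia.
  by case: (rem m' (rem m M)) => // m2' s _; exists m2'; apply: mem_head.
have m2M1 := mem_rem m2M; have m2M2 := mem_rem m2M1.
have pR : perm_eq (vs2 M) ([:: m.1; m.2; v; v'; m2'.1; m2'.2] ++ vs2 (rem m2' (rem m' (rem m M)))).
  have q1 := vs2_rem mM; have q2 := vs2_rem m'M; have q3 := vs2_rem m2M.
  by clear - pv q1 q2 q3; perm_count.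
have uq : uniq [:: m.1; m.2; v; v'; m2'.1; m2'.2].
  by have := uniqR; rewrite (perm_uniq pR) cat_uniq => /andP[].
have /andP[w1R w2R] := mem_vs2 m2M2.
(* [m'] misses only one vertex outside the packing, and that is [x0]. *)
have one w : w \in [:: m2'.1; m2'.2] -> g v w + g v' w = 1.
  move=> wm; have wR : w \in vs2 M by move: wm; rewrite !inE => /orP[] /eqP->.
  have := rsum_le1 m'M' wR; rewrite gm leq_eqVlt => /orP[/eqP//|]; rewrite ltnS leqn0 => /eqP w0.
  have nx : x0 != w.
    move: x0m wm; rewrite !inE => /orP[] /eqP-> /orP[] /eqP->; apply/negP => /eqP e;
      by move: uq; rewrite e /= !inE eqxx ?(orbT, andbF).
  have : rsum m' + 2 <= 2 * N.
    apply: (@rsum_miss m' [:: x0; w]) => //; first by rewrite /= inE nx.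
      by move=> z; rewrite !inE => /orP[] /eqP->.
    by move=> z; rewrite !inE => /orP[] /eqP->; rewrite // gm.
  by case: ts => _; move: (rsum m'); clear; lia.
have [w1 [w2 [pw gvw1 gvw2]]] : exists w1 w2,
    [/\ perm_eq [:: m2'.1; m2'.2] [:: w1; w2], g v w1 & g v' w2].
  have o1 := one _ (mem_head _ _); have o2 := one m2'.2 ltac:(by rewrite !inE eqxx orbT).
  have o3 := rsum_le1 m2M2 vR; have o4 := rsum_le1 m2M2 v'R.
  move: o1 o2 o3 o4; rewrite [g m2'.1 v]gS [g m2'.2 v]gS [g m2'.1 v']gS [g m2'.2 v']gS.
  case h1 : (g v m2'.1); case h2 : (g v' m2'.2) => //=.
  - by move=> *; exists m2'.1, m2'.2.
  - by case h3 : (g v m2'.2) => //=.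
  - case h3 : (g v' m2'.1) => //=.
  - case h3 : (g v m2'.2); case h4 : (g v' m2'.1) => //= *.
    by exists m2'.2, m2'.1; split=> //; rewrite (perm_catC [:: _] [:: _]).
have gw : g w1 w2.
  have : {subset [:: m2'.1; m2'.2] <= [:: w1; w2]} by move=> z; rewrite (perm_mem pw).
  have nw : w1 != w2.
    have : uniq [:: w1; w2].
      by rewrite -(perm_uniq pw) /= inE andbT; apply: (rainbow_rel_neq rg); apply: aM.
    by rewrite /= inE andbT.
  have gab := aM m2M2.
  have q1 : w1 \in [:: m2'.1; m2'.2] by rewrite (perm_mem pw) mem_head.
  have q2 : w2 \in [:: m2'.1; m2'.2] by rewrite (perm_mem pw) !inE eqxx orbT.
  move: nw q1 q2; rewrite !inE => nw /orP[] /eqP e1 /orP[] /eqP e2' _; rewrite e1 e2' // ?eqxx // in nw *.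
  by rewrite gS.
have pW : perm_eq U ([:: v; w2; v'; w1] ++ (m.1 :: m.2 :: vs2 (rem m2' (rem m' (rem m M)))) ++ vs3 L).
  by clear - pU pR pw; perm_count.
have gw2v' : g w2 v' by rewrite gS. have gw21 : g w2 w1 by rewrite gS.
have [t0 t0L c0] := recolor_C4 colC UU nok rg pW aL jL vv' gvw1 gw2v' gw21.
have pW2 : perm_eq U ([:: v; w2; v'; m.1; m.2] ++ (w1 :: vs2 (rem m2' (rem m' (rem m M)))) ++ vs3 L).
  by clear - pW; perm_count.
have b0 := recolor_bad colC UU nok rg pW2 aL sL t0L c0 vv' gw2v' (aM mM).
have e0 := bad_e2 b0; rewrite -surjective_pairing in e0.
have le2 t : t \in L -> e2 g m2' t <= 4.
  move=> tL; rewrite leqNgt; apply/negP => h.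
  have x1 := pair8 mM m2M1 tL.
  have x2 : e2 g m' t + e2 g m2' t <= 8.
    apply: pair8 => //; rewrite mem_rem_uniq // !inE m2M2 andbT.
    by move: m2M; rewrite mem_rem_uniq ?rem_uniq // !inE => /andP[].
  by move: x1 x2 h (tight t tL); clear; lia.
have x2 t : t \in L -> e2 g m t + e2 g m2' t <= 8 by apply: pair8.
have x3 t : t \in L -> e2 g m' t + e2 g m2' t <= 8.
  apply: pair8 => //; rewrite mem_rem_uniq // !inE m2M2 andbT.
  by move: m2M; rewrite mem_rem_uniq ?rem_uniq // !inE => /andP[].
(* If [m] sends five edges to some [t3], then [m2'] falls short at [t3] and at [t0]; otherwise [m]
   itself falls short at [t0]. *)
have [/hasP[t3 t3L h3]|/hasPn nh] := boolP (has (fun t => 4 < e2 g m t) L).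
  have n30 : t3 != t0 by apply/negP => /eqP e; move: h3 e0; rewrite e; clear; lia.
  have p1 := perm_to_rem t0L; have t3L' : t3 \in rem t0 L by move: t3L; rewrite (perm_mem p1) inE (negbTE n30).
  have p2 := perm_to_rem t3L'.
  have := rt_sum m2M2; have := rsum_le m2M2; rewrite /tsum (perm_big _ p1) big_cons /= (perm_big _ p2) big_cons /=.
  have : \sum_(t <- rem t3 (rem t0 L)) e2 g m2' t <= 4 * size (rem t3 (rem t0 L)).
    by apply: sum_nat_le => t /mem_rem/mem_rem/le2.
  have sj : j = (size (rem t3 (rem t0 L))).+2 by rewrite -sL (perm_size p1) /= (perm_size p2).
  move: sj (x2 _ t3L) (x3 _ t0L) (tight _ t0L) h3 e0.
  move: (size _) (rsum m2') (\sum_(t <- rem t3 (rem t0 L)) e2 g m2' t); clear.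
  by move: (e2 g m t0) (e2 g m' t0) (e2 g m2' t0) (e2 g m t3) (e2 g m2' t3); lia.
have p1 := perm_to_rem t0L.
have : \sum_(t <- rem t0 L) e2 g m t <= 4 * size (rem t0 L).
  by apply: sum_nat_le => t /mem_rem/nh; rewrite -leqNgt.
have sj : j = (size (rem t0 L)).+1 by rewrite -sL (perm_size p1).
move: t1 r1; rewrite /tsum (perm_big _ p1) big_cons /= sj; move: e0.
by move: (size _) (rsum m) (\sum_(t <- rem t0 L) e2 g m t) (e2 g m t0); clear; lia.
Qed.

(** [A] collects the ends adjacent to the fixed vertex [m0.2]. Two of them have a common neighbour
    outside the packing, so they are not adjacent, and by [no_missing] each sees the partner of the
    other. *)
Lemma orient_pairs : exists A B, [/\ perm_eq U (A ++ B ++ vs3 L), size A = N, size B = N &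
  {in A & B, forall a b, g a b}].
Proof.
have [m0 m0M] : exists m0, m0 \in M.
  by move: N3; rewrite -sM; case: (M) => // m s _; exists m; apply: mem_head.
pose f (m : V * V) := if g m0.2 m.1 then m.1 else m.2.
pose k (m : V * V) := if g m0.2 m.1 then m.2 else m.1.
have fk m : perm_eq [:: m.1; m.2] [:: f m; k m].
  by rewrite /f /k; case: ifP => // _; rewrite (perm_catC [:: _] [:: _]).
have gfk m : m \in M -> g (f m) (k m).
  by move=> mM; rewrite /f /k; case: ifP => _; [|rewrite gS]; apply: aM.
have fR m : m \in M -> f m \in vs2 M.
  by move=> mM; have /andP[h1 h2] := mem_vs2 mM; rewrite /f; case: ifP.
have kR m : m \in M -> k m \in vs2 M.
  by move=> mM; have /andP[h1 h2] := mem_vs2 mM; rewrite /k; case: ifP.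
have rm m m' : m \in M -> m' \in M -> m != m' -> m' \in rem m M.
  by move=> mM m'M ne; rewrite mem_rem_uniq // !inE eq_sym ne.
have /andP[m01 m02] := mem_vs2 m0M.
have fm0 m : m \in M -> g m0.2 (f m).
  move=> mM; case: (eqVneq m m0) => [->|ne].
    have h : g m0.2 m0.1 by rewrite gS aM.
    by rewrite /f h.
  have ne' : m0 != m by rewrite eq_sym.
  have h := no_missing mM (rm _ _ mM m0M ne) (v := m0.2) ltac:(by rewrite !inE eqxx orbT).
  by move: h; rewrite /f; case: ifP => //; rewrite ![g _ m0.2]gS => ->; case: (g _ _).
exists (map f M), (map k M); split; rewrite ?size_map //.
  have p : perm_eq (vs2 M) (map f M ++ map k M).
    elim: (M) => // m s IH; rewrite vs2_cons [map f _]/= [map k _]/=.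
    by have := fk m; clear - IH; move=> fk; perm_count.
  by rewrite (perm_trans pU) // catA perm_cat2r.
move=> a b /mapP[m mM ->] /mapP[m' m'M ->].
case: (eqVneq m' m) => [->|ne]; first exact: gfk.
have e : g (f m') (f m) + g (k m') (f m) = 1.
  have h : g m'.1 (f m) + g m'.2 (f m) = 1.
    apply: (no_missing m'M (rm _ _ m'M mM ne)).
    by rewrite (perm_mem (fk m)) mem_head.
  have h' : \sum_(z <- [:: m'.1; m'.2]) g z (f m) = \sum_(z <- [:: f m'; k m']) g z (f m).
    exact: perm_big.
  by move: h'; rewrite !big_cons !big_nil !addn0 h.
have nf : ~~ g (f m') (f m).
  apply/negP => h; have := free_tri (fR _ m'M) (fR _ mM) m02 h.
  by rewrite ![g (f _) m0.2]gS !fm0.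
by move: e; rewrite (negbTE nf) add0n gS; case: (g _ _).
Qed.

Lemma perfect_bound : 0 < j /\ E2 g U <= 2 * (N * N) + 2 * (3 * N + 4 * N * j.-1) +
  (6 + 12 * j.-1 + j.-1 * (6 + 7 * j.-2)).
Proof.
have [A [B [pAB sA sB bip]]] := orient_pairs.
apply: (complete_bipartite_bound colC UU nok rg pAB aL sL bip _ sA sB N3) => a b aA bB.
have aU : a \in U by rewrite (perm_mem pAB) mem_cat aA.
have bU : b \in U by rewrite (perm_mem pAB) !mem_cat bB orbT.
by have := pd aU bU (bip _ _ aA bB); rewrite sA sB mul2n -addnn.
Qed.

End Fixed.

Lemma odd_step m0 : size U = 3 * j + 2 * N -> 2 < N ->
  (forall g x, rainbow_rel g -> m0 <= E2 g U -> x \in U -> N.-1 + 2 * j <= deg g U x) ->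
  (forall g x y, rainbow_rel g -> m0 <= E2 g U -> x \in U -> y \in U -> g x y ->
    2 * N + 4 * j <= deg g U x + deg g U y + 1) ->
  (0 < j -> 2 * (N * N) + 2 * (3 * N + 4 * N * j.-1) +
    (6 + 12 * j.-1 + j.-1 * (6 + 7 * j.-2)) < m0) ->
  forall g M Z L, rainbow_rel g -> m0 <= E2 g U -> config U g M Z L -> size L = j -> False.
Proof.
move=> sU N3 dl pd bd; apply: (perfect_odd colC UU nok sU (ltnW N3) dl).
move=> g M L rg Eg cf sL sM.
have [j0 le] := perfect_bound rg cf sM sL N3 (fun x y => pd g x y rg Eg).
by move: (leq_trans (bd j0) (leq_trans Eg le)); rewrite ltnn.
Qed.

End Odd.

(** * Three vertices outside the packing *)

Section Base.
Variables (V D : eqType) (col : V -> V -> D).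
Hypothesis colC : forall x y, col x y = col y x.
Implicit Types (R : seq V).
Local Notation rainbow_rel := (rainbow_rel col).
Variables (U : seq V) (j : nat).
Hypothesis UU : uniq U.
Hypothesis nok : ~ has_packing col U j.+1.

(** Nine for each ordered pair of triangles, but only six on the diagonal. *)
Lemma tt_sum_le (g : rel V) (L : seq (V * V * V)) : irreflexive g ->
  \sum_(t <- L) \sum_(t' <- L) tt g t t' + 3 * size L <= 9 * (size L * size L).
Proof.
move=> gI; elim: L => [|t L IH]; first by rewrite big_nil.
rewrite big_cons big_cons.
have -> : \sum_(j0 <- L) \sum_(t' <- t :: L) tt g j0 t' =
    \sum_(t' <- L) tt g t' t + \sum_(t0 <- L) \sum_(t' <- L) tt g t0 t'.
  by rewrite -big_split; apply: eq_bigr => t' _; rewrite big_cons.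
rewrite [size (t :: L)]/=.
have h1 := tt_self t gI.
have h2 : \sum_(t' <- L) tt g t t' <= 9 * size L by apply: sum_nat_le => t' _; apply: tt_le9.
have h3 : \sum_(t' <- L) tt g t' t <= 9 * size L by apply: sum_nat_le => t' _; apply: tt_le9.
move: IH h1 h2 h3; move: (\sum_(t0 <- L) \sum_(t' <- L) tt g t0 t') (tt g t t).
move: (\sum_(t' <- L) tt g t t') (\sum_(t' <- L) tt g t' t) (size L); clear; nia.
Qed.

Section Fixed.
Variable g : rel V.
Hypothesis rg : rainbow_rel g.
Hypothesis Eg : 9 * (j * j) + 9 * j + 6 <= E2 g U.
Let gS : symmetric g. Proof. by case: rg. Qed.
Let gI : irreflexive g. Proof. by case: rg. Qed.

Definition eR x y z t := et g x t + et g y t + et g z t.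

Lemma E2_base x y z L : perm_eq U ([:: x; y; z] ++ vs3 L) ->
  E2 g U = 2 * (g x y + g x z + g y z) + 2 * (\sum_(t <- L) eR x y z t) +
    \sum_(t <- L) \sum_(t' <- L) tt g t t'.
Proof.
move=> p; rewrite (E2_split gS p); congr (_ + 2 * _ + _).
  rewrite !big_cons !big_nil !gI [g y x]gS [g z x]gS [g z y]gS.
  move: (g x y) (g x z) (g y z); clear; lia.
by apply: eq_bigr => t _; rewrite !big_cons big_nil /eR addn0 addnA.
Qed.

(** Six edges to each triangle, two among [x], [y], [z] and a complete packing give [E2] at most
    [9 * j ^ 2 + 9 * j + 4]. *)
Lemma many_edges x y z L : perm_eq U ([:: x; y; z] ++ vs3 L) -> size L = j ->
  all (tri g) L -> exists2 t, t \in L & 6 < eR x y z t.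
Proof.
move=> p sL aL; apply/hasP; apply: contraT => /hasPn nh.
have h1 : \sum_(t <- L) eR x y z t <= 6 * size L.
  by apply: sum_nat_le => t /nh; rewrite -leqNgt.
have h2 := tt_sum_le L gI; move: Eg; rewrite (E2_base p).
have h3 : ~~ [&& g x y, g x z & g y z].
  have := @no_repl _ _ _ U j.+1 x g [:: x; y; z] [:: (0, 1, 2)] [::] L nok UU p rg aL isT.
  by rewrite /= sL leqnn /tri /= andbT => ->.
have h4 : g x y + g x z + g y z <= 2 by move: h3; do 3 case: (g _ _).
move: h1 h2 h4; rewrite sL.
move: (\sum_(t <- L) eR x y z t) (\sum_(t <- L) \sum_(t' <- L) tt g t t').
move: (g x y + g x z + g y z); clear; nia.
Qed.

(** Seven edges to one triangle allow vertices to be exchanged with it so that one of the three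
    outside vertices sees the other two. *)
Lemma exists_cherry x y z L (P : Prop) : perm_eq U ([:: x; y; z] ++ vs3 L) -> size L = j -> all (tri g) L ->
  (forall x' y' z' L', perm_eq U ([:: x'; y'; z'] ++ vs3 L') -> size L' = j -> all (tri g) L' ->
    g z' x' && g z' y' -> P) -> P.
Proof.
move=> pU sL aL; have [t tL et7] := many_edges pU sL aL.
have p3 := vs3_rem tL.
have tt : tri g t by apply: (allP aL).
have aL' : all (tri g) (rem t L) by apply/allP => v /mem_rem; apply: (allP aL).
have sL' : (size (rem t L)).+1 = j by rewrite size_rem // -sL prednK //; case: (L) tL.
case: t tL et7 p3 tt aL' sL' => [[p q] r] tL et7 p3 /and3P[/= gpq gpr gqr] aL' sL' C.
have F a b c d e f : perm_eq [:: x; y; z; p; q; r] [:: a; b; c; d; e; f] ->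
    tri g (d, e, f) -> g a b && g a c -> P.
  move=> pm td abc; apply: (C b c a ((d, e, f) :: rem (p, q, r) L)) => //=; last by rewrite td.
  by rewrite vs3_cons; perm_count.
have := F p x y z q r ltac:(by clear; perm_count); have := F q x y z p r ltac:(by clear; perm_count).
have := F r x y z p q ltac:(by clear; perm_count); have := F x z p y q r ltac:(by clear; perm_count).
have := F p y z x q r ltac:(by clear; perm_count); have := F q x z y p r ltac:(by clear; perm_count).
have := F r x z y p q ltac:(by clear; perm_count); have := F q y z x p r ltac:(by clear; perm_count).
move: et7; rewrite /eR /et /tri /= gpq gpr gqr ![g p _]gS ![g q _]gS ![g r _]gS; clear.
case: (g x p); case: (g x q); case: (g x r); case: (g y p); case: (g y q); case: (g y r) => //=;
by case: (g z p); case: (g z q); case: (g z r); case: (g x y); case: (g x z); case: (g y z) => //=; auto.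
Qed.

(* The only way [x], [y], [z] and [t] can miss two disjoint triangles. *)
Definition near_full x y z (t : V * V * V) v a b :=
  [/\ perm_eq (verts t) [:: v; a; b], [&& g x a, g x b, g y a & g y b] & [&& g z v, g z a & g z b]].

Lemma near_full_exists x y z t L : perm_eq U ([:: x; y; z] ++ verts t ++ vs3 L) ->
  (size L).+1 = j -> all (tri g) L -> tri g t -> g z x && g z y -> 6 < eR x y z t ->
  eR x y z t = 7 /\ exists v a b, near_full x y z t v a b.
Proof.
case: t => [[p q] r] pU sL aL /and3P[/= gpq gpr gqr] /andP[gzx gzy].
have pU' : perm_eq U ([:: x; y; z; p; q; r] ++ [::] ++ vs3 L) by [].
have F I := @no_repl _ _ _ U j.+1 x g _ I [::] L nok UU pU' rg aL.
have sL' : j.+1 <= 2 + size L by rewrite -sL.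
have := F [:: (0, 2, 3); (1, 4, 5)] isT sL'; have := F [:: (0, 2, 4); (1, 3, 5)] isT sL'.
have := F [:: (0, 2, 5); (1, 3, 4)] isT sL'; have := F [:: (1, 2, 3); (0, 4, 5)] isT sL'.
have := F [:: (1, 2, 4); (0, 3, 5)] isT sL'; have := F [:: (1, 2, 5); (0, 3, 4)] isT sL'.
have DD v a b : perm_eq (verts (p, q, r)) [:: v; a; b] ->
   [&& g x a, g x b, g y a & g y b] -> [&& g z v, g z a & g z b] ->
   exists v a b, near_full x y z (p, q, r) v a b by move=> *; exists v, a, b; split.
have := DD p q r ltac:(by clear; rewrite /verts /=; perm_count).
have := DD q p r ltac:(by clear; rewrite /verts /=; perm_count).
have := DD r p q ltac:(by clear; rewrite /verts /=; perm_count).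
rewrite /eR /et /tri /= gpq gpr gqr [g x z]gS gzx [g y z]gS gzy !andbT /=; clear.
case: (g x p); case: (g x q); case: (g x r); case: (g y p); case: (g y q); case: (g y r) => //=;
by case: (g z p); case: (g z q); case: (g z r) => //= *; auto.
Qed.

(** Inserting [x y] closes [x y z]. A triangle receiving seven edges gives a contradiction unless
    the lost edge is in another triangle [T]. Then [T] receives at most six, and every triangle
    receiving seven misses an edge to [T]; these shortages put [E2] two below the hypothesis. *)
Lemma base_cherry x y z L : perm_eq U ([:: x; y; z] ++ vs3 L) -> size L = j -> all (tri g) L ->
  g z x && g z y -> False.
Proof.
move=> pU sL aL gz; have /andP[gzx gzy] := gz.
have [xU yU] : x \in U /\ y \in U by rewrite !(perm_mem pU) !inE !eqxx !orbT.
have u3 : uniq [:: x; y; z] by have := UU; rewrite (perm_uniq pU) cat_uniq => /andP[].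
have xy : x != y by move: u3; rewrite /= !inE negb_or => /andP[/andP[]].
have [g' [rg' _ gxy k]] := ar_swap colC UU rg xU yU xy.
have k' : keeps col g g' (col x y) by [].
have pt t : t \in L -> perm_eq U ([:: x; y; z] ++ verts t ++ vs3 (rem t L)).
  by move=> tL; have p3 := vs3_rem tL; rewrite /verts; perm_count.
have st t : t \in L -> (size (rem t L)).+1 = j.
  by move=> tL; rewrite size_rem // -sL prednK //; case: (L) tL.
have at' t : t \in L -> all (tri g) (rem t L).
  by move=> tL; apply/allP => v /mem_rem; apply: (allP aL).
have NF t : t \in L -> 6 < eR x y z t -> eR x y z t = 7 /\ exists v a b, near_full x y z t v a b.
  by move=> tL; apply: near_full_exists (pt _ tL) (st _ tL) (at' _ tL) (allP aL _ tL) gz.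
(* Of the choices [x y z] with [v a b], [x y a] with [v z b] and [x y b] with [v z a], one avoids
   the lost edge, since no edge of [g] is in all three. *)
have opt t : t \in L -> 6 < eR x y z t -> ~~ has (fun s => colT col s (col x y)) (rem t L) -> False.
  move=> tL h7 nc; have [_ [v [a [b [pv /and4P[xa xb ya yb] /and3P[zv za zb]]]]]] := NF _ tL h7.
  have aL' := keepL k' (at' _ tL) nc.
  have [gva gvb gab] := tri_adj rg (allP aL _ tL) pv.
  have pW : perm_eq U ([:: x; y; z; v; a; b] ++ [::] ++ vs3 (rem t L)).
    by have := pt _ tL; move: pv; rewrite /verts; clear => pv pq; perm_count.
  have uq : uniq [:: x; y; z; v; a; b].
    by have := UU; rewrite (perm_uniq pW) cat_uniq => /andP[].
  have sL' : j.+1 <= 2 + size (rem t L) by rewrite -(st _ tL).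
  have F I := @no_repl _ _ _ U j.+1 x g' _ I [::] _ nok UU pW rg' aL'.
  have F1 := F [:: (0, 1, 2); (3, 4, 5)] isT sL'.
  have F2 := F [:: (0, 1, 4); (3, 2, 5)] isT sL'.
  have F3 := F [:: (0, 1, 5); (3, 2, 4)] isT sL'.
  have gvz : g v z by rewrite gS. have gxz : g x z by rewrite gS. have gyz : g y z by rewrite gS.
  have K s w : g s w -> ~~ g' s w -> forall c d, g c d -> ~~ same_edge c d s w -> g' c d.
    move=> gsw ng c d gcd; apply: (keep_same rg gsw) => //.
    have <- : col x y = col s w; last by [].
    by apply/eqP; rewrite eq_sym; apply: contraNT ng; apply: k.
  move: F1; rewrite /= /tri /= gxy !andbT !negb_and -!orbA /=.
  case/or4P => [e|e|e|/orP[e|e]].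
  - have kk := K _ _ gxz e; move: F2; rewrite /= /tri /= gxy !kk //; by same_absurd uq.
  - have kk := K _ _ gyz e; move: F2; rewrite /= /tri /= gxy !kk //; by same_absurd uq.
  - have kk := K _ _ gva e; move: F2; rewrite /= /tri /= gxy !kk //; by same_absurd uq.
  - have kk := K _ _ gvb e; move: F3; rewrite /= /tri /= gxy !kk //; by same_absurd uq.
  - have kk := K _ _ gab e; move: F2; rewrite /= /tri /= gxy !kk //; by same_absurd uq.
have [|nc] := boolP (has (fun s => colT col s (col x y)) L); last first.
  have [t tL h7] := many_edges pU sL aL; apply: (opt t tL h7).
  by apply: contra nc => /hasP[s /mem_rem sin c]; apply/hasP; exists s.
case/hasP => T TL cT; have [s [s' [o [pT css]]]] := colTP cT.
have [gss gso gs'o] := tri_adj rg (allP aL _ TL) pT.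
have sn : s \notin vs3 (rem T L).
  have := UU; rewrite (perm_uniq (pt _ TL)) !cat_uniq => /and3P[_ _ /and3P[_ /hasPn h _]].
  by apply/negP => /h; rewrite (perm_mem pT) mem_head.
have kss : keeps col g g' (col s s') by rewrite css.
have kk := keep_same rg gss kss.
have eT : eR x y z T <= 6.
  rewrite leqNgt; apply/negP => h7; apply: (opt T TL h7).
  apply/hasPn => t tL; apply/negP => /colTP[e [f [i [pe cef]]]].
  have [gef _ _] := tri_adj rg (allP (at' _ TL) _ tL) pe.
  have [_ _ gR] := rg; have := gR _ _ _ _ gef gss; rewrite cef css => /(_ erefl).
  have /and3P[m1 m2 m3] := mem_vs3 tL.
  have mv w : w \in [:: e; f; i] -> w \in vs3 (rem T L).
    by rewrite -(perm_mem pe) /verts !inE => /or3P[] /eqP->.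
  have em := mv e ltac:(by rewrite mem_head). have fm := mv f ltac:(by rewrite !inE eqxx orbT).
  by move=> /orP[] /andP[/eqP e1 /eqP e2']; move: sn; rewrite -?e1 -?e2' ?em ?fm.
(* Seven edges together with all nine to [T] would give [x y z], [s a v] and [s' b o], which avoid
   the lost edge [s s']. *)
have bd t : t \in rem T L -> eR x y z t + tt g t T <= 15.
  move=> tT; have tL := mem_rem tT.
  case: (ltnP 6 (eR x y z t)) => [h7|le]; last exact: leq_add le (tt_le9 _ _ _).
  have [-> [v [a [b [pv /and4P[xa xb ya yb] /and3P[zv za zb]]]]]] := NF _ tL h7.
  rewrite (_ : 15 = 7 + 8) // leq_add2l (tt_perm g pv pT) leqNgt; apply/negP => h9.
  have [gva gvb gab] := tri_adj rg (allP aL _ tL) pv.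
  have p3 := vs3_rem TL; have p4 := vs3_rem tT.
  have pW : perm_eq U ([:: x; y; z; v; a; b; s; s'; o] ++ [::] ++ vs3 (rem t (rem T L))).
    by move: pv pT; rewrite /verts; clear - pU p3 p4 => pv pT; perm_count.
  have uq : uniq [:: x; y; z; v; a; b; s; s'; o].
    by have := UU; rewrite (perm_uniq pW) cat_uniq => /andP[].
  have aL' : all (tri g') (rem t (rem T L)).
    apply: (keepL_edge rg gss kss); last by apply/allP => w /mem_rem/mem_rem; apply: (allP aL).
    have := UU; rewrite (perm_uniq pW) cat_uniq => /and3P[_ /hasPn h _].
    by apply/negP => /h; rewrite !inE eqxx !orbT.
  have sL' : j.+1 <= 3 + size (rem t (rem T L)).
    by rewrite size_rem // -(st _ TL); move: tT; case: (rem T L) => //= *; lia.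
  have := @no_repl _ _ _ U j.+1 x g' _ [:: (0, 1, 2); (6, 4, 3); (7, 5, 8)] [::] _ nok UU pW rg' aL' isT sL'.
  have [gsa gsv gs'b gbo] : [/\ g s a, g s v, g s' b & g b o].
    rewrite [g s a]gS [g s v]gS [g s' b]gS; move: h9; clear; do 9 case: (g _ _) => //=.
  have gxz : g x z by rewrite gS. have gyz : g y z by rewrite gS. have gav : g a v by rewrite gS.
  by rewrite /= /tri /= gxy !kk //; same_absurd uq.
have pL := perm_to_rem TL.
have sj := st _ TL.
move: Eg; rewrite (E2_base pU) (perm_big _ pL) big_cons /=.
have -> : \sum_(t <- L) \sum_(t' <- L) tt g t t' =
   tt g T T + 2 * (\sum_(t <- rem T L) tt g t T) + \sum_(t <- rem T L) \sum_(t' <- rem T L) tt g t t'.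
  rewrite (perm_big _ pL) big_cons /= (perm_big _ pL) big_cons /=.
  have -> : \sum_(t <- rem T L) \sum_(t' <- L) tt g t t' =
     \sum_(t <- rem T L) tt g t T + \sum_(t <- rem T L) \sum_(t' <- rem T L) tt g t t'.
    by rewrite -big_split; apply: eq_bigr => t _; rewrite (perm_big _ pL) big_cons.
  rewrite (_ : \sum_(j0 <- rem T L) tt g T j0 = \sum_(t <- rem T L) tt g t T); last first.
    apply: eq_bigr => t _; rewrite /tt /et ![g _ T.1.1]gS ![g _ T.1.2]gS ![g _ T.2]gS.
    by clear; do 9 move: (g _ _) => ?; lia.
  by rewrite mul2n -addnn !addnA.
have h1 := tt_self T gI; have h2 := tt_sum_le (rem T L) gI.
have h3 : \sum_(t <- rem T L) (eR x y z t + tt g t T) <= 15 * size (rem T L) by apply: sum_nat_le.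
rewrite big_split /= in h3.
have h4 : g x y + g x z + g y z <= 2.
  have h3' : ~~ [&& g x y, g x z & g y z].
    have := @no_repl _ _ _ U j.+1 x g [:: x; y; z] [:: (0, 1, 2)] [::] L nok UU pU rg aL isT.
    by rewrite /= sL leqnn /tri /= andbT => ->.
  by move: h3'; do 3 case: (g _ _).
move: h1 h2 h3 h4 eT sj; move: (size (rem T L)) (eR x y z T) (tt g T T) (g x y + g x z + g y z).
move: (\sum_(t <- rem T L) tt g t T) (\sum_(t <- rem T L) eR x y z t).
move: (\sum_(t <- rem T L) \sum_(t' <- rem T L) tt g t t'); clear; nia.
Qed.

Lemma base_step x y z L : perm_eq U ([:: x; y; z] ++ vs3 L) -> size L = j -> all (tri g) L -> False.
Proof. by move=> pU sL aL; apply: (exists_cherry pU sL aL) => *; apply: base_cherry; eassumption. Qed.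

End Fixed.
End Base.

(** * Two pairs outside the packing *)

Section TwoPairs.
Variables (V D : eqType) (col : V -> V -> D).
Hypothesis colC : forall x y, col x y = col y x.
Implicit Types (R : seq V).
Local Notation rainbow_rel := (rainbow_rel col).
Variables (U : seq V) (j : nat).
Hypothesis UU : uniq U.
Hypothesis nok : ~ has_packing col U j.+1.
Variable g : rel V.
Hypothesis rg : rainbow_rel g.
Let gS : symmetric g. Proof. by case: rg. Qed.
Let gI : irreflexive g. Proof. by case: rg. Qed.

(** Four edges on four vertices without a triangle form a 4-cycle, and inserting a diagonal leaves
    one of its two triangles. *)
Lemma two_pairs_j0 x y x' y' : perm_eq U [:: x; y; x'; y'] -> j = 0 ->
  g x y -> g x' y' -> 8 <= E2 g U -> False.
Proof.
move=> pU j0 gxy gxy'.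
have F I := @no_repl _ _ _ U j.+1 x g [:: x; y; x'; y'] I [::] [::] nok UU pU rg isT.
have := F [:: (0, 1, 2)] isT; have := F [:: (0, 1, 3)] isT; have := F [:: (0, 2, 3)] isT.
have := F [:: (1, 2, 3)] isT; rewrite j0 /= /tri /= gxy gxy' !andbT.
move=> /(_ isT) f1 /(_ isT) f2 /(_ isT) f3 /(_ isT) f4.
have jL : j <= size ([::] : seq (V * V * V)) by rewrite j0.
have C4 u u' w w' : perm_eq [:: x; y; x'; y'] [:: u; u'; w; w'] ->
    g u w -> g u w' -> g u' w -> g u' w' -> False.
  move=> p h1 h2 h3 h4.
  have pW : perm_eq U ([:: u; u'; w; w'] ++ [::] ++ vs3 [::]) by rewrite (perm_trans pU).
  by have [t] := recolor_C4 colC UU nok rg pW isT jL h1 h2 h3 h4.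
rewrite (E2_perm _ pU) /E2 /deg !big_cons !big_nil !gI [g y x]gS [g y' x']gS gxy gxy'.
rewrite [g x' x]gS [g x' y]gS [g y' x]gS [g y' y]gS.
have := C4 x y' y x' ltac:(by clear; perm_count); have := C4 x x' y y' ltac:(by clear; perm_count).
rewrite gxy gxy' [g y' y]gS [g y' x']gS [g x' y]gS gxy'; move: f1 f2 f3 f4; clear.
case: (g x x'); case: (g x y'); case: (g y x'); case: (g y y') => //= *; by auto.
Qed.

Section Two.
Variables (x y x' y' : V) (t1 t2 : V * V * V) (L : seq (V * V * V)).
Hypothesis pU : perm_eq U ([:: x; y; x'; y'] ++ verts t1 ++ verts t2 ++ vs3 L).
Hypothesis aL : all (tri g) (t1 :: t2 :: L).
Hypothesis sL : (size L).+2 = j.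
Hypotheses (gxy : g x y) (gxy' : g x' y').

Let T1 : tri g t1. Proof. by have /and3P[] := aL. Qed.
Let T2 : tri g t2. Proof. by have /and3P[] := aL. Qed.
Let aL0 : all (tri g) L. Proof. by have /and3P[] := aL. Qed.

(** After [x y p] and [x' y' u], at most one of the four pairs between the remaining sides [q r] and
    [v w] is missing, which leaves a third triangle. *)
Lemma no_cross : 8 <= tt g t1 t2 -> ~~ bad g x y t1 -> ~~ bad g x' y' t2 -> False.
Proof.
rewrite /bad !negbK => h8 /hasP[p pt /andP[xp yp]] /hasP[u ut /andP[xu yu]].
have ex (t : V * V * V) v : v \in verts t -> exists a b, perm_eq (verts t) [:: v; a; b].
  rewrite !inE => /or3P[] /eqP->.
  - by exists t.1.2, t.2.
  - by exists t.1.1, t.2; rewrite /verts; clear; perm_count.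
  - by exists t.1.1, t.1.2; rewrite /verts; clear; perm_count.
have [q [r p1]] := ex _ _ pt; have [v [w p2]] := ex _ _ ut.
have [gpq gpr gqr] := tri_adj rg T1 p1; have [guv guw gvw] := tri_adj rg T2 p2.
have pW : perm_eq U ([:: x; y; x'; y'; p; q; r; u; v; w] ++ [::] ++ vs3 L).
  by move: pU p1 p2; rewrite /verts; clear => pV p1 p2; perm_count.
have sL' : j.+1 <= 3 + size L by rewrite -sL.
have F I := @no_repl _ _ _ U j.+1 x g _ I [::] _ nok UU pW rg aL0.
have := F [:: (0, 1, 4); (2, 3, 7); (5, 6, 8)] isT sL'.
have := F [:: (0, 1, 4); (2, 3, 7); (5, 6, 9)] isT sL'.
have := F [:: (0, 1, 4); (2, 3, 7); (5, 8, 9)] isT sL'.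
have := F [:: (0, 1, 4); (2, 3, 7); (6, 8, 9)] isT sL'.
move: h8; rewrite (tt_perm g p1 p2) /= /tri /= gxy gxy' xp yp xu yu gqr gvw !andbT /=; clear.
have b0 (b : bool) : b <= 1 by case: b.
have := b0 (g p u); have := b0 (g p v); have := b0 (g p w); have := b0 (g q u); have := b0 (g r u).
move: (nat_of_bool (g p u)) (nat_of_bool (g p v)) (nat_of_bool (g p w)) (nat_of_bool (g q u)) (nat_of_bool (g r u)).
move=> n1 n2 n3 n4 n5 l1 l2 l3 l4 l5 h8.
have : 3 <= (g q v + g q w) + (g r v + g r w).
  move: h8 l1 l2 l3 l4 l5; move: (nat_of_bool (g q v)) (nat_of_bool (g q w)).
  by move: (nat_of_bool (g r v)) (nat_of_bool (g r w)); clear; lia.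
by case: (g q v); case: (g q w); case: (g r v); case: (g r w).
Qed.

(* [p] completes the pair [x y]; among five mutually adjacent vertices, two go with [z]. *)
Lemma five_clique z z' p s1 s2 s3 s4 s5 : perm_eq [:: x'; y'] [:: z; z'] ->
  perm_eq (verts t1 ++ verts t2) [:: p; s1; s2; s3; s4; s5] ->
  g x p && g y p ->
  [&& g s1 s2, g s1 s3, g s1 s4 & g s1 s5] -> [&& g s2 s3, g s2 s4 & g s2 s5] ->
  [&& g s3 s4, g s3 s5 & g s4 s5] ->
  2 <= g z s1 + g z s2 + g z s3 + g z s4 + g z s5 -> False.
Proof.
move=> pz pY /andP[xp yp] /and4P[h12 h13 h14 h15] /and3P[h23 h24 h25] /and3P[h34 h35 h45].
have pW : perm_eq U ([:: x; y; z; p; s1; s2; s3; s4; s5] ++ [:: z'] ++ vs3 L).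
  by move: pU pY pz; rewrite /verts; clear => pV pY pz; perm_count.
have sL' : j.+1 <= 3 + size L by rewrite -sL.
have F I := @no_repl _ _ _ U j.+1 x g _ I _ _ nok UU pW rg aL0.
have := F [:: (0, 1, 3); (2, 4, 5); (6, 7, 8)] isT sL'.
have := F [:: (0, 1, 3); (2, 4, 6); (5, 7, 8)] isT sL'.
have := F [:: (0, 1, 3); (2, 4, 7); (5, 6, 8)] isT sL'.
have := F [:: (0, 1, 3); (2, 4, 8); (5, 6, 7)] isT sL'.
have := F [:: (0, 1, 3); (2, 5, 6); (4, 7, 8)] isT sL'.
have := F [:: (0, 1, 3); (2, 5, 7); (4, 6, 8)] isT sL'.
have := F [:: (0, 1, 3); (2, 5, 8); (4, 6, 7)] isT sL'.
have := F [:: (0, 1, 3); (2, 6, 7); (4, 5, 8)] isT sL'.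
have := F [:: (0, 1, 3); (2, 6, 8); (4, 5, 7)] isT sL'.
have := F [:: (0, 1, 3); (2, 7, 8); (4, 5, 6)] isT sL'.
rewrite /= /tri /= gxy xp yp h12 h13 h14 h15 h23 h24 h25 h34 h35 h45 !andbT /=; clear.
by case: (g z s1); case: (g z s2); case: (g z s3); case: (g z s4); case: (g z s5).
Qed.

(** Only [u w] may be missing between the triangles. The pair [z u] takes a neighbour among [a],
    [b], [c], [d], the edge [x y] takes its twin in the same triangle, and the other three vertices
    form a triangle. *)
Lemma one_missing z z' u a b w c d : perm_eq [:: x'; y'] [:: z; z'] ->
  perm_eq (verts t1) [:: u; a; b] -> perm_eq (verts t2) [:: w; c; d] ->
  [&& g a w, g a c, g a d, g b w, g b c & g b d] -> g u c -> g u d ->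
  [&& g x a && g y a, g x b && g y b, g x c && g y c & g x d && g y d] ->
  g z u -> g z a || g z b || g z c || g z d -> False.
Proof.
move=> pz p1 p2 /and5P[aw ac ad bw /andP[bc bd]] uc ud.
move=> /and4P[/andP[xa ya] /andP[xb yb] /andP[xc yc] /andP[xd yd]] zu.
have [gua gub gab] := tri_adj rg T1 p1; have [gwc gwd gcd] := tri_adj rg T2 p2.
have pW : perm_eq U ([:: x; y; z; u; a; b; w; c; d] ++ [:: z'] ++ vs3 L).
  by move: pU p1 p2 pz; rewrite /verts; clear => pV p1 p2 pz; perm_count.
have sL' : j.+1 <= 3 + size L by rewrite -sL.
have F I := @no_repl _ _ _ U j.+1 x g _ I _ _ nok UU pW rg aL0.
have := F [:: (0, 1, 5); (2, 3, 4); (6, 7, 8)] isT sL'.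
have := F [:: (0, 1, 4); (2, 3, 5); (6, 7, 8)] isT sL'.
have := F [:: (0, 1, 8); (2, 3, 7); (4, 5, 6)] isT sL'.
have := F [:: (0, 1, 7); (2, 3, 8); (4, 5, 6)] isT sL'.
rewrite /= /tri /= gxy gua gub gab gwc gwd gcd aw bw uc ud xa ya xb yb xc yc xd yd zu !andbT /=; clear.
by case: (g z a); case: (g z b); case: (g z c); case: (g z d).
Qed.

(** The count leaves at most one pair [u w] missing between the triangles. Removing a common
    neighbour of [x] and [y] leaves a clique on five vertices, of which [x'] sees two, unless a pair
    is missing and neither of its ends is a common neighbour; then [one_missing] applies. *)
Lemma two_pairs_final : {in [:: x'; y'], forall z, et g z t1 + et g z t2 = 3} ->
  bad g x' y' t1 -> e2 g (x', y') t1 = 3 -> ~~ bad g x y t1 ->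
  e2 g (x, y) t1 <= 5 -> e2 g (x, y) t2 <= 5 ->
  18 <= e2 g (x, y) t1 + e2 g (x, y) t2 + tt g t1 t2 -> False.
Proof.
move=> hz b1 e1 nb l1 l2 cnt.
have split8 : tt g t1 t2 = 9 \/ exists u a b w c d,
    [/\ perm_eq (verts t1) [:: u; a; b], perm_eq (verts t2) [:: w; c; d],
     [&& g a w, g a c, g a d, g b w, g b c & g b d], g u c && g u d &
     e2 g (x, y) t1 = 5 /\ e2 g (x, y) t2 = 5].
  case: (ltnP (tt g t1 t2) 9) => [lt9|ge9]; last first.
    by left; apply/eqP; rewrite eqn_leq ge9 tt_le9.
  right; have [t8 e5 e5'] : [/\ tt g t1 t2 = 8, e2 g (x, y) t1 = 5 & e2 g (x, y) t2 = 5].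
    move: cnt l1 l2 lt9; move: (e2 g (x, y) t1) (e2 g (x, y) t2) (tt g t1 t2).
    by clear => n1 n2 n3 *; split; lia.
  have DD u a b w c d : perm_eq (verts t1) [:: u; a; b] -> perm_eq (verts t2) [:: w; c; d] ->
    [&& g a w, g a c, g a d, g b w, g b c & g b d] -> g u c && g u d ->
    exists u a b w c d, [/\ perm_eq (verts t1) [:: u; a; b], perm_eq (verts t2) [:: w; c; d],
     [&& g a w, g a c, g a d, g b w, g b c & g b d], g u c && g u d &
     e2 g (x, y) t1 = 5 /\ e2 g (x, y) t2 = 5].
    by move=> *; exists u, a, b, w, c, d.
  have R1 (t : V * V * V) : perm_eq (verts t) [:: t.1.1; t.1.2; t.2] by [].
  have R2 (t : V * V * V) : perm_eq (verts t) [:: t.1.2; t.1.1; t.2].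
    by rewrite /verts; clear; perm_count.
  have R3 (t : V * V * V) : perm_eq (verts t) [:: t.2; t.1.1; t.1.2].
    by rewrite /verts; clear; perm_count.
  have := DD _ _ _ _ _ _ (R1 t1) (R1 t2); have := DD _ _ _ _ _ _ (R1 t1) (R2 t2).
  have := DD _ _ _ _ _ _ (R1 t1) (R3 t2); have := DD _ _ _ _ _ _ (R2 t1) (R1 t2).
  have := DD _ _ _ _ _ _ (R2 t1) (R2 t2); have := DD _ _ _ _ _ _ (R2 t1) (R3 t2).
  have := DD _ _ _ _ _ _ (R3 t1) (R1 t2); have := DD _ _ _ _ _ _ (R3 t1) (R2 t2).
  have := DD _ _ _ _ _ _ (R3 t1) (R3 t2).
  move: t8; rewrite /tt /et.
  move: (exists u a b w c d, _) => P; clear.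
  by case: (g t1.1.1 t2.1.1); case: (g t1.1.1 t2.1.2); case: (g t1.1.1 t2.2);
    case: (g t1.1.2 t2.1.1); case: (g t1.1.2 t2.1.2); case: (g t1.1.2 t2.2);
    case: (g t1.2 t2.1.1); case: (g t1.2 t2.1.2); case: (g t1.2 t2.2) => //= _ *; auto.
have z5 p s1 s2 s3 s4 s5 z : z \in [:: x'; y'] -> perm_eq (verts t1 ++ verts t2) [:: p; s1; s2; s3; s4; s5] ->
    2 <= g z s1 + g z s2 + g z s3 + g z s4 + g z s5.
  move=> zin pY; have := hz z zin.
  have : \sum_(v <- verts t1 ++ verts t2) g z v = \sum_(v <- [:: p; s1; s2; s3; s4; s5]) g z v by exact: perm_big.
  rewrite /verts !big_cons !big_nil /et; have : g z p <= 1 by case: (g z p).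
  do 12 move: (nat_of_bool (g z _)) => ?; clear; lia.
case: split8 => [t9|[u [a [b [w [c [d [p1 p2 /and5P[aw ac ad bw /andP[bc bd]] /andP[uc ud] [e5 e5']]]]]]]]].
  move: nb; rewrite /bad negbK => /hasP[p pt xyp].
  have [q [r p1]] : exists a b, perm_eq (verts t1) [:: p; a; b].
    move: pt; rewrite !inE => /or3P[] /eqP->.
    - by exists t1.1.2, t1.2.
    - by exists t1.1.1, t1.2; rewrite /verts; clear; perm_count.
    - by exists t1.1.1, t1.1.2; rewrite /verts; clear; perm_count.
  have p2 : perm_eq (verts t2) [:: t2.1.1; t2.1.2; t2.2] by [].
  have [gpq gpr gqr] := tri_adj rg T1 p1; have [guv guw gvw] := tri_adj rg T2 p2.
  have pY : perm_eq (verts t1 ++ verts t2) [:: p; q; r; t2.1.1; t2.1.2; t2.2].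
    by move: p1; rewrite /verts; clear => p1; perm_count.
  have := z5 _ _ _ _ _ _ x' ltac:(by rewrite mem_head) pY.
  move: t9; rewrite (tt_perm g p1 p2) => t9.
  have [h1 h2] : [&& g q t2.1.1, g q t2.1.2 & g q t2.2] /\ [&& g r t2.1.1, g r t2.1.2 & g r t2.2].
    by move: t9; clear; do 9 case: (g _ _).
  move: h1 h2 => /and3P[h1 h2 h3] /and3P[h4 h5 h6].
  by apply: (five_clique (perm_refl _) pY xyp); rewrite ?gqr ?h1 ?h2 ?h3 ?h4 ?h5 ?h6 ?guv ?guw ?gvw.
have [gua gub gab] := tri_adj rg T1 p1; have [gwc gwd gcd] := tri_adj rg T2 p2.
have [xyu|nu] := boolP (g x u && g y u).
  have pY : perm_eq (verts t1 ++ verts t2) [:: u; a; b; w; c; d].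
    by move: p1 p2; rewrite /verts; clear => p1 p2; perm_count.
  have := z5 _ _ _ _ _ _ x' ltac:(by rewrite mem_head) pY.
  by apply: (five_clique (perm_refl _) pY xyu); rewrite ?gab ?aw ?ac ?ad ?bw ?bc ?bd ?gwc ?gwd ?gcd.
have [xyw|nw] := boolP (g x w && g y w).
  have pY : perm_eq (verts t1 ++ verts t2) [:: w; u; a; b; c; d].
    by move: p1 p2; rewrite /verts; clear => p1 p2; perm_count.
  have := z5 _ _ _ _ _ _ x' ltac:(by rewrite mem_head) pY.
  by apply: (five_clique (perm_refl _) pY xyw); rewrite ?gua ?gub ?uc ?ud ?gab ?ac ?ad ?bc ?bd ?gcd.
have C4 : [&& g x a && g y a, g x b && g y b, g x c && g y c & g x d && g y d].
  move: e5 e5' nu nw; rewrite /e2 /= !(et_perm g _ p1) !(et_perm g _ p2); clear.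
  case: (g x u); case: (g y u); case: (g x a); case: (g y a); case: (g x b); case: (g y b) => //=;
  by case: (g x w); case: (g y w); case: (g x c); case: (g y c); case: (g x d); case: (g y d).
have A6 : [&& g a w, g a c, g a d, g b w, g b c & g b d] by rewrite aw ac ad bw bc bd.
have some z : z \in [:: x'; y'] -> g z a || g z b || g z c || g z d.
  move=> zin; have := hz z zin; rewrite (et_perm g _ p1) (et_perm g _ p2); clear.
  by case: (g z u); case: (g z w); case: (g z a); case: (g z b); case: (g z c); case: (g z d).
have : g x' u || g y' u.
  have : u \in verts t1 by rewrite (perm_mem p1) mem_head.
  move: b1 e1; rewrite badE /e2 /et /= !inE; clear.
  by move=> h1 h2 /or3P[] /eqP->; move: h1 h2; do 6 case: (g _ _).
case/orP => zu.
  by apply: (one_missing (perm_refl _) p1 p2 A6 uc ud C4 zu); apply: some; rewrite mem_head.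
apply: (one_missing (z' := x') _ p1 p2 A6 uc ud C4 zu); last by apply: some; rewrite !inE eqxx orbT.
by clear; perm_count.
Qed.

End Two.

(** With all other blocks at their maximum, these three quantities must reach 24, and they cannot
    exceed 8 + 8 + 9: one unit of slack. *)
Lemma two_pairs_count m m' L t1 t2 L2 : config U g [:: m; m'] [::] L -> size L = j ->
  perm_eq L [:: t1, t2 & L2] -> 9 * (j * j) + 13 * j + 6 <= E2 g U ->
  [/\ 24 <= (e2 g m t1 + e2 g m' t1) + (e2 g m t2 + e2 g m' t2) + tt g t1 t2,
      e2 g m t1 + e2 g m' t1 <= 8 & e2 g m t2 + e2 g m' t2 <= 8].
Proof.
move=> cf sL pL Eg; have [pU aM aL] := cf; have jL : j <= size L by rewrite sL.
have e8 t : t \in L -> e2 g m t + e2 g m' t <= 8.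
  by move=> tL; have := e2_sum UU nok rg cf jL isT tL; rewrite !big_cons big_nil addn0.
have [t1L t2L] : t1 \in L /\ t2 \in L by rewrite !(perm_mem pL) !inE !eqxx !orbT.
split; try exact: e8.
move: Eg; rewrite (E2_split gS pU).
have pm m1 m2 : perm_eq [:: m; m'] [:: m1; m2] -> g m1.1 m1.2 ->
    \sum_(v <- vs2 [:: m; m']) (g m1.1 v + g m1.2 v) <= 4.
  move=> p gm; have pR : perm_eq (vs2 [:: m; m'] ++ [::]) (m1.1 :: m1.2 :: vs2 [:: m2]).
    by rewrite cats0 (vs2_perm p).
  by have := sum_nat_le (degR_pair UU nok rg cf jL gm pR); rewrite cats0.
have [gm gm'] : g m.1 m.2 /\ g m'.1 m'.2 by move: aM => /= /and3P[].
have r1 := pm _ _ (perm_refl _) gm.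
have r2 := pm m' m ltac:(by rewrite (perm_catC [:: _] [:: _])) gm'.
have -> : \sum_(x <- vs2 [:: m; m']) \sum_(y <- vs2 [:: m; m']) g x y =
    \sum_(v <- vs2 [:: m; m']) (g m.1 v + g m.2 v) + \sum_(v <- vs2 [:: m; m']) (g m'.1 v + g m'.2 v).
  rewrite [LHS]sum_vs2 [LHS]big_cons [\sum_(_ <- [:: m']) _]big_cons big_nil addn0.
  by rewrite -!big_split.
have -> : \sum_(t <- L) \sum_(x <- vs2 [:: m; m']) et g x t = \sum_(t <- L) (e2 g m t + e2 g m' t).
  by apply: eq_bigr => t _; rewrite sum_vs2 !big_cons big_nil addn0.
have s1 : \sum_(t <- L) (e2 g m t + e2 g m' t) <=
    (e2 g m t1 + e2 g m' t1) + (e2 g m t2 + e2 g m' t2) + 8 * size L2.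
  rewrite (perm_big _ pL) !big_cons /= addnA leq_add2l; apply: sum_nat_le => t tL; apply: e8.
  by rewrite (perm_mem pL) !inE tL !orbT.
have s2 : \sum_(t <- L) \sum_(t' <- L) tt g t t' + 3 * size L2 <=
    12 + 2 * tt g t1 t2 + 36 * size L2 + 9 * (size L2 * size L2).
  rewrite (perm_big _ pL) !big_cons /= !(perm_big _ pL) /= !big_cons.
  have -> : \sum_(t <- L2) \sum_(t' <- L) tt g t t' =
     \sum_(t <- L2) (tt g t t1 + tt g t t2) + \sum_(t <- L2) \sum_(t' <- L2) tt g t t'.
    by rewrite -big_split; apply: eq_bigr => t _; rewrite (perm_big _ pL) !big_cons /= addnA.
  have tC : tt g t2 t1 = tt g t1 t2.
    rewrite /tt /et ![g _ t1.1.1]gS ![g _ t1.1.2]gS ![g _ t1.2]gS.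
    by clear; do 9 move: (nat_of_bool (g _ _)) => ?; lia.
  have q1 := tt_self t1 gI; have q2 := tt_self t2 gI; have q3 := tt_sum_le L2 gI.
  have q4 : \sum_(t <- L2) tt g t1 t <= 9 * size L2 by apply: sum_nat_le => t _; apply: tt_le9.
  have q5 : \sum_(t <- L2) tt g t2 t <= 9 * size L2 by apply: sum_nat_le => t _; apply: tt_le9.
  have q6 : \sum_(t <- L2) (tt g t t1 + tt g t t2) <= 18 * size L2.
    by apply: sum_nat_le => t _; rewrite (leq_add (tt_le9 _ _ _) (tt_le9 _ _ _)).
  move: q1 q2 q3 q4 q5 q6; rewrite tC.
  move: (\sum_(t <- L2) \sum_(t' <- L2) tt g t t') (\sum_(t <- L2) tt g t1 t).
  move: (\sum_(t <- L2) tt g t2 t) (\sum_(t <- L2) (tt g t t1 + tt g t t2)) (tt g t1 t1) (tt g t2 t2).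
  by move: (tt g t1 t2) (size L2 * size L2) (size L2); clear; lia.
have sj : j = (size L2).+2 by rewrite -sL (perm_size pL).
move: r1 r2 s1 s2; rewrite sj.
move: (\sum_(v <- vs2 [:: m; m']) (g m.1 v + g m.2 v)) (\sum_(v <- vs2 [:: m; m']) (g m'.1 v + g m'.2 v)).
move: (\sum_(t <- L) (e2 g m t + e2 g m' t)) (\sum_(t <- L) \sum_(t' <- L) tt g t t').
move: ((e2 g m t1 + e2 g m' t1) + (e2 g m t2 + e2 g m' t2)) (tt g t1 t2) (size L2); clear; nia.
Qed.

(** By [no_cross] all other triangles are bad for [m']. They are not bad for [m], since a triangle
    receives at least seven edges from [m] and [m']; so [t1] is bad for [m'] too. At most three
    edges from [m'] to each triangle contradict its degrees unless [j = 2], where all values are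
    determined. *)
Lemma two_pairs_bad m m' L t1 : config U g [:: m; m'] [::] L -> size L = j -> 1 < j ->
  (forall x, x \in U -> 2 * j + 1 <= deg g U x) -> 9 * (j * j) + 13 * j + 6 <= E2 g U ->
  t1 \in L -> ~~ bad g m.1 m.2 t1 -> False.
Proof.
move=> cf sL j2 dl Eg t1L nb1; have [pU aM aL] := cf; have jL : j <= size L by rewrite sL.
have [gm gm'] : g m.1 m.2 /\ g m'.1 m'.2 by move: aM => /= /and3P[].
have pUt t t' : t \in L -> t' \in rem t L ->
    perm_eq U ([:: m.1; m.2; m'.1; m'.2] ++ verts t ++ verts t' ++ vs3 (rem t' (rem t L))).
  move=> tL tL'; have p1 := vs3_rem tL; have p2 := vs3_rem tL'.
  by rewrite /verts; clear - pU p1 p2; perm_count.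
have aLt t t' : t \in L -> t' \in rem t L -> all (tri g) (t :: t' :: rem t' (rem t L)).
  move=> tL tL'; apply/allP => w; rewrite !inE => h; apply: (allP aL).
  by case/or3P: h => [/eqP->|/eqP->|/mem_rem/mem_rem] //; apply: mem_rem tL'.
have sLt t t' : t \in L -> t' \in rem t L -> (size (rem t' (rem t L))).+2 = j.
  move=> tL tL'; rewrite -sL (perm_size (perm_to_rem tL)) /=.
  by rewrite (perm_size (perm_to_rem tL')).

have pL t t' : t \in L -> t' \in rem t L -> perm_eq L [:: t, t' & rem t' (rem t L)].
  by move=> tL tL'; apply: (perm_trans (perm_to_rem tL)); rewrite perm_cons perm_to_rem.
have CC t t' : t \in L -> t' \in rem t L ->
    [/\ 7 <= e2 g m t + e2 g m' t, 7 <= e2 g m t' + e2 g m' t', 8 <= tt g t t' &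
     24 <= (e2 g m t + e2 g m' t) + (e2 g m t' + e2 g m' t') + tt g t t'].
  move=> tL tL'; have [h1 h2 h3] := two_pairs_count cf sL (pL _ _ tL tL') Eg.
  have := tt_le9 g t t'; move: (tt g t t') h1 h2 h3.
  move: (e2 g m t + e2 g m' t) (e2 g m t' + e2 g m' t'); clear => a b c; split; lia.
have nc t t' : t \in L -> t' \in rem t L -> ~~ bad g m.1 m.2 t -> bad g m'.1 m'.2 t'.
  move=> tL tL' nb; apply: contraT => nb'; have [_ _ h8 _] := CC _ _ tL tL'.
  by case: (no_cross (pUt _ _ tL tL') (aLt _ _ tL tL') (sLt _ _ tL tL') gm gm' h8 nb nb').
have [t2 t2L] : exists t2, t2 \in rem t1 L.
  case: (rem t1 L) (size_rem t1L) => [|t2 l _]; last by exists t2; rewrite mem_head.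
  by rewrite sL; move: j2; case: (j) => [|[]].
have be (u u' : V) t : bad g u u' t -> e2 g (u, u') t <= 3 by apply: bad_e2.
have be' t : bad g m'.1 m'.2 t -> e2 g m' t <= 3 by move/be; case: (m').
have bm' : {in L, forall t, bad g m'.1 m'.2 t}.
  have bo t : t \in rem t1 L -> bad g m'.1 m'.2 t by move=> tL; apply: (nc t1).
  have nb2 : ~~ bad g m.1 m.2 t2.
    apply/negP => /be b2; have := be' _ (bo _ t2L); have [_ h _ _] := CC _ _ t1L t2L.
    by move: h b2; case: (m) => u v /=; clear; lia.
  have t1r : t1 \in rem t2 L.
    have p := pL _ _ t1L t2L; have t2L' := mem_rem t2L.
    have : perm_eq (rem t2 L) (t1 :: rem t2 (rem t1 L)).
      rewrite -(perm_cons t2); apply: (perm_trans _ (permEl (perm_catCA [:: t1] [:: t2] _))).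
      by apply: perm_trans p; rewrite perm_sym perm_to_rem.
    by move/perm_mem->; rewrite mem_head.
  move=> t; rewrite (perm_mem (perm_to_rem t1L)) inE => /orP[/eqP->|]; last exact: bo.
  by apply: (nc t2) => //; apply: mem_rem t2L.
have t2L' := mem_rem t2L.
have mU : [/\ m.1 \in U, m.2 \in U, m'.1 \in U & m'.2 \in U].
  by rewrite !(perm_mem pU) !mem_cat !inE !eqxx !orbT.
have [_ _ m1U m2U] := mU.
have pR : perm_eq (vs2 [:: m; m'] ++ [::]) (m'.1 :: m'.2 :: vs2 [:: m]).
  by rewrite cats0 (vs2_perm (permEl (perm_catC [:: m] [:: m']))).
have pR' : perm_eq (vs2 [:: m; m'] ++ [::]) (m.1 :: m.2 :: vs2 [:: m']) by [].
have dd := deg_pair UU nok rg cf jL gm' pR.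
have l3 l : {subset l <= L} -> \sum_(t <- l) e2 g m' t <= 3 * size l.
  by move=> sl; apply: sum_nat_le => t /sl tl; apply/be'/bm'.
have [d1 d2] := (dl _ m1U, dl _ m2U).
have em' : \sum_(t <- L) e2 g (m'.1, m'.2) t = \sum_(t <- L) e2 g m' t by rewrite -surjective_pairing.
have j_2 : j = 2.
  move: dd d1 d2 (l3 _ (fun _ => id)) j2; rewrite em' sL /=.
  by move: (\sum_(_ <- _) _) (deg g U _) (deg g U _); clear; lia.
have L2 : perm_eq L [:: t1; t2].
  have := pL _ _ t1L t2L; have := sLt _ _ t1L t2L; rewrite j_2.
  by case: (rem t2 (rem t1 L)).
have EL (F : V * V * V -> nat) : \sum_(t <- L) F t = F t1 + F t2.
  by rewrite (perm_big _ L2) /= !big_cons big_nil addn0.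
have r1 v : v \in [:: m'.1; m'.2] -> g v m.1 + g v m.2 <= 1.
  move=> vin; have := degR_pair UU nok rg cf jL gm pR' => /(_ v).
  rewrite ![g v _]gS; apply; rewrite cats0 [vs2 _]/= !inE; move: vin; rewrite !inE.
  by case/orP => ->; rewrite !orbT.
have dx v : v \in [:: m'.1; m'.2] -> deg g U v <= 2 + (et g v t1 + et g v t2).
  move=> vin; rewrite (deg_config v cf) EL !big_cons !big_nil leq_add2r ?addn0.
  have := r1 v vin; rewrite /em; move: vin; rewrite !inE => /orP[] /eqP->;
  by rewrite gI; do 3 case: (g _ _).
have dl' v : v \in [:: m'.1; m'.2] -> 3 <= et g v t1 + et g v t2.
  move=> vin; have := dx v vin; have : v \in U by move: vin; rewrite !inE => /orP[] /eqP->.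
  by move/dl; rewrite j_2; clear; lia.
have b1 := be' _ (bm' _ t1L); have b2 := be' _ (bm' _ t2L').
have [q1 q2] : et g m'.1 t1 + et g m'.1 t2 = 3 /\ et g m'.2 t1 + et g m'.2 t2 = 3.
  move: b1 b2 (dl' m'.1 (mem_head _ _)) (dl' m'.2); rewrite /e2 inE mem_head orbT => c1 c2 c3 /(_ isT).
  by move: c1 c2 c3; clear; lia.
have e1 : e2 g (m'.1, m'.2) t1 = 3.
  by move: b1 b2 q1 q2; rewrite /e2 /=; clear; lia.
have e1' : e2 g (m'.1, m'.2) t2 = 3.
  by move: e1 q1 q2; rewrite /e2 /=; clear; lia.
have [_ h1 h2] := two_pairs_count cf sL (pL _ _ t1L t2L) Eg.
have [_ _ _ h3] := CC _ _ t1L t2L.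
rewrite /e2 /= in e1 e1'; rewrite /e2 in h1 h2 h3.
apply: (two_pairs_final (pUt _ _ t1L t2L) (aLt _ _ t1L t2L) (sLt _ _ t1L t2L) gm _ (bm' _ t1L)) => //.
- by move=> v; rewrite !inE => /orP[] /eqP->.
- by move: h1; rewrite e1 /e2 /=; clear; lia.
- by move: h2; rewrite e1' /e2 /=; clear; lia.
by move: h3; rewrite e1 e1' /e2 /=; clear; lia.
Qed.

(** A triangle receives at least seven edges from [m] and [m'] together, so it is not bad for
    both. *)
Lemma two_pairs_step m m' L : config U g [:: m; m'] [::] L -> size L = j -> 1 < j ->
  (forall x, x \in U -> 2 * j + 1 <= deg g U x) -> 9 * (j * j) + 13 * j + 6 <= E2 g U -> False.
Proof.
move=> cf sL j2 dl Eg.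
have [t1 [t2 [l pL]]] : exists t1 t2 l, L = [:: t1, t2 & l].
  by case: L sL {cf} => [|t1 [|t2 l]] /= sL; move: j2; rewrite -sL // => _; exists t1, t2, l.
have pL' : perm_eq L [:: t1, t2 & l] by rewrite pL.
have [h1 h2 h3] := two_pairs_count cf sL pL' Eg.
have t1L : t1 \in L by rewrite pL mem_head.
have [b|nb] := boolP (bad g m.1 m.2 t1); last exact: (two_pairs_bad cf sL j2 dl Eg t1L nb).
have [b'|nb'] := boolP (bad g m'.1 m'.2 t1); last first.
  have cf' := config_perm (permEl (perm_catC [:: m] [:: m'])) (perm_refl _) (perm_refl _) cf.
  exact: (two_pairs_bad cf' sL j2 dl Eg t1L nb').
have := bad_e2 b; have := bad_e2 b'; have := tt_le9 g t1 t2.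
rewrite -!surjective_pairing; move: h1 h2 h3; clear.
move: (e2 g m t1) (e2 g m' t1) (tt g t1 t2) (e2 g m t2 + e2 g m' t2); clear; lia.
Qed.

End TwoPairs.

(** * Seven vertices *)

Definition pairs7 : seq (nat * nat) :=
  [seq p <- [seq (i, j) | i <- iota 0 7, j <- iota 0 7] | p.1 < p.2].

Definition tri_pairs (t : nat * nat * nat) := [:: (t.1.1, t.1.2); (t.1.1, t.2); (t.1.2, t.2)].

Definition triples7 : seq (nat * nat * nat) :=
  [seq t <- [seq (p, k) | p <- pairs7, k <- iota 0 7] | t.1.2 < t.2].

Definition disj_tri7 : seq (seq (nat * nat * nat)) :=
  [seq I <- [seq [:: s; t] | s <- triples7, t <- triples7] | uniq (vs3 I)].

(** The excluded pairs are known edges: the triangle of the packing and the two matching edges. *)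
Definition free7 := [seq p <- pairs7 |
  p \notin [:: (0, 1); (0, 2); (1, 2); (3, 4); (5, 6)]].

(* [has] and [all] are strict under call by value. *)
Fixpoint lazy_has T (a : pred T) s := if s is x :: s' then if a x then true else lazy_has a s' else false.
Fixpoint lazy_all T (a : pred T) s := if s is x :: s' then if a x then lazy_all a s' else false else true.

Lemma lazy_hasE T (a : pred T) s : lazy_has a s = has a s. Proof. by elim: s => //= x s ->. Qed.
Lemma lazy_allE T (a : pred T) s : lazy_all a s = all a s. Proof. by elim: s => //= x s ->. Qed.

Definition contains2 (l : seq (nat * nat)) :=
  lazy_has (fun I => lazy_all (fun t => lazy_all (fun p => p \notin l) (tri_pairs t)) I) disj_tri7.

(* [l] lists the pairs that may be missing; adding a missing edge to a rainbow graph costs at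
   most one present edge, the one of the same colour. *)
Fixpoint forced r l := if contains2 l then true else if r is r'.+1 then
  lazy_has (fun e => let l' := filter (predC1 e) l in if forced r' l' then
     lazy_all (fun f => if f \in e :: l' then true else forced r' (f :: l')) pairs7 else false) l
  else false.

(** Runs through all ways to add at most [n] elements of [es] to the missing pairs [acc], allowing
    two exchanges for each. *)
Fixpoint all_forced es acc n := if es is e :: es' then
  if n is n'.+1 then if all_forced es' (e :: acc) n' then all_forced es' acc n else false
  else all_forced es' acc n
  else forced 2 acc.

(** Of the 21 pairs at least 14 are edges, whence the budget 7. *)
Lemma all_forced_free : all_forced free7 [::] 7.
Proof. by vm_compute. Qed.

Lemma filter_skip (T : eqType) (P : pred T) (K s : seq T) : {in K, forall p, ~~ P p} ->
  filter P [seq p <- s | p \notin K] = filter P s.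
Proof.
move=> KP; rewrite -filter_predI; apply: eq_filter => p /=.
by case: (boolP (p \in K)) => [/KP/negbTE->|_]; rewrite ?andbT.
Qed.

Lemma contains2E l :
  contains2 l = has (all (fun t => all (fun p => p \notin l) (tri_pairs t))) disj_tri7.
Proof.
rewrite /contains2 lazy_hasE; apply: eq_has => I; rewrite lazy_allE; apply: eq_all => t.
by rewrite lazy_allE.
Qed.

Opaque contains2 pairs7.

Lemma all_forcedP es acc n (P : pred (nat * nat)) : all_forced es acc n ->
  size (filter P es) <= n -> forced 2 (catrev (filter P es) acc).
Proof.
elim: es acc n => [|e es IH] acc n //=; case: n => [|n].
  by move=> h; case: (P e) => //=; apply: IH.
by case: ifP => // h1 h2; case: (P e) => /= sz; [exact: IH h1 sz|exact: IH h2 sz].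
Qed.

Lemma disj_tri7P : all (fun I => [&& uniq (vs3 I), all (fun i => i < 7) (vs3 I), size I == 2 &
  all (fun t => all (mem pairs7) (tri_pairs t)) I]) disj_tri7.
Proof. by vm_compute. Qed.

Lemma pairs7P p : p \in pairs7 -> p.1 < p.2 < 7.
Proof.
rewrite mem_filter => /andP[->] /allpairsP[q [_]]; rewrite mem_iota => /andP[_ h] ->; exact: h.
Qed.

Section Seven.
Variables (V D : eqType) (col : V -> V -> D).
Hypothesis colC : forall x y, col x y = col y x.
Local Notation rainbow_rel := (rainbow_rel col).
Variables (U : seq V) (x0 : V).
Hypothesis UU : uniq U.
Hypothesis sU : size U = 7.
Hypothesis nok : ~ has_packing col U 2.
Let v i := nth x0 U i.

(** Only an upper bound for the absent edges: a listed pair may be present. *)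
Definition misses (g : rel V) (l : seq (nat * nat)) := {in pairs7, forall p, p \notin l -> g (v p.1) (v p.2)}.

Lemma misses_contains2 g l : rainbow_rel g -> misses g l -> ~~ contains2 l.
Proof.
move=> rg mg; rewrite contains2E; apply/hasPn => I Iin.
have /and4P[uI bI sI /allP pI] := allP disj_tri7P _ Iin.
have pU : perm_eq U (U ++ [::] ++ vs3 [::]) by rewrite !cats0.
have b7 : uniq (vs3 I) && all (fun i => i < size U) (vs3 I) by rewrite uI sU.
have := no_repl x0 nok UU pU rg isT b7; rewrite (eqP sI) => /(_ isT).
apply: contra; rewrite all_map => /allP h; apply/allP => t tI /=.
have /= /and4P[q1 q2 q3 _] := pI t tI; have := h t tI.
by rewrite /= => /and4P[r1 r2 r3 _]; rewrite /tri /= !(mg _ q1, mg _ q2, mg _ q3).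
Qed.

(** A round of [forced] is one use of [ar_swap]: [e] leaves the list, and at most one pair enters
    it, the edge that had the colour of [e]. *)
Lemma forced_false r g l : forced r l -> rainbow_rel g -> misses g l -> {subset l <= pairs7} -> False.
Proof.
elim: r g l => [|r IH] g l fl rg mg lp; move: fl; rewrite /= (negbTE (misses_contains2 rg mg)) //.
rewrite lazy_hasE => /hasP[e el]; set l' := filter _ l.
have l'p : {subset l' <= pairs7} by move=> p; rewrite mem_filter => /andP[_ /lp].
case: ifP => // f1; rewrite lazy_allE => /allP f2.
have /andP[e12 e7] := pairs7P (lp _ el).
have inj i k : i < 7 -> k < 7 -> (v i == v k) = (i == k).
  by move=> i7 k7; rewrite /v nth_uniq ?sU.
have vU i : i < 7 -> v i \in U by move=> i7; rewrite mem_nth ?sU.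
have e17 := ltn_trans e12 e7.
have nl p : p \notin l' -> p != e -> p \notin l.
  by rewrite mem_filter /= => /nandP[/negPn ->|].
have ne : v e.1 != v e.2 by rewrite inj // ltn_eqF.
have [g' [rg' _ ge gk]] := ar_swap colC UU rg (vU _ e17) (vU _ e7) ne.
have [/hasP[f fin /andP[fl' /eqP cf]]|/hasPn no] := boolP (has (fun f => (f \notin e :: l') &&
    (col (v f.1) (v f.2) == col (v e.1) (v e.2))) pairs7); last first.
  apply: (IH g' l') => // p pin pl; have [->//|pe] := eqVneq p e.
  apply: gk; first by apply: mg => //; apply: nl.
  by have := no p pin; rewrite inE (negbTE pe) (negbTE pl).
have := f2 f fin; rewrite (negbTE fl') => f3.
apply: (IH g' (f :: l')) => // [p pin|p]; last by rewrite inE => /orP[/eqP->//|/l'p].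
rewrite inE negb_or => /andP[pf pl]; have [->//|pe] := eqVneq p e.
have gp : g (v p.1) (v p.2) by apply: mg => //; apply: nl.
apply: gk => //; apply: contra pf => /eqP cp; have [_ _ rb] := rg.
have gf : g (v f.1) (v f.2).
  by move: fl'; rewrite inE negb_or => /andP[fe fl']; apply: mg => //; apply: nl.
have := rb _ _ _ _ gp gf; rewrite cp cf => /(_ erefl).
have /andP[p12 p7] := pairs7P pin; have /andP[f12 f7] := pairs7P fin.
have [p17 f17] := (ltn_trans p12 p7, ltn_trans f12 f7).
rewrite /same_edge !inj //; move: p12 f12; case: (p) (f) => p1 p2 [q1 q2] /=; clear.
move=> h1 h2 /orP[] /andP[/eqP e1 /eqP e2]; first by rewrite e1 e2.
by move: h1 h2; rewrite e1 e2; lia.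
Qed.

Lemma no_seven_vertices g t m m' : rainbow_rel g ->
  U = [:: t.1.1; t.1.2; t.2; m.1; m.2; m'.1; m'.2] ->
  tri g t -> g m.1 m.2 -> g m'.1 m'.2 -> 28 <= E2 g U -> False.
Proof.
move=> rg eU tg gm gm' Eg; have [gS gI _] := rg.
pose P p := ~~ g (v p.1) (v p.2).
have kn : filter P pairs7 = filter P free7.
  rewrite /free7 filter_skip // => p; have /and3P[t1 t2 t3] := tg.
  by rewrite /P /v eU !inE => /or4P[|||/orP[]] /eqP->; rewrite /= ?t1 ?t2 ?t3 ?gm ?gm'.
have szb : size (filter P pairs7) <= 7.
  have : \sum_(p <- pairs7) g (v p.1) (v p.2) + \sum_(p <- pairs7) P p = 21.
    rewrite -big_split /= (eq_bigr (fun _ => 1)); first by rewrite sum1_size.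
    by move=> p _; rewrite /P; case: (g _ _).
  rewrite size_filter -sum1_count [X in _ -> X <= _]big_mkcond /=.
  have -> : \sum_(p <- pairs7) (if P p then 1 else 0) = \sum_(p <- pairs7) P p by apply: eq_bigr.
  have : E2 g U = 2 * \sum_(p <- pairs7) g (v p.1) (v p.2).
    rewrite /v eU; move: (t.1.1) (t.1.2) (t.2) (m.1) (m.2) (m'.1) (m'.2) => a b c d e f h.
    have -> : pairs7 = ltac:(let x := eval vm_compute in pairs7 in exact x) by vm_compute.
    rewrite /E2 /deg !big_cons !big_nil /= !gI.
    rewrite ![g b a]gS ![g c a]gS ![g d a]gS ![g e a]gS ![g f a]gS ![g h a]gS.
    rewrite ![g c b]gS ![g d b]gS ![g e b]gS ![g f b]gS ![g h b]gS.
    rewrite ![g d c]gS ![g e c]gS ![g f c]gS ![g h c]gS.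
    rewrite ![g e d]gS ![g f d]gS ![g h d]gS ![g f e]gS ![g h e]gS ![g h f]gS.
    clear; do 21 (let z := fresh "z" in move: (nat_of_bool (g _ _)) => z); lia.
  move: Eg; move: (E2 g U) (\sum_(p <- _) _) (\sum_(p <- _) P p); clear; lia.
have := all_forcedP (P := P) all_forced_free; rewrite -kn => /(_ szb) fb.
apply: (forced_false fb rg) => [p pin|p]; rewrite -[catrev _ _]/(rev _) mem_rev.
  by rewrite mem_filter pin andbT negbK.
by rewrite mem_filter => /andP[].
Qed.
End Seven.

(** * Induction *)

(* Twice the bound of the theorem for [k = j + 1], at [n = 3 k + 2 s] and, rounded down, at
   [n = 3 k + 2 s + 1]; beyond the range of the theorem the truncated difference makes it weaker. *)
Definition threshold_even j s := 2 * (j + 1 + s) ^ 2 + 4 * j * (j + 1 + s) + (j + 1) * j + 2 + 2 * (j ^ 2 - s).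
Definition threshold_odd j s :=
  2 * (j + 1 + s) * (j + 2 + s) + 2 * j * (2 * j + 2 * s + 3) + (j + 1) * j + 2 + 2 * (j ^ 2 - s.+1).

(** Both thresholds belong to the same [n], since [3 * j.+1 + 2 * s.+1 + 1 = 3 * j.+2 + 2 * s]; so
    enough edges for the larger packing provide the one with a triangle less. *)
Lemma threshold_odd_le_even j s : threshold_odd j s.+1 <= threshold_even j.+1 s.
Proof.
rewrite /threshold_odd /threshold_even; have : j ^ 2 - s.+2 <= j.+1 ^ 2 - s; first by lia.
by move: (j ^ 2 - _) (j.+1 ^ 2 - _); nia.
Qed.

Lemma threshold_even_le_odd j s : threshold_even j s.+2 <= threshold_odd j.+1 s.
Proof.
rewrite /threshold_odd /threshold_even; have : j ^ 2 - s.+2 <= j.+1 ^ 2 - s.+1; first by lia.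
by move: (j ^ 2 - _) (j.+1 ^ 2 - _); nia.
Qed.

(** Half the difference is [s.+2 + 2 * j], the value that degrees must exceed in [even_step]. *)
Lemma threshold_evenS j s : threshold_odd j s + 4 * j + 2 * s + 4 = threshold_even j s.+1.
Proof. by rewrite /threshold_odd /threshold_even; move: (j ^ 2 - _); nia. Qed.

Lemma threshold_even_odd j s : threshold_even j s + 4 * j + 2 * s <= threshold_odd j s.
Proof.
rewrite /threshold_odd /threshold_even; have : j ^ 2 - s <= (j ^ 2 - s.+1).+1; first by lia.
by move: (j ^ 2 - _) (j ^ 2 - _); nia.
Qed.

(** Through [pair_deg] this yields the degree sum [2 * N + 4 * j - 1] for [N = s.+3]. *)
Lemma threshold_oddS j s : threshold_odd j s + 8 * j + 4 * s + 6 <= threshold_odd j s.+1.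
Proof.
rewrite /threshold_odd; have : j ^ 2 - s.+1 <= (j ^ 2 - s.+2).+1; first by lia.
by move: (j ^ 2 - _) (j ^ 2 - _); nia.
Qed.

(** The left side is the edge count of [complete_bipartite_bound]. *)
Lemma threshold_odd_step j s (N := s.+2) : 0 < j ->
  2 * (N * N) + 2 * (3 * N + 4 * N * j.-1) + (6 + 12 * j.-1 + j.-1 * (6 + 7 * j.-2)) < threshold_odd j s + 2.
Proof.
rewrite /threshold_odd /N; case: j => // -[|j] _ /=; first by nia.
move: (j.+2 ^ 2 - s.+1) (leq_subLR s.+1 (j.+2 ^ 2) ) => d _; nia.
Qed.

Section Induction.
Variables (V D : eqType) (col : V -> V -> D).
Hypothesis colC : forall x y, col x y = col y x.
Local Notation rainbow_rel := (rainbow_rel col).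
Local Notation edge_threshold := (edge_threshold col).

(** The packing may live in another rainbow graph [h]. Restricting [h] to [U] and extending it by
    [g] puts its triangles into a graph with at least as many edges as [g]. *)
Lemma packing_config U g k : uniq U -> rainbow_rel g -> has_packing col U k ->
  exists g' Z L, [/\ rainbow_rel g', E2 g U <= E2 g' U, config U g' [::] Z L & size L = k].
Proof.
move=> UU rg [h [L [rh tL uL sLU kL]]].
pose h' x y := [&& h x y, x \in U & y \in U].
have rh' : rainbow_rel h'.
  have [hS hI hC] := rh; split=> [x y|x|x y z w /and3P[h1 _ _] /and3P[h2 _ _]].
  - by rewrite /h' hS [(x \in U) && _]andbC.
  - by rewrite /h' hI.
  exact: hC.
have [|re Ee] := extend_rainbow colC UU rg rh'; first by move=> x y /and3P[_ -> ->].
set g' := extend col U h' g in re Ee; set L' := take k L.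
have sL'U : {subset vs3 L' <= U} by move=> x /vs3_take/sLU.
have sL' : size L' = k by rewrite size_takel.
have uL' : uniq (vs3 L').
  by move: uL; rewrite -{1}(cat_take_drop k L) vs3_cat cat_uniq => /andP[].
exists g', [seq x <- U | x \notin vs3 L'], L'; split => //; split => //.
  rewrite /= -(perm_filterC (mem (vs3 L')) U) perm_catC perm_cat2l perm_sym.
  apply: uniq_perm => //; first by rewrite filter_uniq.
  by move=> x; rewrite mem_filter andb_idr //; apply: sL'U.
apply/allP => t tL'; have := allP tL _ (mem_take tL').
have U3 x : x \in [:: t.1.1; t.1.2; t.2] -> x \in U.
  by move=> xt; apply: sL'U; apply/flattenP; exists [:: t.1.1; t.1.2; t.2] => //; apply/mapP; exists t.
by move=> /and3P[h1 h2 h3]; rewrite /tri /g' /extend /h' h1 h2 h3 !U3 // !inE eqxx ?orbT.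
Qed.

Lemma edge_threshold_intro j n F :
  (forall U g, uniq U -> size U = n -> rainbow_rel g -> F + 2 <= E2 g U -> has_packing col U j) ->
  (forall U, uniq U -> size U = n -> ~ has_packing col U j.+1 ->
     forall g Z L, rainbow_rel g -> F + 2 <= E2 g U -> config U g [::] Z L -> size L = j -> False) ->
  edge_threshold j n F.
Proof.
move=> pk st U g UU sU rg Eg; apply: NNPP => nok.
have [g' [Z [L [rg' Eg' cf sL]]]] := packing_config UU rg (pk U g UU sU rg Eg).
exact: (st U UU sU nok g' Z L rg' (leq_trans Eg Eg') cf sL).
Qed.

Lemma edge_threshold_packing j n F F' : edge_threshold j n F' -> F' <= F ->
  forall U g, uniq U -> size U = n -> rainbow_rel g -> F + 2 <= E2 g U -> has_packing col U j.+1.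
Proof. by move=> th le U g UU sU rg Eg; apply: (th U g) => //; apply: leq_trans Eg; rewrite leq_add2r. Qed.

Lemma packing0 n F U g : uniq U -> size U = n -> rainbow_rel g -> F + 2 <= E2 g U -> has_packing col U 0.
Proof. by move=> _ _ rg _; exists g, [::]. Qed.

Lemma edge_threshold_base j :
  (forall U g, uniq U -> size U = 3 * j.+1 -> rainbow_rel g ->
     threshold_even j 0 + 2 <= E2 g U -> has_packing col U j) ->
  edge_threshold j (3 * j.+1) (threshold_even j 0).
Proof.
move/edge_threshold_intro; apply => U UU sU nok g Z L rg Eg cf sL.
have := size_config cf; rewrite sU sL => sZ; have [pU _ aL] := cf.
have E9 : 9 * (j * j) + 9 * j + 6 <= E2 g U by apply: leq_trans Eg; rewrite /threshold_even; clear; nia.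
case: Z sZ cf pU => [|x [|y [|z [|w Z]]]] /= sZ cf pU; try by move: sZ; clear; lia.
exact: (base_step colC UU nok rg E9 pU sL aL).
Qed.

Lemma edge_threshold_even j s :
  (forall U g, uniq U -> size U = 3 * j.+1 + 2 * s.+1 -> rainbow_rel g -> threshold_even j s.+1 + 2 <= E2 g U ->
     has_packing col U j) ->
  edge_threshold j (3 * j.+1 + 2 * s + 1) (threshold_odd j s) ->
  edge_threshold j (3 * j.+1 + 2 * s.+1) (threshold_even j s.+1).
Proof.
move=> pk th; apply: edge_threshold_intro pk _ => U UU sU nok g Z L rg Eg cf sL.
apply: (even_step (N := s.+2) UU nok _ isT _ rg Eg cf sL).
  by rewrite sU; clear; lia.
move=> g' x rg' Eg' xU.
have sU' : size U = (3 * j.+1 + 2 * s + 1).+1 by rewrite sU; clear; lia.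
have := min_deg th nok UU sU' rg' Eg' xU; rewrite -threshold_evenS; clear.
by move: (threshold_odd _ _) (deg _ _ _); lia.
Qed.

Lemma edge_threshold_odd j s :
  (forall U g, uniq U -> size U = 3 * j.+1 + 2 * s + 1 -> rainbow_rel g -> threshold_odd j s + 2 <= E2 g U ->
     has_packing col U j) ->
  edge_threshold j (3 * j.+1 + 2 * s) (threshold_even j s) ->
  (0 < s -> edge_threshold j (3 * j.+1 + 2 * s.-1 + 1) (threshold_odd j s.-1)) ->
  edge_threshold j (3 * j.+1 + 2 * s + 1) (threshold_odd j s).
Proof.
move=> pk the tho; apply: edge_threshold_intro pk _ => U UU sU nok g Z L rg Eg cf sL.
have sUN : size U = 3 * j + 2 * s.+2 by rewrite sU; clear; lia.
have dl g' x : rainbow_rel g' -> threshold_odd j s + 2 <= E2 g' U -> x \in U -> s.+2.-1 + 2 * j <= deg g' U x.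
  move=> rg' Eg' xU; have sU' : size U = (3 * j.+1 + 2 * s).+1 by rewrite sU; clear; lia.
  have := min_deg the nok UU sU' rg' Eg' xU; have := threshold_even_odd j s; clear.
  by move: (threshold_odd _ _) (threshold_even _ _) (deg _ _ _); lia.
case: s {the} tho sU Eg sUN dl => [|s] tho sU Eg sUN dl; last first.
  apply: (@odd_step _ _ _ colC U j s.+3 UU nok (threshold_odd j s.+1 + 2) sUN isT dl _ _ g [::] Z L rg Eg cf sL).
    move=> g' x y rg' Eg' xU yU gxy.
    have sU' : size U = (3 * j.+1 + 2 * s + 1).+2 by rewrite sU; clear; lia.
    have := pair_deg (tho isT) nok UU sU' rg' Eg' xU yU gxy; have := threshold_oddS j s; clear.
    by move: (threshold_odd _ _) (threshold_odd _ _) (deg _ _ _) (deg _ _ _); lia.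
  by move=> j0; have := threshold_odd_step s.+1 j0.
apply: (perfect_odd colC UU nok sUN isT dl _ rg Eg cf sL) => {rg Eg cf sL Z}g M {}L rg Eg cf sL sM.
case: M sM cf => [|m [|m' []]] // _ cf; have [pU /and3P[gm gm' _] aL] := cf.
(* Comparing two triangles needs [j] at least 2; [j = 0] means four vertices and [j = 1] seven. *)
have j2 : 1 < j -> False.
  move=> j2; apply: (two_pairs_step UU nok rg cf sL j2).
    by move=> x xU; rewrite addnC; apply: dl.
  by apply: leq_trans Eg; rewrite /threshold_odd; move: j2; clear; case: j => // j _; rewrite subn1; nia.
move: (ltnP 1 j) => [/j2//|]; case: (j) sL nok Eg => [|[|//]] sL nok' Eg _.
  case: L sL cf pU aL => // _ cf pU _.
  by apply: (two_pairs_j0 colC UU nok' rg pU erefl gm gm'); apply: leq_trans Eg; rewrite /threshold_odd.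
case: L sL cf pU aL => [|t []] // _ cf pU /andP[tt _].
set W := [:: t.1.1; t.1.2; t.2; m.1; m.2; m'.1; m'.2].
have pW : perm_eq U W by apply: perm_trans pU _; rewrite /W; clear; perm_count.
have uW : uniq W by rewrite -(perm_uniq pW).
have nokW : ~ has_packing col W 2.
  by move=> /has_packing_sub h; apply: nok'; apply: h => x; rewrite (perm_mem pW).
apply: (no_seven_vertices colC m.1 uW erefl nokW rg erefl tt gm gm').
by rewrite -(E2_perm _ pW); apply: leq_trans Eg; rewrite /threshold_odd.
Qed.

(** The packing with one triangle less comes from the smaller [j] at [s.+1] or [s.+2], so the outer
    hypothesis must hold for all [s]. *)
Lemma edge_thresholds j s :
  edge_threshold j (3 * j.+1 + 2 * s) (threshold_even j s) /\
  edge_threshold j (3 * j.+1 + 2 * s + 1) (threshold_odd j s).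
Proof.
elim: j s => [|j IHj] s; last first.
  have pe s' U g : uniq U -> size U = 3 * j.+2 + 2 * s' -> rainbow_rel g -> threshold_even j.+1 s' + 2 <= E2 g U ->
      has_packing col U j.+1.
    move=> UU sU; have [_ th] := IHj s'.+1.
    by apply: (edge_threshold_packing th (threshold_odd_le_even j s')) => //; rewrite sU; clear; lia.
  have po s' U g : uniq U -> size U = 3 * j.+2 + 2 * s' + 1 -> rainbow_rel g -> threshold_odd j.+1 s' + 2 <= E2 g U ->
      has_packing col U j.+1.
    move=> UU sU; have [th _] := IHj s'.+2.
    by apply: (edge_threshold_packing th (threshold_even_le_odd j s')) => //; rewrite sU; clear; lia.
  elim: s => [|s [IHe IHo]].
    split; [|apply: edge_threshold_odd (po 0) _ _ => //]; rewrite muln0 addn0;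
    by apply: edge_threshold_base => U g; rewrite -[3 * _]addn0; apply: (pe 0).
  have te := edge_threshold_even (pe s.+1) IHo; split => //.
  exact: edge_threshold_odd (po s.+1) te (fun _ => IHo).
have pk F n U g := @packing0 n F U g.
elim: s => [|s [IHe IHo]].
  split; [|apply: edge_threshold_odd (@pk _ _) _ _ => //]; rewrite muln0 addn0;
  by apply: edge_threshold_base; apply: pk.
have te := edge_threshold_even (@pk _ _) IHo; split => //.
exact: edge_threshold_odd (@pk _ _) te (fun _ => IHo).
Qed.
End Induction.

(** * Anti-Ramsey numbers *)

Section AntiRamsey.
Variables (n : nat) (T : eqType) (c : {set complete_graph n} -> T).
Let col (x y : 'I_n) : T := c [set x; y].

Lemma set2_same_edge (x y z w : 'I_n) : [set x; y] = [set z; w] -> x != y -> same_edge x y z w.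
Proof.
move=> e xy; have := set21 z w; have := set22 z w; rewrite -e !inE /same_edge.
move=> /orP[] /eqP wE /orP[] /eqP zE; rewrite wE zE ?eqxx ?orbT //.
  by have := set22 x y; rewrite e wE zE !inE orbb eq_sym (negbTE xy).
by have := set21 x y; rewrite e wE zE !inE orbb (negbTE xy).
Qed.

(** [g] consists of the first listed edge of each colour; each contributes two ordered pairs to
    [E2]. *)
Lemma rainbow_representatives :
  exists2 g : rel 'I_n, rainbow_rel col g & 2 * num_colors c <= E2 g (enum 'I_n).
Proof.
pose s := [seq c e | e in edges (complete_graph n)].
pose rep d := nth set0 (enum (edges (complete_graph n))) (index d s).
have repP d : d \in s -> rep d \in edges (complete_graph n) /\ c (rep d) = d.
  move=> ds; have lt : index d s < size (enum (edges (complete_graph n))) by rewrite -(size_map c) index_mem.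
  split; first by rewrite -mem_enum mem_nth.
  by rewrite /rep -(nth_map set0 d) // nth_index.
pose g x y := (x != y) && ([set x; y] == rep (col x y)).
have gS x y : g x y = g y x by rewrite /g /col setUC eq_sym.
exists g.
  split=> [x y|x|x y z w /andP[xy /eqP e1] /andP[zw /eqP e2] e]; first exact: gS.
    by rewrite /g eqxx.
  by apply: set2_same_edge xy; rewrite e1 e2 e.
pose P d x y := (x != y) && ([set x; y] == rep d).
have le x y : \sum_(d <- undup s) P d x y <= g x y.
  have [gxy|ngxy] := boolP (g x y); last first.
    rewrite leqn0 big_seq big1 // => d; rewrite mem_undup => /repP[_ cd].
    apply/eqP; rewrite eqb0; apply: contra ngxy => /andP[xy /eqP e]; rewrite /g xy /=.
    by rewrite /col e cd.
  apply: (@leq_trans (\sum_(d <- undup s) (d == col x y))).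
    rewrite big_seq [X in _ <= X]big_seq; apply: leq_sum => d; rewrite mem_undup => /repP[_ cd].
    by case: (boolP (P d x y)) => // /andP[_ /eqP e]; rewrite /col e cd eqxx.
  rewrite -big_mkcond /= sum1_count -[X in _ <= X]/1.
  by rewrite count_uniq_mem ?undup_uniq // leq_b1.
have two d : d \in undup s -> 2 <= \sum_x \sum_y P d x y.
  rewrite mem_undup => /repP[/imsetP[[a b]]]; rewrite inE /= => ab e _.
  rewrite pair_bigA /= (bigD1 (a, b)) //= (bigD1 (b, a)) /=; last by rewrite xpair_eqE eq_sym negb_and ab.
  have ba : b != a by rewrite eq_sym.
  by rewrite /P e ab ba [[set b; a]]setUC eqxx.
rewrite /E2 /deg big_enum /=.
apply: (@leq_trans (\sum_x \sum_y \sum_(d <- undup s) P d x y)); last first.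
  by apply: leq_sum => x _; rewrite big_enum /=; apply: leq_sum => y _; apply: le.
have -> : \sum_x \sum_y \sum_(d <- undup s) P d x y = \sum_(d <- undup s) \sum_x \sum_y P d x y.
  by rewrite [RHS]exchange_big; apply: eq_bigr => x _; rewrite [RHS]exchange_big.
exact: (sum_nat_ge two).
Qed.

Lemma nth_vs3 (V : Type) (x0 : V) (L : seq (V * V * V)) i : i < size L ->
  [/\ nth x0 (vs3 L) (3 * i) = (nth (x0, x0, x0) L i).1.1,
      nth x0 (vs3 L) (3 * i).+1 = (nth (x0, x0, x0) L i).1.2 &
      nth x0 (vs3 L) (3 * i).+2 = (nth (x0, x0, x0) L i).2].
Proof.
elim: L i => // t L IH [|i] //; rewrite mulnS !addSn add0n; exact: IH.
Qed.

(** Vertex [(i, a)] goes to place [3 * i + a] of the flattened packing. *)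
Lemma packing_rainbow_copy k (x0 : 'I_n) : has_packing col (enum 'I_n) k ->
  ~~ rainbow_free c (disjoint_triangles k).
Proof.
move=> [g [L [[gS gI gR] tL uL _ kL]]]; rewrite negbK.
pose h := [ffun p : 'I_k * 'I_3 => nth x0 (vs3 L) (3 * p.1 + p.2)].
have lt3 (p : 'I_k * 'I_3) : 3 * p.1 + p.2 < size (vs3 L).
  have := ltn_ord p.1; have := ltn_ord p.2; rewrite size_vs3; move: kL (nat_of_ord p.1) (nat_of_ord p.2).
  by move: (size L); clear; lia.
have hinj : injective h.
  move=> p q; rewrite !ffunE => /eqP; rewrite nth_uniq // => /eqP.
  case: p q => i a [i' a'] /= e; have := ltn_ord a; have := ltn_ord a'.
  by move=> h1 h2; congr pair; apply: val_inj => /=; move: e h1 h2; clear; lia.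
have gh (p q : disjoint_triangles k) : adj p q -> g (h p) (h q).
  case: p q => i a [i' a'] /andP[/= /eqP <- ne]; rewrite !ffunE /=.
  have iL : i < size L by apply: leq_trans kL.
  have [e0 e1 e2] := nth_vs3 x0 iL; have /and3P[t1 t2 t3] := allP tL _ (mem_nth (x0, x0, x0) iL).
  move: ne; rewrite -val_eqE; case: a a' => [[|[|[|//]]] ?] [[|[|[|//]]] ?] //= _;
  by rewrite ?addn0 ?addn1 ?addn2 ?e0 ?e1 ?e2 // gS.
apply/existsP; exists h; apply/andP; split.
  apply/andP; split; first by apply/injectiveP.
  apply/forallP => p; apply/forallP => q; apply/implyP => /gh ghpq.
  by apply/eqP => e; move: ghpq; rewrite e gI.
apply/dinjectiveP => _ _ /imsetP[[p q] /[!inE] /= pq ->] /imsetP[[p' q'] /[!inE] /= pq' ->].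
rewrite !imsetU1 !imset_set1 => e; apply: (imset_inj hinj); rewrite !imsetU1 !imset_set1.
have /orP[/andP[/eqP-> /eqP->]|/andP[/eqP-> /eqP->]] // := gR _ _ _ _ (gh _ _ pq) (gh _ _ pq') e.
by rewrite setUC.
Qed.

End AntiRamsey.

Lemma ar_lt_threshold n j F : 0 < n -> (forall V D : eqType, forall col : V -> V -> D,
   (forall x y, col x y = col y x) -> edge_threshold col j n F) ->
  2 * ar n (disjoint_triangles j.+1) < F + 2.
Proof.
case: n => // n _ th; rewrite ltnNge; apply/negP => le.
have /ar_attained[c fc nc] : 0 < ar n.+1 (disjoint_triangles j.+1) by move: le; clear; lia.
have [g rg Eg] := rainbow_representatives c.
have colC (x y : 'I_n.+1) : c [set x; y] = c [set y; x] by rewrite setUC.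
have := th _ _ _ colC (enum 'I_n.+1) g (enum_uniq _) _ rg; rewrite size_enum_ord => /(_ erefl).
rewrite nc in Eg => /(_ (leq_trans le Eg)) /(packing_rainbow_copy ord0).
by rewrite fc.
Qed.

Lemma twice_bin2 m : 2 * 'C(m, 2) = m * m.-1.
Proof. by have := bin_ffact m 2; rewrite ffactnS ffactn1 mulnC. Qed.

(** The bound doubled, with the subtracted term moved to the left, so that it can be stated in the
    naturals. *)
Lemma ar_nat_bound k n : 2 <= k -> 3 * k <= n -> n <= 2 * k ^ 2 - k + 2 ->
  2 * ar n (disjoint_triangles k) + (n - 3 * k) <=
  2 * ((n - k + 2) ^ 2 %/ 4 + (k - 2) * (n - k + 2) + 'C(k - 2, 2) + (k - 1) ^ 2) + 2.
Proof.
case: k => [|[|j]] // _ h1 h2.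
have n0 : 0 < n by move: h1; clear; lia.
have even_or_odd : exists s, n = 3 * j.+2 + 2 * s \/ n = 3 * j.+2 + 2 * s + 1.
  by exists (n - 3 * j.+2)./2; move: h1; clear; lia.
have b2 := twice_bin2 j; rewrite !subSS !subn0; case: even_or_odd => s [] en.
- have th V D col cC := (@edge_thresholds V D col cC j.+1 s).1.
  have := ar_lt_threshold n0 (F := threshold_even j.+1 s) (j := j.+1); rewrite {1}en => /(_ th).
  have -> : n - j.+2 + 2 = 2 * (j + s + 3) by rewrite en; clear; lia.
  have -> : (2 * (j + s + 3)) ^ 2 %/ 4 = (j + s + 3) ^ 2 by rewrite expnMn mulKn.
  have -> : n - 3 * j.+2 = 2 * s by rewrite en; clear; lia.
  (* The upper limit on [n] says exactly that the difference in the threshold is not truncated. *)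
  have sj : s <= j.+1 ^ 2 by move: h2; rewrite en; clear; nia.
  have : threshold_even j.+1 s + 2 * s = 2 * ((j + s + 3) ^ 2 + j * (2 * (j + s + 3)) + 'C(j, 2) + j.+1 ^ 2) + 2.
    move: b2; rewrite /threshold_even -{2}(subnKC sj); move: ('C(j, 2)) (j.+1 ^ 2 - s) => C d; clear.
    case: j => [|j] /=; nia.
  by move: (ar _ _) (threshold_even _ _); clear; lia.
have th V D col cC := (@edge_thresholds V D col cC j.+1 s).2.
have := ar_lt_threshold n0 (F := threshold_odd j.+1 s) (j := j.+1); rewrite {1}en => /(_ th).
have -> : n - j.+2 + 2 = 2 * (j + s + 3) + 1 by rewrite en; clear; lia.
have -> : (2 * (j + s + 3) + 1) ^ 2 %/ 4 = (j + s + 3) * (j + s + 4).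
  have -> : (2 * (j + s + 3) + 1) ^ 2 = 1 + (j + s + 3) * (j + s + 4) * 4 by clear; nia.
  by rewrite divnDMl.
have -> : n - 3 * j.+2 = 2 * s + 1 by rewrite en; clear; lia.
have sj : s.+1 <= j.+1 ^ 2 by move: h2; rewrite en; clear; nia.
have : threshold_odd j.+1 s + 2 * s =
    2 * ((j + s + 3) * (j + s + 4) + j * (2 * (j + s + 3) + 1) + 'C(j, 2) + j.+1 ^ 2).
  move: b2; rewrite /threshold_odd -{2}(subnKC sj); move: ('C(j, 2)) (j.+1 ^ 2 - s.+1) => C d; clear.
  case: j => [|j] /=; nia.
by move: (ar _ _) (threshold_odd _ _); clear; lia.
Qed.

Import Order.TTheory GRing.Theory Num.Theory.
Local Open Scope ring_scope.

Theorem theorem1p3 (k n : nat) (hk : (2 <= k)%N) (hn3k : (3 * k <= n)%N)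
    (hn : (n <= 2 * k ^ 2 - k + 2)%N) :
  (ar n (disjoint_triangles k))%:R <=
    ((n - k + 2) ^ 2 %/ 4)%N%:R + ((k - 2) * (n - k + 2))%N%:R
    + 'C(k - 2, 2)%:R + ((k - 1) ^ 2)%N%:R - (n%:R - (3 * k)%N%:R) / 2 + 1 :> rat.
Proof.
have := ar_nat_bound hk hn3k hn; rewrite -natrB //.
rewrite -(ler_nat rat) !(natrD, natrM _ 2).
move: ((ar _ _)%:R) ((_ %/ 4)%:R) ((_ * _)%:R) ('C(_, _)%:R) ((_ ^ 2)%:R) ((n - _)%:R) => a b c d e f.
lra.
Qed.
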